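(* Let $H:\mathbb{C}^n\to\mathbb{R}$ be smooth with $H=0$ in a neighbourhood of $0$ and $H(x)=(1+\epsilon)|x|^2$ for $|x|$ large, where $\epsilon>0$. Let $\mathcal{L}_H$, $E^{\pm}$, $\Sigma_\tau$, $\Gamma_\alpha$, $\tau,\alpha,\beta$ be as in the context; in particular $\tau>\alpha>0$ and $\beta>0$ satisfy $\mathcal{L}_H\le 0$ on $\partial\Sigma_\tau$ and $\mathcal{L}_H\ge\beta$ on $\Gamma_\alpha$. Then there exists a critical point $x$ of $\mathcal{L}_H$ with $\mathcal{L}_H(x)\ge\beta$.
   Context: Let $S^1=\mathbb{R}/2\pi\mathbb{Z}$ and let $\mathfrak{B}=L^2_{1/2}(S^1,\mathbb{C}^n)$ be the Hilbert space of loops $\gamma(\theta)=\sum_{m\in\mathbb{Z}}c_me^{im\theta}$ with $\|\gamma\|^2_{L^2_{1/2}}=\sum_m|c_m|^2|m|+|c_0|^2<\infty$. Let $J$ be the standard complex structure on $\mathbb{C}^n$ (multiplication by $\sqrt{-1}$) and $\langle\cdot,\cdot\rangle$ the real inner product. The action functional is $$\mathcal{L}_H(\gamma)=\int_{S^1}\tfrac12\langle -J\dot\gamma(\theta),\gamma(\theta)\rangle-H(\gamma(\theta))\,d\theta$$ (the quadratic term being extended continuously to $\mathfrak{B}$); its formal $L^2$-gradient is $-J\partial_\theta\gamma-\nabla H(\gamma)$, so its critical points are $2\pi$-periodic orbits of the Hamiltonian vector field $J\nabla H$. Let $E^+\subset\mathfrak{B}$ be the closed span of the eigenvectors of $-J\partial_\theta$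 with positive eigenvalue and $E^-$ the closed span of those with nonpositive eigenvalue, so $\mathfrak{B}=E^+\oplus E^-$. Fix a unit vector $e^+\in E^+$ and set $$\Sigma_\tau=\{\gamma^-+se^+ : \gamma^-\in E^-,\ \|\gamma^-\|_{L^2_{1/2}}\le\tau,\ 0\le s\le\tau\},\qquad \Gamma_\alpha=\{\gamma\in E^+ : \|\gamma\|_{L^2_{1/2}}=\alpha\}.$$ $\partial\Sigma_\tau$ denotes the boundary of $\Sigma_\tau$ relative to $E^-\oplus\mathbb{R}e^+$. The constants $\tau,\alpha,\beta>0$ are fixed so that $\mathcal{L}_H|_{\partial\Sigma_\tau}\le0$ ($\tau$ large), $\mathcal{L}_H|_{\Gamma_\alpha}\ge\beta$, and $\Sigma_\tau\cap\Gamma_\alpha=\{\alpha e^+\}$ (so $\tau>\alpha$). *)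

(* Defs.v *)
From HB Require Import structures.
From mathcomp Require Import all_boot all_order all_algebra.
From mathcomp Require Import all_classical all_reals all_analysis.

Set Implicit Arguments.
Unset Strict Implicit.
Unset Printing Implicit Defensive.

Import Order.TTheory GRing.Theory Num.Theory.
Import numFieldNormedType.Exports.

Local Open Scope classical_set_scope.
Local Open Scope ring_scope.

(** [cspace R n] is C^n, with z = x + sqrt(-1) y encoded as the pair (x, y) of
    its real and imaginary parts, so that real differentiability of functions
    on C^n is the library's. *)
Definition cspace (R : realType) (n : nat) : normedModType R :=
  ('rV[R]_n * 'rV[R]_n)%type.

(** [loop R n] : loops in C^n are functions of the real variable theta;
    2 pi-periodicity is part of [sob_half] and of [C1loop].  Elements of
    L^2_{1/2} are represented by functions, [lnorm (g - h) = 0] playing the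
    role of equality (that is, equality almost everywhere); the subsets of
    [sob_half] and the functions on it defined below are invariant under it. *)
Definition loop (R : realType) (n : nat) : lmodType R := R -> cspace R n.

Section LoopSpace.
Context {R : realType} {n : nat}.
Implicit Types (z w : cspace R n) (g h : loop R n) (m : int).

Definition Jmul z : cspace R n := (- z.2, z.1).

Definition rdot z w : R :=
  \sum_(j < n) (z.1 ord0 j * w.1 ord0 j + z.2 ord0 j * w.2 ord0 j).

(** The Euclidean norm; the norm [`|z|] carried by the product type is the
    supremum norm. *)
Definition enorm z : R := Num.sqrt (rdot z z).

(** e^{it} z *)
Definition cis (t : R) z : cspace R n := cos t *: z + sin t *: Jmul z.

Definition circle : set R := `[0, 2 * pi].

Definition cint g : cspace R n :=
  (\row_(j < n) \int[lebesgue_measure]_(t in circle) (g t).1 ord0 j,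
   \row_(j < n) \int[lebesgue_measure]_(t in circle) (g t).2 ord0 j).

Definition fcoef g m : cspace R n :=
  (2 * pi)^-1 *: cint (fun t => cis (- (m%:~R * t)) (g t)).

Definition loop_periodic g := forall t, g (t + 2 * pi) = g t.

Definition square_integrable g :=
  (forall j, measurable_fun setT (fun t => (g t).1 ord0 j)) /\
  (forall j, measurable_fun setT (fun t => (g t).2 ord0 j)) /\
  lebesgue_measure.-integrable circle (fun t => (rdot (g t) (g t))%:E).

Definition lnorm2 g : \bar R :=
  (\esum_(m in [set: int]) (enorm (fcoef g m) ^+ 2 * `|m%:~R|)%:E
   + (enorm (fcoef g 0) ^+ 2)%:E)%E.

Definition lnorm g : R := Num.sqrt (fine (lnorm2 g)).

(** The space L^2_{1/2}(S^1, C^n). *)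
Definition sob_half : set (loop R n) :=
  [set g | loop_periodic g /\ square_integrable g /\ (lnorm2 g < +oo)%E].

Definition C1loop g :=
  loop_periodic g /\ (forall t, derivable g t 1) /\ continuous (derive1 g).

Definition symplectic_action g : R :=
  \int[lebesgue_measure]_(t in circle) (2^-1 * rdot (- Jmul (derive1 g t)) (g t)).

(** The continuous extension of [symplectic_action] from continuously
    differentiable loops to L^2_{1/2}: its limit at [g] along such loops. *)
Definition symplectic_action_ext g : R :=
  lim (symplectic_action @
       filter_from [set e : R | 0 < e]
         (fun e => [set h | C1loop h /\ lnorm (h - g) < e])).

Definition action (H : cspace R n -> R) g : R :=
  symplectic_action_ext g - \int[lebesgue_measure]_(t in circle) H (g t).

Definition eigenloop (lam : R) g :=
  C1loop g /\ forall t, - Jmul (derive1 g t) = lam *: g t.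

Definition closed_span (P : set (loop R n)) : set (loop R n) :=
  [set g | sob_half g /\ forall e : R, 0 < e ->
     exists k (a : 'I_k -> R) (b : 'I_k -> loop R n),
       (forall i, P (b i)) /\ lnorm (g - \sum_(i < k) a i *: b i) < e].

Definition Eplus : set (loop R n) :=
  closed_span [set g | exists2 lam : R, 0 < lam & eigenloop lam g].

Definition Eminus : set (loop R n) :=
  closed_span [set g | exists2 lam : R, lam <= 0 & eigenloop lam g].

Definition Eminus_line (ep : loop R n) : set (loop R n) :=
  [set g | exists gm (s : R), Eminus gm /\ g = gm + s *: ep].

Definition Sigma (ep : loop R n) (tau : R) : set (loop R n) :=
  [set g | exists gm (s : R),
     [/\ Eminus gm, lnorm gm <= tau, 0 <= s <= tau & g = gm + s *: ep]].

Definition Gamma (alpha : R) : set (loop R n) :=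
  [set g | Eplus g /\ lnorm g = alpha].

(** The topological boundary of [A] relative to the subspace [F]. *)
Definition rel_boundary (F A : set (loop R n)) : set (loop R n) :=
  [set g | F g /\ forall e : R, 0 < e ->
     (exists2 h, (F `&` A) h & lnorm (h - g) < e) /\
     (exists2 h, (F `\` A) h & lnorm (h - g) < e)].

(** [L] is Frechet differentiable at [g], as a function on L^2_{1/2}, and its
    differential at [g] is the zero functional. *)
Definition critical_point (L : loop R n -> R) g :=
  sob_half g /\ forall e : R, 0 < e -> exists2 d : R, 0 < d &
    forall h, sob_half h -> lnorm h <= d -> `|L (g + h) - L g| <= e * lnorm h.

Fixpoint Ck (k : nat) (f : cspace R n -> R) : Prop :=
  match k with
  | 0 => continuous f
  | k'.+1 => (forall z, differentiable f z) /\ forall v, Ck k' ('D_v f)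
  end.

Definition smooth (f : cspace R n -> R) := forall k, Ck k f.

End LoopSpace.

(* Main.v *)
Require Import Defs.
From HB Require Import structures.
From mathcomp Require Import all_boot all_order all_algebra.
From mathcomp Require Import fingroup perm.
From mathcomp Require Import all_classical all_reals all_analysis.
From mathcomp Require Import measurable_realfun measurable_fun_approximation simple_functions.
From mathcomp Require Import finmap zify ring lra.
Set Implicit Arguments.
Unset Strict Implicit.
Unset Printing Implicit Defensive.
Import Order.TTheory GRing.Theory Num.Theory.
Import numFieldNormedType.Exports.

(** The minimax argument on the linking sets Sigma and Gamma is carried out on
    trigonometric polynomials, where the action is a function of finitely many
    real variables, and the critical point is a limit of almost critical
    trigonometric polynomials.

    Fixed degree N.  One step of steepest descent, switched off where the
    action is at most beta / 2 and of full length where it is at least beta,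
    lowers the action by a multiple of the squared gradient
    ([descent_step_decrease]).  After replacing e^+ by its truncation the
    action is still at most beta / 2 on the boundary of Sigma, so the iterates
    of the step fix that boundary.  The Poincare-Miranda theorem
    ([poincare_miranda]), applied to the E^- coordinates and to the squared
    norm of the E^+ part minus alpha ^ 2, then produces for every k a point of
    Sigma whose k-th iterate lies on Gamma ([linking_point]).  Along these k
    steps the action stays above beta and starts below a bound independent of
    k; hence one of them starts at a point with an arbitrarily small gradient
    and action at least beta ([galerkin_critical]).

    Bounds independent of N.  With kap = 2 (1 + eps), the gradient of H is
    kap z plus a bounded perturbation supported in a ball.  A small gradient
    therefore controls every Fourier coefficient but the one whose index is
    nearest to kap.  If that one is large, the whole loop avoids the ball, the
    problem is linear along it, and its action is at most a constant times the
    squared gradient, which is less than beta ([coef_bound]).  This covers the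
    case where kap is an integer, in which the linear problem at infinity is
    degenerate.

    Limit.  The bounds give square summability of (1 + |m|) |c_m|, which makes
    the almost critical polynomials converge in L^2_{1/2}, along an
    ultrafilter, to a loop ([loop_of_coef], [lnorm_limit]).  The action
    ([action_dist]) and each Fourier coefficient of the gradient
    ([fcoef_grad_along_dist]) are continuous, so the limit has action at least
    beta and solves m x_m = (grad H (x))_m for all m; as the Taylor remainder
    of H is quadratic, it is a critical point ([critical_of_eq]).

    Three classical facts are proved on the way: the Poincare-Miranda theorem,
    from a labelling lemma whose parity argument is a mod 2 cup product
    ([kuhn_labelling]); Parseval's identity, from the density of
    trigonometric polynomials in L^2 ([parseval]); and the formula
    pi * sum_m m |g_m|^2 for the extended quadratic part of the action
    ([symplectic_action_extE]). *)

(** * A labelling lemma on the triangulated cube *)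

Section CubicalCup.
Context (V : eqType).
Implicit Types (l m : V -> bool) (c : seq V).

(** A cochain mod 2 on the full simplex with vertex set V: [Vtx m] is the
    0-cochain m, [Edge l] is the coboundary of the 0-cochain l. *)
Inductive factor := Vtx of (V -> bool) | Edge of (V -> bool).

(** The value on an ordered simplex of the cup product of the cochains fs. *)
Fixpoint cup (fs : seq factor) c : bool :=
  match fs, c with
  | [::], _ => true
  | Vtx m :: fs', y :: _ => m y && cup fs' c
  | Edge l :: fs', y :: ((y' :: _) as c') => (l y' (+) l y) && cup fs' c'
  | _, _ => false
  end.

Definition del (u : nat) c := take u c ++ drop u.+1 c.

(** The coboundary mod 2 of a cup product, as a sum over the faces. *)
Definition cobd (fs : seq factor) c : bool :=
  \big[addb/false]_(u < size c) cup fs (del u c).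

Lemma big_addb_andl (I : Type) (r : seq I) (b : bool) (F : I -> bool) :
  \big[addb/false]_(i <- r) (b && F i) = b && \big[addb/false]_(i <- r) F i.
Proof. by rewrite big_distrr. Qed.

Lemma cobd_cons fs y c : cobd fs (y :: c) =
  cup fs c (+) \big[addb/false]_(u < size c) cup fs (y :: del u c).
Proof.
by rewrite /cobd /= big_ord_recl /= {1}/del /= ?drop0; congr (_ (+) _).
Qed.

Lemma cobd_Edge l fs y y' y'' c :
  cobd (Edge l :: fs) [:: y, y', y'' & c] =
  (l y' (+) l y) && cobd fs [:: y', y'' & c].
Proof.
rewrite 2!cobd_cons /= big_ord_recl /= {1}/del /= ?drop0.
rewrite -[X in _ (+) (_ (+) X)]/(\big[addb/false]_(i < size (y'' :: c)) ((l y' (+) l y) && cup fs (y' :: del i (y'' :: c)))).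
rewrite big_addb_andl.
set e := cup _ _; set S := \big[_/_]_(_ < _) _.
by case: (l y); case: (l y'); case: (l y''); case: e; case: S.
Qed.

Lemma cobd_Edges ls c : size c = (size ls).+2 ->
  cobd (map Edge ls) c = false.
Proof.
elim: ls c => [|l ls IH] [|y [|y' [|y'' c]]] //= sc.
  by rewrite /cobd /= !big_ord_recl big_ord0.
by rewrite cobd_Edge IH ?andbF //=; case: sc => ->.
Qed.

Lemma cobd_Vtx_Edges m ls c : size c = (size ls).+2 ->
  cobd (Vtx m :: map Edge ls) c = cup (Edge m :: map Edge ls) c.
Proof.
case: c => [|y [|y' c]] // sc.
have := cobd_Edges sc; rewrite !cobd_cons /=.
rewrite big_addb_andl.
set e := cup _ (y' :: _); set S := \big[_/_]_(_ < _) _.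
by case: (m y); case: (m y'); case: e; case: S.
Qed.

(** The Leibniz rule: the factors [Edge l] are coboundaries, hence have
    coboundary zero, and only the 0-cochain m contributes, by its own
    coboundary [Edge m]. *)
Lemma cup_coboundary ls1 m ls2 c : size c = (size ls1 + size ls2).+2 ->
  cobd (map Edge ls1 ++ Vtx m :: map Edge ls2) c =
  cup (map Edge (ls1 ++ m :: ls2)) c.
Proof.
elim: ls1 c => [|l ls IH] c; first exact: cobd_Vtx_Edges.
case: c => [|y [|y' [|y'' c]]] // sc.
by rewrite [LHS]cobd_Edge IH //; case: sc => /= ->.
Qed.

Lemma cup_addE ls1 l l' ls2 c :
  cup (map Edge (ls1 ++ l :: ls2)) c (+) cup (map Edge (ls1 ++ l' :: ls2)) c =
  cup (map Edge (ls1 ++ (fun x => l x (+) l' x) :: ls2)) c.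
Proof.
elim: ls1 c => [|k ls IH] [|y [|y' c]] //=.
  by case: (l y); case: (l y'); case: (l' y); case: (l' y'); case: (cup _ _).
by rewrite -IH; case: (k y'); case: (k y).
Qed.

Lemma cup_Edge_const fs1 l fs2 c b : {in c, forall y, l y = b} ->
  cup (fs1 ++ Edge l :: fs2) c = false.
Proof.
elim: fs1 c => [|[m|k] fs1 IH] [|y [|y' c]] //= lb.
- by rewrite !lb ?inE ?eqxx ?orbT // addbb.
- by rewrite IH ?andbF.
- by rewrite IH ?andbF.
- by rewrite IH ?andbF // => z zc; apply: lb; rewrite inE zc orbT.
Qed.

Lemma cup_Vtx_eq0 fs1 m fs2 c : {in c, forall y, m y = false} ->
  cup (fs1 ++ Vtx m :: fs2) c = false.
Proof.
elim: fs1 c => [|[m'|k] fs1 IH] [|y [|y' c]] //= lb.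
- by rewrite lb ?mem_head.
- by rewrite lb ?mem_head.
- by rewrite IH ?andbF.
- by rewrite IH ?andbF.
- by rewrite IH ?andbF // => z zc; apply: lb; rewrite inE zc orbT.
Qed.

Lemma cup_EdgesE (I : Type) (l : I -> V -> bool) (r : seq I) (v : nat -> V) a :
  cup (map Edge (map l r)) (map v (iota a (size r).+1)) =
  \big[andb/true]_(k <- zip r (iota a (size r)))
     (l k.1 (v k.2.+1) (+) l k.1 (v k.2)).
Proof.
elim: r a => [|i r IH] a /=; first by rewrite big_nil.
by rewrite big_cons -IH.
Qed.

End CubicalCup.

(** Each x cancels with h x; P selects one element of each pair. *)
Lemma big_addb_invol (T : finType) (F P : pred T) (h : T -> T) :
  involutive h -> (forall x, F (h x) = F x) -> (forall x, P (h x) = ~~ P x) ->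
  \big[addb/false]_(x : T) F x = false.
Proof.
move=> hK Fh Ph; rewrite (bigID P) /= [X in _ (+) X](reindex_inj (inv_inj hK)) /=.
under [X in _ (+) X]eq_bigl do rewrite Ph negbK.
by under [X in _ (+) X]eq_bigr do rewrite Fh; rewrite addbb.
Qed.

Section KuhnLemma.
Context (D p : nat) (p_gt0 : 0 < p).
Local Notation vertex := {ffun 'I_D -> nat}.
Implicit Types (l : 'I_D -> vertex -> bool) (q : {ffun 'I_D -> 'I_p}) (s : 'S_D).

(** The vertices of a Kuhn simplex: walk from [q] to its opposite corner,
    incrementing the coordinate [i] at step [s i]. *)
Definition kuhn q s (k : nat) : vertex := [ffun i => q i + (s i < k)].

Definition in_box (x : vertex) := forall i, x i <= p.

Lemma kuhn_in_box q s k : in_box (kuhn q s k).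
Proof. by move=> i; rewrite ffunE (leq_trans _ (ltn_ord (q i))) // -[(q i).+1]addn1 leq_add2l leq_b1. Qed.

Definition chain q s := map (kuhn q s) (iota 0 D.+1).

(** The number mod 2 of Kuhn simplices along which every label changes in turn.
    It does not depend on the labelling, once the values on the faces of the
    box are prescribed. *)
Definition cupsum l : bool :=
  \big[addb/false]_(qs : {ffun 'I_D -> 'I_p} * 'S_D)
     cup (map (@Edge _) [seq l k | k <- enum 'I_D]) (chain qs.1 qs.2).

Definition face_labels l := forall i x, in_box x ->
  (x i = 0 -> l i x = false) /\ (x i = p -> l i x = true).

(** A face obtained by dropping an interior vertex no longer records in which
    order the two steps around that vertex were made, so it comes from exactly
    two Kuhn simplices of its cell. *)
Lemma face_cancel (fs : seq (factor vertex)) u : 0 < u -> u < D ->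
  \big[addb/false]_(qs : {ffun 'I_D -> 'I_p} * 'S_D) cup fs (del u (chain qs.1 qs.2))
  = false.
Proof.
move=> u0 uD.
rewrite -(pair_big xpredT xpredT (fun q s => cup fs (del u (chain q s)))) /=.
apply: big1 => q _.
have uD' : u.-1 < D by rewrite (leq_ltn_trans (leq_pred _)).
set a := Ordinal uD'; set b := Ordinal uD.
have ab : a != b by rewrite -val_eqE /= neq_ltn prednK // leqnn.
pose h s : 'S_D := (s * tperm a b)%g.
apply: (@big_addb_invol _ _ (fun s : 'S_D => (s^-1)%g a < (s^-1)%g b) h).
- by move=> s; rewrite /h -mulgA tperm2 mulg1.
- move=> s; congr (cup fs _); rewrite /del /chain -!map_take -!map_drop -!map_cat.
  have E k : k <> u -> kuhn q (h s) k = kuhn q s k.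
    move=> ku; apply/ffunP => i; rewrite !ffunE /h permM; congr (_ + nat_of_bool _).
    case: tpermP => [->|->|//] /=.
      apply/idP/idP => H; first by rewrite (leq_ltn_trans (leq_pred _)).
      by rewrite ltn_neqAle (introN eqP (nesym ku)) -(prednK u0).
    apply/idP/idP => H; last by rewrite (leq_ltn_trans (leq_pred _)).
    by rewrite ltn_neqAle (introN eqP (nesym ku)) -(prednK u0).
  apply/eq_in_map => k; rewrite mem_cat take_iota drop_iota !mem_iota add0n add0n => H.
  apply: E => ku; subst k; move: H.
  by rewrite ltnn /= orbF leq_min ltnn.
- move=> s; rewrite /h invMg !permM tpermV tpermL tpermR -leqNgt ltn_neqAle.
  by rewrite val_eqE (inj_eq perm_inj) eq_sym ab.
Qed.

Lemma del_last q s : del D (chain q s) = map (kuhn q s) (iota 0 D).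
Proof.
by rewrite /del /chain -map_take -map_drop take_iota drop_iota (minn_idPl _) // subnn cats0.
Qed.

Lemma del_first q s : del 0 (chain q s) = map (kuhn q s) (iota 1 D).
Proof. by rewrite /del /chain take0 -map_drop drop_iota subn1. Qed.

(** Without its first vertex, a Kuhn simplex is also one of the neighbouring
    cell without its last vertex. For a cell at the end of the box, the map h
    below wraps around to the opposite end; both terms are then zero because
    the faces lie in the boundary of the box. *)
Lemma extreme_faces (fs : seq (factor vertex)) : 0 < D ->
  (forall i c, {in c, forall y, in_box y /\ y i = 0} -> cup fs c = false) ->
  (forall i c, {in c, forall y, in_box y /\ y i = p} -> cup fs c = false) ->
  \big[addb/false]_(qs : {ffun 'I_D -> 'I_p} * 'S_D) cup fs (del 0 (chain qs.1 qs.2))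
  = \big[addb/false]_(qs : {ffun 'I_D -> 'I_p} * 'S_D) cup fs (del D (chain qs.1 qs.2)).
Proof.
move=> D0 F0 Fp.
pose o : 'I_D := Ordinal D0.
pose cyc : 'S_D := perm (@ord_pred_inj D).
pose h (qs : {ffun 'I_D -> 'I_p} * 'S_D) : {ffun 'I_D -> 'I_p} * 'S_D :=
  ([ffun i => if i == (qs.2^-1)%g o then ordS (qs.1 i) else qs.1 i], (qs.2 * cyc)%g).
have hI : injective h.
  move=> [q s] [q' s'] [] /= /ffunP Hq /mulIg ss; subst s'; congr pair.
  apply/ffunP => i; move: (Hq i); rewrite !ffunE; case: ifP => // _.
  exact: (@ordS_inj p).
rewrite [RHS](reindex_inj hI) /=; apply: eq_bigr => -[q s] _ /=.
rewrite del_first del_last.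
set i := (s^-1)%g o.
have si : s i = o by rewrite /i permKV.
case: (eqVneq (q i).+1 p) => [qp|qp].
  rewrite (Fp i) ?(F0 i) // => y /mapP[k]; rewrite mem_iota => /andP[k0 kD] ->;
    split; try exact: kuhn_in_box.
    rewrite /h /= !ffunE eqxx permM permE si /=.
    rewrite qp modnn add0n add0n modn_small ?prednK // leqNgt.
    by rewrite -[X in _ < X]add0n kD.
  by rewrite ffunE si /= k0 addn1.
congr (cup fs _); rewrite -[iota 1 D]/(iota (1 + 0) D) iotaDl -map_comp.
apply/eq_in_map => k; rewrite mem_iota add0n => /andP[_ kD] /=.
apply/ffunP => j; rewrite /h /= !ffunE permM permE /=.
have qS : (q i).+1 < p by rewrite ltn_neqAle qp ltn_ord.
case: (eqVneq j i) => [->|ji].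
  have -> : (ordS (q i) : nat) = (q i).+1 by rewrite /= modn_small.
  have -> : (s i + D).-1 %% D < k = false.
    by rewrite si add0n modn_small ?prednK // leqNgt kD.
  by rewrite si addn0 addn1.
have sj : 0 < s j.
  rewrite lt0n; apply/eqP => H; case/eqP: ji; apply: (@perm_inj _ s).
  by apply: val_inj; rewrite si.
have -> : ((s j + D).-1 %% D) = (s j).-1.
  rewrite -[in (s j + D)](prednK sj) addSn /= modnDr modn_small //.
  by rewrite (leq_ltn_trans (leq_pred _)).
by rewrite add1n -[in LHS](prednK sj) ltnS.
Qed.

Definition top_label (a : 'I_D) (x : vertex) := x a == p.

(** The two products differ by the coboundary of the product in which the label
    a is replaced by the 0-cochain l a + l' a. Its faces cancel in pairs, or
    lie in the boundary of the box, where either some other label is constant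
    or l a and l' a agree. *)
Lemma cupsum_update l l' a : face_labels l -> l' a = top_label a ->
  (forall i, i != a -> l' i = l i) -> cupsum l = cupsum l'.
Proof.
move=> fl l'a l'E; apply/eqP; rewrite -[_ == _]negbK negb_eqb; apply/negPf.
rewrite /cupsum -big_split /=.
have D0 : 0 < D by case: (a) => ?; apply: leq_ltn_trans.
have ua := enum_uniq 'I_D; have sa := size_enum_ord D.
have [r1 [r2 Er]] : exists r1 r2, enum 'I_D = r1 ++ a :: r2.
  have : a \in enum 'I_D by rewrite mem_enum.
  by case/splitPr => r1 r2; exists r1, r2.
move: ua sa; rewrite Er.
rewrite cat_uniq /= => /and4P[_ /norP[ar1 _] ar2 _] sr.
have El r : a \notin r -> map l' r = map l r.
  by move=> ar; apply/eq_in_map => i ir; apply: l'E; apply: contraNneq ar => <-.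
pose m x := l a x (+) l' a x.
pose fs := map (@Edge _) (map l r1) ++ Vtx m :: map (@Edge _) (map l r2).
have sr' : (size r1 + size r2).+1 = D by move: sr; rewrite size_cat /= addnS.
transitivity (\big[addb/false]_(qs : {ffun 'I_D -> 'I_p} * 'S_D)
    \big[addb/false]_(u < D.+1) cup fs (del u (chain qs.1 qs.2))).
  (* On each simplex, the change of one factor is a coboundary. *)
  apply: eq_bigr => -[q s] _ /=.
  rewrite [map l (r1 ++ _)]map_cat [map l' (r1 ++ _)]map_cat /= !El // cup_addE.
  rewrite -cup_coboundary; last by rewrite !size_map size_iota sr'.
  by rewrite /cobd size_map size_iota.
(* Only the faces without the first or without the last vertex remain. *)
rewrite exchange_big /= (bigD1 ord0) // (bigD1 ord_max) /=; last first.
  by rewrite -val_eqE /= -lt0n.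
rewrite [X in _ (+) (_ (+) X)]big1 ?addbF; last first.
  move=> u /andP[u0 uD]; apply: face_cancel; first by rewrite lt0n.
  by rewrite ltn_neqAle uD -ltnS ltn_ord.
have fs0 b (i : 'I_D) c : {in c, forall y, in_box y /\ l i y = b} ->
    {in c, forall y, m y = false} \/ i != a -> cup fs c = false.
  move=> li [m0|ia]; first exact: cup_Vtx_eq0.
  have {}li : {in c, forall y, l i y = b} by move=> y /li [].
  have : i \in r1 ++ a :: r2 by rewrite -Er mem_enum.
  rewrite mem_cat inE (negbTE ia) /= /fs => /orP[]/splitPr[? ?].
    by rewrite !map_cat /= -catA /=; apply: cup_Edge_const li.
  by rewrite !map_cat /= -cat_rcons catA; apply: cup_Edge_const li.
rewrite extreme_faces ?addbb // => i c ci.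
  apply: (@fs0 false i) => [y /ci [yb yi]|]; first by split=> //; apply: (fl _ _ yb).1.
  case: (eqVneq i a) => [ia|]; [left|by right] => y /ci [yb yi]; subst i.
  by rewrite /m l'a /top_label yi (fl _ _ yb).1 //=; case: p p_gt0.
apply: (@fs0 true i) => [y /ci [yb yi]|]; first by split=> //; apply: (fl _ _ yb).2.
case: (eqVneq i a) => [ia|]; [left|by right] => y /ci [yb yi]; subst i.
by rewrite /m l'a /top_label yi (fl _ _ yb).2 // eqxx.
Qed.

Lemma cup_chainE l q s : cup (map (@Edge _) [seq l k | k <- enum 'I_D]) (chain q s)
  = [forall k : 'I_D, l k (kuhn q s k.+1) (+) l k (kuhn q s k)].
Proof.
rewrite /chain -[X in iota 0 X.+1](size_enum_ord D) cup_EdgesE size_enum_ord.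
have -> : zip (enum 'I_D) (iota 0 D) = [seq (k, val k) | k <- enum 'I_D].
  by rewrite -val_enum_ord; elim: (enum 'I_D) => //= k r ->.
by rewrite big_map big_enum big_andE.
Qed.

(** Along a Kuhn simplex the label [top_label k] changes only in the last layer
    of cells, at the step that increments the coordinate k: only the identity
    permutation in the last cell makes the labels change in the prescribed
    order. *)
Lemma cupsum_top : cupsum top_label = true.
Proof.
have p1 : p.-1 < p by rewrite prednK.
pose q1 : {ffun 'I_D -> 'I_p} := [ffun _ => Ordinal p1].
rewrite /cupsum (bigD1 (q1, 1%g)) //= cup_chainE big1 ?addbF.
  apply/forallP => k; rewrite /top_label !ffunE perm1 ltnS leqnn ltnn /=.
  by rewrite addn1 prednK // eqxx addn0 ltn_eqF.
move=> [q s] /= qs; apply/negbTE; apply: contra qs.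
rewrite cup_chainE => /forallP H.
have {}H k : s k = k /\ q k = Ordinal p1.
  have := H k; rewrite /top_label !ffunE ltnS.
  case: (ltngtP (s k) k) => [_|_|/val_inj sk] /=; rewrite ?addbb //.
  rewrite addn1 addn0 (ltn_eqF (ltn_ord _)) addbF => /eqP qp.
  by split=> //; apply: val_inj; apply/eqP; rewrite -eqSS prednK //; apply/eqP.
apply/eqP; congr pair; first by apply/ffunP => k; rewrite ffunE (H k).2.
by apply/permP => k; rewrite perm1 (H k).1.
Qed.

Lemma cupsum_face_labels l : face_labels l -> cupsum l = true.
Proof.
move=> fl; pose mix r := fun a : 'I_D => if a < r then top_label a else l a.
have fm r : face_labels (mix r).
  move=> i x xb; rewrite /mix; case: ifP => _; last exact: fl.
  by rewrite /top_label; split=> ->; rewrite ?eqxx // ltn_eqF.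
have mixS r : r <= D -> cupsum (mix r) = cupsum l.
  elim: r => [_|r IH rD]; first by congr cupsum; apply/funext => a.
  rewrite -IH 1?ltnW //; apply/esym/(@cupsum_update _ _ (Ordinal rD)) => //.
    by apply/funext => x; rewrite /mix /= ltnSn.
  move=> i ir; apply/funext => x; rewrite /mix ltnS.
  by rewrite leq_eqVlt (_ : (i == r :> nat) = false) //; apply/negbTE.
rewrite -(mixS D (leqnn D)) -[RHS]cupsum_top; congr cupsum.
by apply/funext => a; rewrite /mix ltn_ord.
Qed.

(** A sum equal to 1 has a nonzero term, that is, a Kuhn simplex along which
    each label takes both values. *)
Theorem kuhn_labelling l : face_labels l ->
  exists q : {ffun 'I_D -> 'I_p}, forall k : 'I_D, exists x y : vertex,
    [/\ forall i, q i <= x i <= (q i).+1, forall i, q i <= y i <= (q i).+1,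
       l k x = false & l k y = true].
Proof.
move=> /cupsum_face_labels; rewrite /cupsum.
have [/existsP[[q s] H] _|/existsPn H] := boolP [exists qs : {ffun 'I_D -> 'I_p} * 'S_D,
   cup (map (@Edge _) [seq l k | k <- enum 'I_D]) (chain qs.1 qs.2)]; last first.
  by rewrite big1 // => qs _; apply/negbTE/H.
exists q => k; move: H; rewrite cup_chainE => /forallP /(_ k).
have B j i : q i <= kuhn q s j i <= (q i).+1.
  by rewrite ffunE leq_addr -[(q i).+1]addn1 leq_add2l leq_b1.
by case E1: (l k _); case E2: (l k _) => // _;
  [exists (kuhn q s k), (kuhn q s k.+1)|exists (kuhn q s k.+1), (kuhn q s k)].
Qed.

End KuhnLemma.

Local Open Scope classical_set_scope.
Local Open Scope ring_scope.

(** * Ultrafilter limits and the Poincare-Miranda theorem *)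

(** Limits along a free ultrafilter of nat take the place of the extraction of
    convergent subsequences: all bounded sequences converge simultaneously. *)
Lemma ultra_lim (R : realType) (T : Type) (U : set_system T) (u : T -> R) (a b : R) :
  UltraFilter U -> (forall t, a <= u t <= b) ->
  exists2 l, a <= l <= b & u t @[t --> U] --> l.
Proof.
move=> UU uab.
have PU := @ultra_proper _ _ UU.
have UA : (u @ U) `[a, b]%classic.
  apply: (@filterS _ U _ setT); last exact: filterT.
  by move=> t _ /=; rewrite in_itv /= uab.
have [l [lab cl]] := @segment_compact R a b _ (fmap_proper_filter _ PU) UA.
exists l; first by move: lab; rewrite /= in_itv.
move=> V lV; have [//|UV] := in_ultra_setVsetC (u @^-1` V) UU.
by have [x [/= Vx]] := cl (~` V) V UV lV.
Qed.

Lemma free_ultrafilter : exists U : set_system nat, UltraFilter U /\ \oo `<=` U.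
Proof. exact: ultraFilterLemma. Qed.

Lemma ultra_cvg (R : realType) (U : set_system nat) (u : nat -> R) (l : R) :
  \oo `<=` U -> u @ \oo --> l -> u @ U --> l.
Proof. by move=> sU ul V /ul /sU. Qed.

Lemma norm_lim_le (R : realType) (T : Type) (F : set_system T) (u : T -> R) (l B : R) :
  ProperFilter F -> u @ F --> l -> (forall t, `|u t| <= B) -> `|l| <= B.
Proof.
move=> PF ul uB; have C : `|u t| @[t --> F] --> `|l| by exact: cvg_norm.
rewrite -(cvg_lim _ C) //; apply: limr_le; first by apply/cvg_ex; exists `|l|.
exact: filterE.
Qed.

(** The signs of the f_i on a grid of mesh 1 / (p + 1) satisfy the boundary
    condition of the labelling lemma, after the upper faces are labelled true
    by decree. The cells that it provides contain, for each i, a point with f_i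
    <= 0 and a point with f_i >= 0; as p grows they shrink to a common zero. *)
Lemma poincare_miranda (R : realType) (I : finType) (a b : I -> R)
    (f : I -> (I -> R) -> R) :
  (forall i, a i < b i) ->
  (forall (F : set_system nat) (x : nat -> I -> R) (x0 : I -> R), ProperFilter F ->
     (forall k i, a i <= x k i <= b i) -> (forall i, x k i @[k --> F] --> x0 i) ->
     forall j, f j (x k) @[k --> F] --> f j x0) ->
  (forall i (x : I -> R), (forall j, a j <= x j <= b j) ->
     (x i = a i -> f i x <= 0) /\ (x i = b i -> 0 <= f i x)) ->
  exists2 x : I -> R, forall j, a j <= x j <= b j & forall j, f j x = 0.
Proof.
move=> ab fc ff.
pose pt (p : nat) (v : {ffun 'I_#|I| -> nat}) : I -> R := fun i =>
  a i + (b i - a i) * ((v (enum_rank i))%:R / p.+1%:R).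
have p0 p : 0 < p.+1%:R :> R by rewrite ltr0n.
have pt_box p v : in_box p.+1 v -> forall i, a i <= pt p v i <= b i.
  move=> vb i; have ba : 0 < b i - a i by rewrite subr_gt0.
  have := vb (enum_rank i); rewrite /pt; set k := v _ => kp.
  rewrite lerDl mulr_ge0 ?divr_ge0 ?ler0n ?(ltW ba) //= -lerBrDl.
  by rewrite ler_piMr ?(ltW ba) // ler_pdivrMr // mul1r ler_nat.
pose l p (k : 'I_#|I|) (v : {ffun 'I_#|I| -> nat}) : bool := (v k == p.+1 :> nat) || (0 < f (@enum_val I (mem I) k) (pt p v)).
have fl p : face_labels p.+1 (l p).
  move=> k v vb; have [f0 f1] := ff (@enum_val I (mem I) k) _ (pt_box _ _ vb).
  rewrite /l; split=> [vk|->]; last by rewrite eqxx.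
  rewrite vk /= ltNge f0 // /pt enum_valK vk mul0r mulr0 addr0 //.
have K p : exists z : (I -> R) * (I -> I -> R) * (I -> I -> R), forall i,
   [/\ forall j, a j <= z.1.1 j <= b j, forall j, a j <= z.1.2 i j <= b j,
       forall j, a j <= z.2 i j <= b j,
     forall j, `|z.1.2 i j - z.1.1 j| <= (b j - a j) / p.+1%:R /\
               `|z.2 i j - z.1.1 j| <= (b j - a j) / p.+1%:R &
       f i (z.1.2 i) <= 0 /\ 0 <= f i (z.2 i)].
  have [q Hq] := kuhn_labelling (ltn0Sn p) (fl p).
  have [x Hx] := choice Hq; have [y {}Hq] := choice Hx.
  pose qn : {ffun 'I_#|I| -> nat} := [ffun i => nat_of_ord (q i)].
  exists (pt p qn, fun i => pt p (x (enum_rank i)), fun i => pt p (y (enum_rank i))) => i.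
  have [qx qy lx ly] := Hq (enum_rank i).
  have qb : in_box p.+1 qn by move=> k; rewrite ffunE ltnW.
  have xb : in_box p.+1 (x (enum_rank i)).
    by move=> k; have /andP[_ H] := qx k; exact: leq_trans H (ltn_ord _).
  have yb : in_box p.+1 (y (enum_rank i)).
    by move=> k; have /andP[_ H] := qy k; exact: leq_trans H (ltn_ord _).
  have near (w : {ffun 'I_#|I| -> nat}) : (forall k, (q k <= w k <= (q k).+1)%N) ->
      forall j, `|pt p w j - pt p qn j| <= (b j - a j) / p.+1%:R.
    move=> qw j; rewrite /pt opprD addrACA subrr add0r -mulrBr -mulrBl.
    have ba : 0 < b j - a j by rewrite subr_gt0.
    rewrite !normrM (gtr0_norm ba) ler_pM2l // normfV (gtr0_norm (p0 p)).
    rewrite ler_pdivrMr // mulVf ?gt_eqF // ffunE.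
    have /andP[H1 H2] := qw (enum_rank j).
    by rewrite ger0_norm ?subr_ge0 ?ler_nat // lerBlDl natr1 ler_nat.
  split=> //=; try exact: pt_box; first by move=> j; split; exact: near.
  move: lx ly; rewrite /l enum_rankK; split; first by case/norP: (negbT lx) => _; rewrite -leNgt.
  case/orP: ly => [/eqP yi|/ltW //]; apply: (ff i _ (pt_box _ _ yb)).2.
  by rewrite /pt yi divff ?gt_eqF // mulr1 addrC subrK.
have {K} [z Hz] := choice K.
have [U [UU sU]] := free_ultrafilter.
have PU := @ultra_proper _ _ UU.
have K2 i : exists t, a i <= t <= b i /\ (z p).1.1 i @[p --> U] --> t.
  have zb p : a i <= (z p).1.1 i <= b i by have [H _ _ _ _] := Hz p i; exact: H.
  have [t tab ut] := ultra_lim UU zb.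
  by exists t.
have {K2} [x0 Hx0] := choice K2.
(* Every vertex of the p-th cell converges to the limit of its corner. *)
have close (w : nat -> I -> R) : (forall p j, `|w p j - (z p).1.1 j| <= (b j - a j) / p.+1%:R) ->
    forall j, w p j @[p --> U] --> x0 j.
  move=> wz j.
  have H0 : (fun p => (b j - a j) / p.+1%:R) @ U --> 0.
    apply: ultra_cvg => //; rewrite -[X in _ --> X](mulr0 (b j - a j)).
    by apply: cvgM; [exact: cvg_cst|exact: cvg_harmonic].
  have Hd : (w p j - (z p).1.1 j) @[p --> U] --> 0.
    apply/norm_cvg0P; apply: (@squeeze_cvgr _ _ _ _ (fun=> 0) (fun p => (b j - a j) / p.+1%:R)) => //.
    - by apply: filterE => p; rewrite normr_ge0 wz.
    - exact: cvg_cst.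
  rewrite -[X in _ --> X]add0r.
  have -> : (fun p => w p j) = (fun p => (w p j - (z p).1.1 j) + (z p).1.1 j).
    by apply/funext => p; rewrite subrK.
  by apply: cvgD => //; exact: (Hx0 j).2.
exists x0; first by move=> j; exact: (Hx0 j).1.
move=> i; apply/eqP; rewrite eq_le; apply/andP; split.
  have C : (f i ((z p).1.2 i)) @[p --> U] --> f i x0.
    apply: fc => [p j|j]; first by have [_ H _ _ _] := Hz p i; exact: H.
    by apply: (close (fun p => (z p).1.2 i)) => p k; have [_ _ _ H _] := Hz p i; exact: (H k).1.
  rewrite -(cvg_lim _ C) //; apply: limr_le; first by apply/cvg_ex; exists (f i x0).
  by apply: filterE => p; have [_ _ _ _ [H _]] := Hz p i.
have C : (f i ((z p).2 i)) @[p --> U] --> f i x0.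
  apply: fc => [p j|j]; first by have [_ _ H _ _] := Hz p i; exact: H.
  by apply: (close (fun p => (z p).2 i)) => p k; have [_ _ _ H _] := Hz p i; exact: (H k).2.
rewrite -(cvg_lim _ C) //; apply: limr_ge; first by apply/cvg_ex; exists (f i x0).
by apply: filterE => p; have [_ _ _ _ [_ H]] := Hz p i.
Qed.

(** * Square integrable functions on the circle *)

Section ScalarL2.
Context {R : realType}.
Local Notation mu := (@lebesgue_measure R).
Local Notation S1 := (@circle R).
Implicit Types f g h : R -> R.

Definition circle_integrable f := mu.-integrable S1 (EFin \o f).
Definition circle_int f : R := \int[mu]_(t in S1) f t.

Lemma measurable_circle : measurable S1. Proof. exact: measurable_itv. Qed.
Hint Resolve measurable_circle : core.

Lemma pi2_gt0 : 0 < 2 * pi :> R. Proof. by rewrite mulr_gt0 ?pi_gt0. Qed.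

Lemma circle_measure : mu S1 = (2 * pi)%:E.
Proof. by rewrite /circle lebesgue_measure_itv /= lte_fin pi2_gt0 -EFinD subr0. Qed.

Lemma circle_integrableD f g : circle_integrable f -> circle_integrable g -> circle_integrable (fun t => f t + g t).
Proof. by move=> fi gi; exact: (@integrableD _ _ _ mu S1 measurable_circle _ _ fi gi). Qed.

Lemma circle_integrableB f g : circle_integrable f -> circle_integrable g -> circle_integrable (fun t => f t - g t).
Proof. by move=> fi gi; exact: (@integrableB _ _ _ mu S1 measurable_circle _ _ fi gi). Qed.

Lemma circle_integrableZ c f : circle_integrable f -> circle_integrable (fun t => c * f t).
Proof. by move=> fi; exact: (@integrableZl _ _ _ mu S1 measurable_circle c _ fi). Qed.

Lemma circle_integrable_sum (I : Type) (r : seq I) (P : pred I) (F : I -> R -> R) :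
  (forall i, P i -> circle_integrable (F i)) -> circle_integrable (fun t => \sum_(i <- r | P i) F i t).
Proof.
move=> Fi; have := @integrable_sum _ _ _ mu S1 measurable_circle I r P (fun i => EFin \o F i) Fi.
by apply: eq_integrable => // t _; rewrite /= sumEFin.
Qed.

(** Domination is required only on the circle, but measurability everywhere, so
    that restrictions of measurability to the circle never have to be carried
    along. *)
Lemma circle_integrable_le f g : measurable_fun setT f -> circle_integrable g -> (forall t, S1 t -> `|f t| <= g t) ->
  circle_integrable f.
Proof.
move=> mf gi fg; apply: (@le_integrable _ _ _ mu S1 measurable_circle _ _ _ _ gi).
  by apply/measurable_EFinP; exact: measurable_funTS.
by move=> t St; rewrite /= lee_fin (le_trans (fg t St)) // ler_norm.
Qed.

Lemma circle_integrable_cst c : circle_integrable (fun=> c).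
Proof.
have fin : (mu S1 < +oo)%E by rewrite circle_measure ltry.
apply: (@measurable_bounded_integrable _ _ _ mu _ _ measurable_circle fin) => //.
by exists `|c|; split; [exact: num_real|move=> x cx t _; exact: ltW].
Qed.

Lemma circle_integrable_bd f M : measurable_fun setT f -> (forall t, S1 t -> `|f t| <= M) -> circle_integrable f.
Proof. by move=> mf fM; apply: (circle_integrable_le mf (circle_integrable_cst M)). Qed.

Lemma circle_integrable_cont f : continuous f -> circle_integrable f.
Proof.
move=> cf; apply: continuous_compact_integrable; first exact: segment_compact.
exact: continuous_subspaceT.
Qed.

Lemma circle_intD f g : circle_integrable f -> circle_integrable g -> circle_int (fun t => f t + g t) = circle_int f + circle_int g.
Proof. by move=> fi gi; exact: RintegralD. Qed.

Lemma circle_intB f g : circle_integrable f -> circle_integrable g -> circle_int (fun t => f t - g t) = circle_int f - circle_int g.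
Proof. by move=> fi gi; exact: RintegralB. Qed.

Lemma circle_intZ c f : circle_integrable f -> circle_int (fun t => c * f t) = c * circle_int f.
Proof. by move=> fi; exact: RintegralZl. Qed.

Lemma circle_int_cst c : circle_int (fun=> c) = c * (2 * pi).
Proof.
have := @Rintegral_cst _ _ _ mu S1 measurable_circle c.
by rewrite /circle_int [fine _](_ : _ = 2 * pi) //; exact: (congr1 fine circle_measure).
Qed.

Lemma circle_int_sum (I : Type) (r : seq I) (P : pred I) (F : I -> R -> R) :
  (forall i, P i -> circle_integrable (F i)) ->
  circle_int (fun t => \sum_(i <- r | P i) F i t) = \sum_(i <- r | P i) circle_int (F i).
Proof.
move=> Fi; elim: r => [|i r IH].
  by under eq_fun do rewrite big_nil; rewrite big_nil circle_int_cst mul0r.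
under eq_fun do rewrite big_cons; rewrite big_cons; case: ifP => // Pi.
by rewrite circle_intD ?IH //; [exact: Fi|exact: circle_integrable_sum].
Qed.

Lemma circle_int_le f g : circle_integrable f -> circle_integrable g -> (forall t, S1 t -> f t <= g t) -> circle_int f <= circle_int g.
Proof. by move=> fi gi fg; exact: le_Rintegral. Qed.

Lemma circle_int_ge0 f : (forall t, S1 t -> 0 <= f t) -> 0 <= circle_int f.
Proof. by move=> f0; exact: (@Rintegral_ge0 _ _ _ mu S1 f f0). Qed.

Lemma circle_int_eq f g : (forall t, S1 t -> f t = g t) -> circle_int f = circle_int g.
Proof. by move=> fg; apply: eq_Rintegral => t; rewrite in_setE => /fg. Qed.

Lemma circle_int_norm f : circle_integrable f -> `|circle_int f| <= circle_int (fun t => `|f t|).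
Proof. by move=> fi; exact: le_normr_Rintegral. Qed.

Lemma circle_integrable_norm f : circle_integrable f -> circle_integrable (fun t => `|f t|).
Proof. by move=> fi; exact: integrable_norm. Qed.

Lemma circle_integrable_eq f g : (forall t, S1 t -> f t = g t) -> circle_integrable f -> circle_integrable g.
Proof.
move=> fg; apply: eq_integrable => // t; rewrite in_setE => St.
by rewrite /= fg.
Qed.

Definition sqint f := measurable_fun setT f /\ circle_integrable (fun t => f t ^+ 2).
Definition l2sq f : R := circle_int (fun t => f t ^+ 2).

Lemma sqint_mul f g : sqint f -> sqint g -> circle_integrable (fun t => f t * g t).
Proof.
move=> [mf fi] [mg gi]; apply: (circle_integrable_le _ (circle_integrableD fi gi)); first exact: measurable_funM.
move=> t _; rewrite normrM -(real_normK (num_real (f t))) -(real_normK (num_real (g t))).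
have := sqr_ge0 (`|f t| - `|g t|); have := normr_ge0 (f t); have := normr_ge0 (g t); nra.
Qed.

Lemma sqintZ c f : sqint f -> sqint (fun t => c * f t).
Proof.
move=> [mf fi]; split; first exact: measurable_funM.
apply: circle_integrable_eq (circle_integrableZ (c ^+ 2) fi) => t _; ring.
Qed.

Lemma sqintD f g : sqint f -> sqint g -> sqint (fun t => f t + g t).
Proof.
move=> sf sg; split; first exact: measurable_funD sf.1 sg.1.
apply: circle_integrable_eq (circle_integrableD (circle_integrableD sf.2 sg.2) (circle_integrableZ 2 (sqint_mul sf sg))) => t _; ring.
Qed.

Lemma sqintB f g : sqint f -> sqint g -> sqint (fun t => f t - g t).
Proof.
move=> sf sg; have := sqintD sf (sqintZ (-1) sg).
by congr sqint; apply/funext => t; rewrite mulN1r.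
Qed.

Lemma sqint_bd f M : measurable_fun setT f -> (forall t, S1 t -> `|f t| <= M) -> sqint f.
Proof.
move=> mf fM; split=> //; apply: (@circle_integrable_bd _ (M ^+ 2)); first exact: measurable_funX.
by move=> t St; rewrite normrX lerXn2r ?nnegrE ?normr_ge0 ?fM // (le_trans _ (fM t St)).
Qed.

Lemma l2sqD f g : sqint f -> sqint g ->
  l2sq (fun t => f t + g t) <= 2 * l2sq f + 2 * l2sq g.
Proof.
move=> sf sg; rewrite /l2sq -!circle_intZ; [|exact: sg.2|exact: sf.2].
rewrite -circle_intD; [|exact/circle_integrableZ/sf.2|exact/circle_integrableZ/sg.2].
apply: circle_int_le; [exact: (sqintD sf sg).2|by apply: circle_integrableD; apply: circle_integrableZ; [exact: sf.2|exact: sg.2]|].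
by move=> t _; have := sqr_ge0 (f t - g t); nra.
Qed.

(** Real trigonometric polynomials, generated so that closure under products is
    the only property that needs trigonometric identities. *)
Inductive trigp : (R -> R) -> Prop :=
| trigp_cos (m : int) : trigp (fun t => cos (m%:~R * t))
| trigp_sin (m : int) : trigp (fun t => sin (m%:~R * t))
| trigp_add f g of trigp f & trigp g : trigp (fun t => f t + g t)
| trigp_scale c f of trigp f : trigp (fun t => c * f t).

Lemma trigp_cst c : trigp (fun=> c).
Proof.
have := trigp_scale c (trigp_cos 0).
by congr trigp; apply/funext => t; rewrite mulr0z mul0r cos0 mulr1.
Qed.

Lemma trigp_ext f g : trigp f -> f =1 g -> trigp g.
Proof. by move=> tf /funext <-. Qed.

Lemma trigp_mul f g : trigp f -> trigp g -> trigp (fun t => f t * g t).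
Proof.
elim=> {f} [m|m|f1 f2 _ I1 _ I2|c f _ I1] tg; last 2 first.
- by apply: trigp_ext (trigp_add (I1 tg) (I2 tg)) _ => t; rewrite mulrDl.
- by apply: trigp_ext (trigp_scale c (I1 tg)) _ => t; rewrite mulrA.
- elim: tg => {g} [k|k|g1 g2 _ I1 _ I2|c g _ I1].
  + apply: trigp_ext (trigp_scale 2^-1 (trigp_add (trigp_cos (m + k)) (trigp_cos (m - k)))) _ => t.
    by rewrite ?intrB ?intrD ?mulrBl ?mulrDl ?cosB ?cosD; field.
  + apply: trigp_ext (trigp_scale 2^-1 (trigp_add (trigp_sin (k + m)) (trigp_sin (k - m)))) _ => t.
    by rewrite ?intrB ?intrD ?mulrBl ?mulrDl ?sinB ?sinD; field.
  + by apply: trigp_ext (trigp_add I1 I2) _ => t; rewrite mulrDr.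
  + by apply: trigp_ext (trigp_scale c I1) _ => t; rewrite mulrCA.
- elim: tg => {g} [k|k|g1 g2 _ I1 _ I2|c g _ I1].
  + apply: trigp_ext (trigp_scale 2^-1 (trigp_add (trigp_sin (m + k)) (trigp_sin (m - k)))) _ => t.
    by rewrite ?intrB ?intrD ?mulrBl ?mulrDl ?sinB ?sinD; field.
  + apply: trigp_ext (trigp_scale 2^-1 (trigp_add (trigp_cos (m - k)) (trigp_scale (-1) (trigp_cos (m + k))))) _ => t.
    by rewrite ?intrB ?intrD ?mulrBl ?mulrDl ?cosB ?cosD; field.
  + by apply: trigp_ext (trigp_add I1 I2) _ => t; rewrite mulrDr.
  + by apply: trigp_ext (trigp_scale c I1) _ => t; rewrite mulrCA.
Qed.

Lemma trigp_exp f k : trigp f -> trigp (fun t => f t ^+ k).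
Proof.
move=> tf; elim: k => [|k IH]; first by apply: trigp_ext (trigp_cst 1) _ => t; rewrite expr0.
by apply: trigp_ext (trigp_mul tf IH) _ => t; rewrite exprS.
Qed.

Lemma continuous_scale c : continuous (fun t : R => c * t).
Proof. by move=> t; apply: cvgM; [exact: cvg_cst|exact: cvg_id]. Qed.

Lemma trigp_continuous f : trigp f -> continuous f.
Proof.
elim=> {f} [m|m|f g _ cf _ cg|c f _ cf] t.
- exact: (@cvg_comp _ _ _ (fun s : R => m%:~R * s) (@cos R) _ _ _ (@continuous_scale m%:~R t) (@continuous_cos R (m%:~R * t))).
- exact: (@cvg_comp _ _ _ (fun s : R => m%:~R * s) (@sin R) _ _ _ (@continuous_scale m%:~R t) (@continuous_sin R (m%:~R * t))).
- exact: cvgD (cf t) (cg t).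
- by apply: cvgM; [exact: cvg_cst|exact: cf].
Qed.

Lemma sqint_cont f : continuous f -> sqint f.
Proof.
move=> cf; split; first exact: continuous_measurable_fun.
apply: circle_integrable_cont => t; apply: (@continuous_comp _ _ _ f (fun x => x ^+ 2)); first exact: cf.
exact: exprn_continuous.
Qed.

Lemma sqint_trigp f : trigp f -> sqint f.
Proof. by move=> /trigp_continuous /sqint_cont. Qed.

Definition trig_dense f := forall e, 0 < e -> exists2 g, trigp g & l2sq (fun t => f t - g t) < e.

Lemma trig_denseT f : trigp f -> trig_dense f.
Proof.
move=> tf e e0; exists f => //; rewrite /l2sq (_ : (fun t => _) = fun=> 0) ?circle_int_cst ?mul0r //.
by apply/funext => t; rewrite subrr expr0n.
Qed.

Lemma trig_denseD f g : sqint f -> sqint g -> trig_dense f -> trig_dense g ->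
  trig_dense (fun t => f t + g t).
Proof.
move=> sf sg df dg e e0; have e4 : 0 < e / 4 by rewrite divr_gt0.
have [f' tf Hf] := df _ e4; have [g' tg Hg] := dg _ e4.
exists (fun t => f' t + g' t); first exact: trigp_add.
rewrite (_ : (fun t => _) = fun t => (f t - f' t) + (g t - g' t)); last first.
  by apply/funext => t; ring.
apply: le_lt_trans (l2sqD _ _) _; try (apply: sqintB => //; exact: sqint_trigp).
by lra.
Qed.

Lemma trig_denseZ c f : sqint f -> trig_dense f -> trig_dense (fun t => c * f t).
Proof.
move=> sf df e e0.
have e1 : 0 < e / (c ^+ 2 + 1) by rewrite divr_gt0 // ltr_wpDl ?sqr_ge0.
have [g tg Hg] := df _ e1; exists (fun t => c * g t); first exact: trigp_scale.
rewrite (_ : l2sq _ = c ^+ 2 * l2sq (fun t => f t - g t)).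
  have c1 : 0 < c ^+ 2 + 1 by rewrite ltr_wpDl ?sqr_ge0.
  move: Hg; rewrite ltr_pdivlMr // => Hg; apply: le_lt_trans Hg.
  have : 0 <= l2sq (fun t => f t - g t) by apply: circle_int_ge0 => t _; rewrite sqr_ge0.
  nra.
rewrite /l2sq -circle_intZ; last exact: (sqintB sf (sqint_trigp tg)).2.
by apply: circle_int_eq => t _; ring.
Qed.

(** Dominated convergence, applied to the squared differences. *)
Lemma trig_dense_lim (f_ : nat -> R -> R) f F : (forall k, sqint (f_ k)) -> sqint f ->
  (forall k, trig_dense (f_ k)) -> sqint F ->
  (forall k t, S1 t -> `|f_ k t| <= F t) -> (forall t, S1 t -> f_ k t @[k --> \oo] --> f t) ->
  trig_dense f.
Proof.
move=> sf_ sf df sF fF cf e e0.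
have fF' t : S1 t -> `|f t| <= F t.
  move=> St; have C : `|f_ k t| @[k --> \oo] --> `|f t| by apply: cvg_norm; exact: cf.
  rewrite -(cvg_lim _ C) //; apply: limr_le; first by apply/cvg_ex; exists `|f t|.
  by apply: filterE => k; exact: fF.
have mS g : measurable_fun setT g -> measurable_fun S1 (EFin \o g).
  by move=> mg; apply/measurable_EFinP; exact: measurable_funTS.
have C : l2sq (fun t => f_ k t - f t) @[k --> \oo] --> 0.
  have pw : {ae mu, forall t, S1 t -> ((f_ k t - f t) ^+ 2)%:E @[k --> \oo] --> 0%E}.
    apply: aeW => t St; apply: cvg_EFin; first by apply: filterE.
    have fk : f_ k t - f t @[k --> \oo] --> 0.
      by rewrite -[X in _ --> X](subrr (f t)); apply: cvgB; [exact: cf|exact: cvg_cst].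
    by rewrite -(mulr0 (0 : R)); exact: (cvgM fk fk).
  have dom : {ae mu, forall t (k : nat), S1 t -> (`|((f_ k t - f t) ^+ 2)%:E| <= (4 * F t ^+ 2)%:E)%E}.
    apply: aeW => t k St; rewrite lee_fin ger0_norm ?sqr_ge0 //.
    have := fF k t St; have := fF' t St; rewrite !ler_norml => /andP[a b] /andP[c d].
    have := sqr_ge0 (F t); nra.
  have [_ _ DC] := @dominated_convergence _ _ R mu S1 measurable_circle
    (fun k t => ((f_ k t - f t) ^+ 2)%:E) (fun=> 0%:E) (fun t => (4 * F t ^+ 2)%:E)
    (fun k => mS _ (measurable_funX 2 (sqintB (sf_ k) sf).1)) (measurable_cst _)
    pw (circle_integrableZ 4 sF.2) dom.
  by move: DC; rewrite integral0 => /fine_cvgP[_]; exact.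
have e4 : 0 < e / 4 by rewrite divr_gt0.
move/cvgrPdist_lt : C => /(_ _ e4) [N _ /(_ N (leqnn N)) /=]; rewrite sub0r normrN => HN.
have [g tg Hg] := df N _ e4; exists g => //.
rewrite (_ : (fun t => _) = fun t => (f_ N t - g t) + -1 * (f_ N t - f t)); last first.
  by apply/funext => t; ring.
apply: le_lt_trans (l2sqD _ _) _.
- exact: sqintB (sqint_trigp tg).
- by apply: sqintZ; exact: sqintB.
have -> : l2sq (fun t => -1 * (f_ N t - f t)) = l2sq (fun t => f_ N t - f t).
  by apply: circle_int_eq => t _; ring.
have := ler_norm (l2sq (fun t => f_ N t - f t)); lra.
Qed.

(** Countable sets are negligible, which lets end points of arcs be ignored. *)
Lemma trig_dense_ae f g (A : set R) : countable A -> sqint f -> sqint g ->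
  (forall t, S1 t -> ~ A t -> f t = g t) -> trig_dense f -> trig_dense g.
Proof.
move=> cA sf sg fg df e e0; have [h th Hh] := df e e0; exists h => //.
apply: le_lt_trans Hh; rewrite le_eqVlt; apply/orP; left; apply/eqP; congr fine.
apply: ae_eq_integral => //.
- apply/measurable_EFinP; apply: measurable_funTS; apply: measurable_funX.
  exact: (sqintB sg (sqint_trigp th)).1.
- apply/measurable_EFinP; apply: measurable_funTS; apply: measurable_funX.
  exact: (sqintB sf (sqint_trigp th)).1.
exists A; split; first by apply: countable_measurable.
  exact: countable_lebesgue_measure0.
move=> t /= /not_implyP[St H]; apply: contrapT => At; apply: H.
by rewrite fg.
Qed.

End ScalarL2.

(** * Density of trigonometric polynomials *)

Section Density.
Import HBSimple HBNNSimple.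
Context {R : realType}.
Local Notation mu := (@lebesgue_measure R).
Local Notation S1 := (@circle R).
Implicit Types f g h : R -> R.

Lemma bernoulli_ge (x : R) n : -1 <= x -> 1 + n%:R * x <= (1 + x) ^+ n.
Proof.
move=> x1; elim: n => [|n IH]; first by rewrite mul0r addr0 expr0.
rewrite exprS -natr1; apply: (@le_trans _ _ ((1 + x) * (1 + n%:R * x))).
  have := sqr_ge0 x; have : 0 <= n%:R :> R by []; nra.
by apply: ler_wpM2l => //; lra.
Qed.

Lemma cvg_mul_expr (r : R) : 0 <= r < 1 -> k%:R * r ^+ k @[k --> \oo] --> 0.
Proof.
move=> /andP[r0 r1]; pose s := (1 + r) / 2.
have s0 : 0 < s by rewrite /s; lra.
have s1 : s < 1 by rewrite /s; lra.
have rs : r <= s * s by rewrite /s; have := sqr_ge0 (1 - r); nra.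
pose d := s^-1 - 1.
have d0 : 0 < d by rewrite /d subr_gt0 invf_gt1.
have B k : k%:R * r ^+ k <= d^-1 * s ^+ k.
  have ks : k%:R * s ^+ k <= d^-1.
    have dm : -1 <= d by lra.
    have := @bernoulli_ge d k dm; have -> : 1 + d = s^-1 by rewrite /d addrC subrK.
    rewrite exprVn => H.
    have sk0 : 0 < s ^+ k by rewrite exprn_gt0.
    rewrite -(ler_pM2r d0) mulVf ?gt_eqF // mulrAC -(ler_pM2r (_ : 0 < (s ^+ k)^-1)) ?invr_gt0 //.
    by rewrite mul1r mulfK ?gt_eqF // (le_trans _ H) // lerDr.
  apply: (@le_trans _ _ (k%:R * (s ^+ k * s ^+ k))); last by rewrite mulrA ler_wpM2r // ltW // exprn_gt0.
  by rewrite ler_wpM2l // -exprMn lerXn2r // nnegrE // mulr_ge0 // ltW.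
apply: (@squeeze_cvgr _ _ _ _ (fun=> 0) (fun k => d^-1 * s ^+ k)).
- by apply: filterE => k; rewrite B andbT mulr_ge0 // exprn_ge0.
- exact: cvg_cst.
- rewrite -[X in _ --> X](mulr0 d^-1); apply: cvgM; first exact: cvg_cst.
  by apply: cvg_expr; rewrite ger0_norm // ltW.
Qed.

(** An explicit polynomial approximation of the indicator of y < 1/2, which
    turns density into a matter of pointwise convergence. By Bernoulli's
    inequality (1 - y^k)^(k 2^k) is at least 1 - k (2 y)^k, which tends to 1
    when 2 y < 1; and when 2 y >= 1, (1 - x) (1 + x) <= 1 with x = 2^-k bounds
    it by the inverse of (1 + x)^(k 2^k) >= 1 + k. *)
Lemma step_cvg (y : R) : 0 <= y <= 1 ->
  (1 - y ^+ k) ^+ (k * 2 ^ k) @[k --> \oo] --> ((y < 2^-1)%R%:R : R).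
Proof.
move=> /andP[y0 y1].
have yk0 k : 0 <= y ^+ k by rewrite exprn_ge0.
have yk1 k : y ^+ k <= 1 by rewrite exprn_ile1.
case: ltP => yh /=.
  have r01 : 0 <= 2 * y < 1 by apply/andP; split; lra.
  apply: (@squeeze_cvgr _ _ _ _ (fun k => 1 - k%:R * (2 * y) ^+ k) (fun=> 1)).
  - apply: filterE => k; apply/andP; split; last by rewrite exprn_ile1 //; have := yk0 k; have := yk1 k; lra.
    have := @bernoulli_ge (- y ^+ k) (k * 2 ^ k); rewrite lerN2 => /(_ (yk1 k)).
    by rewrite natrM natrX mulrN -mulrA -exprMn.
  - rewrite -[X in _ --> X]subr0; apply: cvgB; first exact: cvg_cst.
    exact: cvg_mul_expr.
  - exact: cvg_cst.
apply: (@squeeze_cvgr _ _ _ _ (fun=> 0) (fun k => k.+1%:R^-1)).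
- apply: filterE => k; apply/andP; split; first by rewrite exprn_ge0 // subr_ge0.
  pose x : R := 2^-1 ^+ k.
  have x0 : 0 < x by rewrite exprn_gt0.
  have x1 : x <= 1 by rewrite exprn_ile1 //; lra.
  have xy : x <= y ^+ k by rewrite lerXn2r // nnegrE.
  apply: (@le_trans _ _ ((1 - x) ^+ (k * 2 ^ k))).
    by rewrite lerXn2r ?nnegrE ?subr_ge0 // lerD2l lerN2.
  have B : k.+1%:R <= (1 + x) ^+ (k * 2 ^ k).
    have := @bernoulli_ge x (k * 2 ^ k); rewrite natrM natrX -mulrA /x -exprMn divff // expr1n mulr1.
    by rewrite nat1r; apply; rewrite (le_trans _ (ltW x0)) ?lerN10.
  have p0 : 0 < (1 + x) ^+ (k * 2 ^ k) by rewrite exprn_gt0 // ltr_wpDl.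
  apply: (@le_trans _ _ ((1 + x) ^+ (k * 2 ^ k))^-1); last by rewrite lef_pV2 ?posrE // ltr0n.
  rewrite -(ler_pM2r p0) mulVf ?gt_eqF // -exprMn exprn_ile1 //; nra.
- exact: cvg_cst.
- exact: cvg_harmonic.
Qed.

Definition half_circle (a t : R) : R := (0 < cos (t - a))%R%:R.

(** The polynomials of [step_cvg] at y = (1 - cos (t - a)) / 2, which is below
    1/2 exactly on the half circle centred at a. *)
Definition step_trig (a : R) (k : nat) (t : R) : R :=
  (1 - ((1 - cos (t - a)) / 2) ^+ k) ^+ (k * 2 ^ k).

Lemma step_trig_cvg a t : step_trig a k t @[k --> \oo] --> half_circle a t.
Proof.
have y01 : 0 <= (1 - cos (t - a)) / 2 <= 1.
  by have := cos_geN1 (t - a); have := cos_le1 (t - a); lra.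
have := step_cvg y01; rewrite /half_circle (_ : (_ < 2^-1) = (0 < cos (t - a))) //.
by apply/idP/idP; lra.
Qed.

Lemma step_trig01 a k t : 0 <= step_trig a k t <= 1.
Proof.
have y01 : 0 <= (1 - cos (t - a)) / 2 <= 1.
  by have := cos_geN1 (t - a); have := cos_le1 (t - a); lra.
case/andP: y01 => y0 y1; rewrite /step_trig.
have yk0 : 0 <= ((1 - cos (t - a)) / 2) ^+ k by rewrite exprn_ge0.
have yk1 : ((1 - cos (t - a)) / 2) ^+ k <= 1 by rewrite exprn_ile1.
by rewrite exprn_ge0 ?exprn_ile1 ?subr_ge0 ?lerBlDr ?lerDl.
Qed.

Lemma trigp_shift_cos (a : R) : trigp (fun t => cos (t - a)).
Proof.
apply: trigp_ext (trigp_add (trigp_scale (cos a) (trigp_cos 1))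
  (trigp_scale (sin a) (trigp_sin 1))) _ => t.
by rewrite !mul1r cosB; ring.
Qed.

Lemma trigp_step a k : trigp (step_trig a k).
Proof.
apply: trigp_exp; apply: trigp_ext (trigp_add (trigp_cst 1) (trigp_scale (-1) (trigp_exp k
  (trigp_add (trigp_cst 2^-1) (trigp_scale (- 2^-1) (trigp_shift_cos a)))))) _ => t.
by rewrite mulN1r mulNr mulrBl mul1r [cos _ / 2]mulrC.
Qed.

Lemma measurable_half a : measurable_fun setT (half_circle a).
Proof.
apply: (measurable_fun_cvg (h := fun k => step_trig a k)) => [k|t _]; last exact: step_trig_cvg.
exact: (sqint_trigp (trigp_step a k)).1.
Qed.

Lemma trig_dense_halves a b : trig_dense (fun t => half_circle a t * half_circle b t).
Proof.
have tk k : trigp (fun t => step_trig a k t * step_trig b k t) by apply: trigp_mul; exact: trigp_step.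
apply: (@trig_dense_lim _ (fun k t => step_trig a k t * step_trig b k t) _ (fun=> 1)).
- by move=> k; exact: sqint_trigp.
- apply: (@sqint_bd _ _ 1); first by apply: measurable_funM; exact: measurable_half.
  by move=> t _; rewrite /half_circle -natrM; case: (0 < _); case: (0 < _); rewrite ?normr1 ?normr0.
- by move=> k; exact: trig_denseT.
- exact: sqint_trigp (trigp_cst 1).
- move=> k t _; have /andP[a0 a1] := step_trig01 a k t; have /andP[b0 b1] := step_trig01 b k t.
  by rewrite ger0_norm ?mulr_ge0 // mulr_ile1.
- by move=> t _; apply: cvgM; exact: step_trig_cvg.
Qed.

Lemma sin_lt0 (t : R) : - pi < t < 0 -> sin t < 0.
Proof. by move=> /andP[a b]; rewrite -oppr_gt0 -sinN sin_gt0_pi //; apply/andP; split; lra. Qed.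

Lemma sin_lt0_2pi (t : R) : pi < t < 2 * pi -> sin t < 0.
Proof.
move=> /andP[a b]; have -> : t = (t - pi) + pi by rewrite subrK.
by rewrite sinDpi oppr_lt0 sin_gt0_pi //; apply/andP; split; lra.
Qed.

Lemma sqint_indic (A : set R) : measurable A -> sqint (\1_A : R -> R).
Proof.
move=> mA; apply: (@sqint_bd _ _ 1); first exact: measurable_indic.
by move=> t _; rewrite indicE; case: (t \in A); rewrite ?normr1 ?normr0.
Qed.

(** A ray cuts out of the circle [0, 2 pi] an arc. Up to end points, the arc is
    the intersection of two half circles if it is shorter than pi, and the
    complement of such an intersection if it is longer. *)
Lemma trig_dense_ray (x : R) : trig_dense (\1_(`]x, +oo[%classic) : R -> R).
Proof.
have pi0 := pi_gt0 R.
have mr : measurable (`]x, +oo[%classic : set R) by exact: measurable_itv.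
have rE t : (\1_(`]x, +oo[%classic) : R -> R) t = (x < t)%R%:R.
  rewrite indicE; congr (nat_of_bool _)%:R.
  by apply/idP/idP => [/set_mem /=|H]; [|apply/mem_set => /=]; rewrite in_itv /= andbT.
have sr := sqint_indic mr.
have [x0|x0] := ltP x 0.
  apply: (@trig_dense_ae _ (fun=> 1) _ set0) => //; [exact: sqint_trigp (trigp_cst 1)| |exact: trig_denseT (trigp_cst 1)].
  by move=> t; rewrite /circle /= in_itv /= => /andP[t0 _] _; rewrite rE (lt_le_trans x0).
have [x2|x2] := leP (2 * pi) x.
  apply: (@trig_dense_ae _ (fun=> 0) _ set0) => //; [exact: sqint_trigp (trigp_cst 0)| |exact: trig_denseT (trigp_cst 0)].
  by move=> t; rewrite /circle /= in_itv /= => /andP[_ t2] _; rewrite rE ltNge (le_trans t2).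
(* The exceptional points: the ends of the arc and of the half circles centred
   at pi / 2 and - pi / 2. *)
pose A : set R := [set` [:: 0; x; pi; 2 * pi]].
have cA : countable A by apply: finite_set_countable; exact: finite_seq.
have sh a b : sqint (fun t => half_circle a t * half_circle b t).
  apply: (@sqint_bd _ _ 1); first by apply: measurable_funM; exact: measurable_half.
  by move=> t _; rewrite /half_circle -natrM; case: (0 < _); case: (0 < _); rewrite ?normr1 ?normr0.
have AE t : S1 t -> ~ A t -> [/\ 0 < t, t < 2 * pi, t != x & t != pi].
  rewrite /circle /= in_itv /= /A /= !inE => /andP[t0 t2] /negP; rewrite !negb_or => /and4P[n0 nx np n2].
  by rewrite !lt_neqAle t0 t2 n2 eq_sym n0.
have half1 a (t : R) : 0 < cos (t - a) -> half_circle a t = 1 by rewrite /half_circle => ->.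
have half0 a (t : R) : cos (t - a) < 0 -> half_circle a t = 0.
  by move=> c0; rewrite /half_circle ltNge (ltW c0).
have [xp|xp] := leP x pi.
  apply: (@trig_dense_ae _ (fun t => 1 + -1 * (half_circle (pi / 2) t * half_circle (x - pi / 2) t)) _ A) => //.
  - apply: sqintD; first exact: sqint_trigp (trigp_cst 1).
    exact: sqintZ.
  - move=> t /AE H {}/H [t0 t2 tx tp]; rewrite rE.
    have c1 : cos (t - pi / 2) = sin t by rewrite cosBpihalf.
    have c2 : cos (t - (x - pi / 2)) = - sin (t - x) by rewrite opprB addrA addrAC cosDpihalf.
    have [tp'|tp'] := ltP t pi.
      rewrite (half1 (pi / 2)); last by rewrite c1 sin_gt0_pi // t0.
      case: (ltgtP x t) tx => // xt _ /=.
        rewrite half0 ?mulr0 ?addr0 // c2 oppr_lt0 sin_gt0_pi //; apply/andP; split; lra.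
      by rewrite half1 ?mulr1 ?subrr // c2 oppr_gt0 sin_lt0 //; apply/andP; split; lra.
    have tp2 : pi < t by rewrite lt_neqAle eq_sym tp.
    rewrite (half0 (pi / 2)) ?mul0r ?mulr0 ?addr0; last by rewrite c1 sin_lt0_2pi // tp2.
    by rewrite (le_lt_trans xp tp2).
  - apply: trig_denseD; [exact: sqint_trigp (trigp_cst 1)|exact: sqintZ|exact: trig_denseT (trigp_cst 1)|].
    by apply: trig_denseZ => //; exact: trig_dense_halves.
apply: (@trig_dense_ae _ (fun t => half_circle (- (pi / 2)) t * half_circle (x + pi / 2) t) _ A) => //; last exact: trig_dense_halves.
move=> t /AE H {}/H [t0 t2 tx tp]; rewrite rE.
have c1 : cos (t - - (pi / 2)) = - sin t by rewrite opprK cosDpihalf.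
have c2 : cos (t - (x + pi / 2)) = sin (t - x) by rewrite opprD addrA cosBpihalf.
have [tp'|tp'] := ltP t pi.
  rewrite half0 ?mul0r; last by rewrite c1 oppr_lt0 sin_gt0_pi // t0.
  by rewrite ltNge (ltW (lt_trans tp' xp)).
have tp2 : pi < t by rewrite lt_neqAle eq_sym tp.
rewrite half1 ?mul1r; last by rewrite c1 oppr_gt0 sin_lt0_2pi // tp2.
case: (ltgtP x t) tx => // xt _ /=.
  by rewrite half1 // c2 sin_gt0_pi //; apply/andP; split; lra.
by rewrite half0 // c2 sin_lt0 //; apply/andP; split; lra.
Qed.

Lemma trig_dense_sum (I : Type) (r : seq I) (F : I -> R -> R) :
  (forall i, sqint (F i)) -> (forall i, trig_dense (F i)) ->
  sqint (fun t => \sum_(i <- r) F i t) /\ trig_dense (fun t => \sum_(i <- r) F i t).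
Proof.
move=> sF dF; elim: r => [|i r [s1 d1]].
  under eq_fun do rewrite big_nil.
  by split; [exact: sqint_trigp (trigp_cst 0)|exact: trig_denseT (trigp_cst 0)].
under eq_fun do rewrite big_cons.
by split; [exact: sqintD|exact: trig_denseD].
Qed.

(** The open rays form a pi-system that generates the Borel sets, and the sets
    with approximable indicator form a Dynkin system. *)
Lemma trig_dense_indic (A : set R) : measurable A -> trig_dense (\1_A : R -> R).
Proof.
move=> mA.
have := @dynkin_induction _ (measurableTypeR R) (@RGenOInfty.G R)
  (fun A : set R => trig_dense (\1_A : R -> R)) (RGenOInfty.measurableE R).
apply.
- move=> _ _ [x ->] [y ->]; exists (Num.max x y).
  apply/seteqP; split=> t /=; rewrite !in_itv /= !andbT gt_max; first by move=> [-> ->].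
  by move=> /andP[].
- rewrite indicT; exact: trig_denseT (trigp_cst 1).
- by move=> _ [x ->]; exact: trig_dense_ray.
- move=> S mS dS; have := trig_denseD (sqint_trigp (trigp_cst 1)) (sqintZ (-1) (sqint_indic mS))
    (trig_denseT (trigp_cst 1)) (trig_denseZ (-1) (sqint_indic mS) dS).
  congr trig_dense; apply/funext => t; rewrite !indicE in_setC.
  by case: (t \in S); rewrite ?mulr1 ?mulr0 ?subrr ?addr0.
- move=> F mF tF dF.
  apply: (@trig_dense_lim _ (fun k t => \sum_(i < k) \1_(F i) t) _ (fun=> 1)).
  + by move=> k; apply: (trig_dense_sum _ _ _).1 => // i; exact: sqint_indic (mF i).
  + apply: sqint_indic; apply: bigcup_measurable => k _; exact: mF.
  + by move=> k; apply: (trig_dense_sum _ _ _).2 => // i; exact: sqint_indic (mF i).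
  + exact: sqint_trigp (trigp_cst 1).
  + move=> k t _; rewrite ger0_norm ?sumr_ge0 //.
    have [[i Fi]|nF] := pselect (exists i : 'I_k, F i t).
      rewrite (bigD1 i) //= big1 ?addr0; first by rewrite indicE; case: (_ \in _).
      move=> j ji; rewrite indicE memNset // => Fj; case/eqP: ji; apply: val_inj.
      by apply: (tF j i) => //; exists t.
    by rewrite big1 // => j _; rewrite indicE memNset // => Fj; apply: nF; exists j.
  + move=> t _; rewrite indicE; have [[n _ Fn]|nF] := pselect ((\bigcup_k F k) t).
      rewrite mem_set; last by exists n.
      apply: cvg_near_cst; exists n.+1 => // k /= nk.
      rewrite (bigD1 (Ordinal nk)) //= big1 ?addr0; first by rewrite indicE mem_set.
      move=> j jn; rewrite indicE memNset // => Fj; case/eqP: jn; apply: val_inj => /=.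
      by apply: (tF j n) => //; exists t.
    rewrite memNset //; apply: cvg_near_cst; apply: filterE => k.
    by rewrite big1 // => j _; rewrite indicE memNset // => Fj; apply: nF; exists j.
- have mA' : (@ocitv R).-sigma.-measurable A := mA.
  by move: mA'; rewrite RGenOInfty.measurableE.
Qed.

Lemma trig_dense_ge0 f : (forall t, 0 <= f t) -> sqint f -> trig_dense f.
Proof.
move=> f0 sf.
have mf : measurable_fun [set: measurableTypeR R] (EFin \o f) by apply/measurable_EFinP; exact: sf.1.
have f0' t : [set: measurableTypeR R] t -> (0 <= (EFin \o f) t)%E by rewrite lee_fin.
pose g n : {nnsfun measurableTypeR R >-> R} := nnsfun_approx measurableT mf n.
have gf n t : 0 <= g n t <= f t.
  apply/andP; split; first exact: fun_ge0.
  by rewrite -lee_fin /g nnsfun_approxE; exact: le_approx.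
have mg n : measurable_fun [set: R] (g n) by exact: (@measurable_funPT _ _ _ _ (g n)).
have sg n : sqint (g n).
  split; first exact: mg.
  apply: (circle_integrable_le _ sf.2); first by apply: measurable_funX; exact: mg.
  move=> t _; have /andP[g0 gf'] := gf n t.
  by rewrite ger0_norm ?sqr_ge0 // lerXn2r ?nnegrE.
apply: (@trig_dense_lim _ (fun n => g n) _ f) => //.
- move=> n.
  have [m [c E]] : exists m (c : nat -> R), forall t : R,
      g n t = \sum_(i < m) (c i * \1_(g n @^-1` [set c i]) t).
    by eexists; exists (nth 0 (fset_set (range (g n)))) => t; exact: (fimfunEord (g n) t).
  rewrite (_ : (g n : R -> R) = fun t => \sum_(i < m) (c i * \1_(g n @^-1` [set c i]) t)); last exact/funext.
  have mS y : measurable (g n @^-1` [set y]) by exact: measurable_sfunP.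
  apply: (trig_dense_sum _ _ _).2 => i; first by apply: sqintZ; exact: sqint_indic (mS _).
  by apply: trig_denseZ; [exact: sqint_indic (mS _)|exact: trig_dense_indic (mS _)].
- by move=> n t _; have /andP[g0 gf'] := gf n t; rewrite ger0_norm.
- move=> t _; have := @cvg_nnsfun_approx _ _ _ _ measurableT _ mf f0' t I.
  by move=> /fine_cvgP[_].
Qed.

Theorem trig_dense_sqint f : sqint f -> trig_dense f.
Proof.
move=> sf; have sN := sqintZ (-1) sf.
have mx h : sqint h -> sqint (fun t => Num.max (h t) 0).
  move=> [mh ih]; have mm : measurable_fun setT (fun t => Num.max (h t) 0).
    by apply: measurable_maxr => //; exact: measurable_cst.
  split=> //; apply: (circle_integrable_le _ ih); first exact: measurable_funX.
  move=> t _; rewrite ger0_norm ?sqr_ge0 //; case: (leP (h t) 0) => _ //.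
  by rewrite expr0n sqr_ge0.
have mx0 h t : 0 <= Num.max (h t) 0 by rewrite le_max lexx orbT.
have := trig_denseD (mx _ sf) (sqintZ (-1) (mx _ sN)) (trig_dense_ge0 (mx0 f) (mx _ sf))
  (trig_denseZ (-1) (mx _ sN) (trig_dense_ge0 (mx0 (fun t => -1 * f t)) (mx _ sN))).
congr trig_dense; apply/funext => t; rewrite !mulN1r.
by case: (leP (f t) 0) => ft; case: (leP (- f t) 0); lra.
Qed.

End Density.

(** * Euclidean structure of C^n and the L^2 pairing of loops *)

(** Cauchy-Schwarz for any positive semidefinite form; degenerate forms, with a
    = 0 or c = 0, have to be included because the L^2 pairing of loops is one. *)
Lemma quad_CS (R : realFieldType) (a c d : R) : 0 <= a -> 0 <= c ->
  (forall x y, 0 <= x ^+ 2 * a + 2 * (x * y) * d + y ^+ 2 * c) -> d ^+ 2 <= a * c.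
Proof.
move=> a0 c0 H.
have [a00|a1] := eqVneq a 0; last first.
  have a2 : 0 < a by rewrite lt_neqAle eq_sym a1.
  by rewrite -(ler_pM2l a2); have := H (- d) a; nra.
have [c00|c1] := eqVneq c 0; last first.
  have c2 : 0 < c by rewrite lt_neqAle eq_sym c1.
  by rewrite -(ler_pM2l c2); have := H c (- d); nra.
have := H 1 1; have := H 1 (-1); rewrite a00 c00 => h1 h2; have -> : d = 0 by lra.
by rewrite expr0n mulr0.
Qed.

Lemma weighted_CS (R : realFieldType) (I : Type) (r : seq I) (w a b : I -> R) :
  (forall i, 0 <= w i) ->
  (\sum_(i <- r) w i * (a i * b i)) ^+ 2 <=
  (\sum_(i <- r) w i * a i ^+ 2) * (\sum_(i <- r) w i * b i ^+ 2).
Proof.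
move=> w0; apply: quad_CS.
- by apply: sumr_ge0 => i _; rewrite mulr_ge0 ?sqr_ge0.
- by apply: sumr_ge0 => i _; rewrite mulr_ge0 ?sqr_ge0.
move=> x y; rewrite !mulr_sumr -!big_split /=; apply: sumr_ge0 => i _.
have -> : x ^+ 2 * (w i * a i ^+ 2) + 2 * (x * y) * (w i * (a i * b i)) + y ^+ 2 * (w i * b i ^+ 2) =
  w i * (x * a i + y * b i) ^+ 2 by ring.
by rewrite mulr_ge0 ?sqr_ge0.
Qed.

Section Pointwise.
Context {R : realType} {n : nat}.
Implicit Types (z w b : cspace R n).

Lemma rdotC z w : rdot z w = rdot w z.
Proof. by apply: eq_bigr => j _; rewrite mulrC [X in _ + X]mulrC. Qed.

Lemma rdotDl z w b : rdot (z + w) b = rdot z b + rdot w b.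
Proof. by rewrite /rdot -big_split; apply: eq_bigr => j _ /=; rewrite !mxE; ring. Qed.

Lemma rdotZl a z b : rdot (a *: z) b = a * rdot z b.
Proof. by rewrite /rdot mulr_sumr; apply: eq_bigr => j _ /=; rewrite !mxE; ring. Qed.

Lemma rdotDr z w b : rdot b (z + w) = rdot b z + rdot b w.
Proof. by rewrite rdotC rdotDl !(rdotC b). Qed.

Lemma rdotZr a z b : rdot b (a *: z) = a * rdot b z.
Proof. by rewrite rdotC rdotZl !(rdotC b). Qed.

Lemma rdotNl z b : rdot (- z) b = - rdot z b.
Proof. by rewrite -scaleN1r rdotZl mulN1r. Qed.

Lemma rdotNr z b : rdot b (- z) = - rdot b z.
Proof. by rewrite rdotC rdotNl rdotC. Qed.

Lemma rdotBl z w b : rdot (z - w) b = rdot z b - rdot w b.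
Proof. by rewrite rdotDl rdotNl. Qed.

Lemma rdot0l b : rdot 0 b = 0.
Proof. by rewrite -(scale0r (0 : cspace R n)) rdotZl mul0r. Qed.

Lemma rdot_suml (I : Type) (r : seq I) (P : pred I) (F : I -> cspace R n) b :
  rdot (\sum_(i <- r | P i) F i) b = \sum_(i <- r | P i) rdot (F i) b.
Proof.
elim: r => [|i r IH]; first by rewrite !big_nil rdot0l.
by rewrite !big_cons; case: ifP => _ //; rewrite rdotDl IH.
Qed.

Lemma rdot_ge0 z : 0 <= rdot z z.
Proof. by apply: sumr_ge0 => j _; rewrite -!expr2 addr_ge0 ?sqr_ge0. Qed.

Lemma enorm_sqr z : enorm z ^+ 2 = rdot z z.
Proof. by rewrite sqr_sqrtr ?rdot_ge0. Qed.

Lemma enorm_ge0 z : 0 <= enorm z. Proof. exact: sqrtr_ge0. Qed.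

Definition e1 (j : 'I_n) : cspace R n := (delta_mx ord0 j, 0).
Definition e2 (j : 'I_n) : cspace R n := (0, delta_mx ord0 j).

Lemma rdot_e1 z j : rdot z (e1 j) = z.1 ord0 j.
Proof.
rewrite /rdot (bigD1 j) //= big1 ?addr0; first by rewrite !mxE !eqxx mulr1 mulr0 addr0.
by move=> k kj; rewrite !mxE (negbTE kj) andbF !mulr0 addr0.
Qed.

Lemma rdot_e2 z j : rdot z (e2 j) = z.2 ord0 j.
Proof.
rewrite /rdot (bigD1 j) //= big1 ?addr0; first by rewrite !mxE !eqxx mulr1 mulr0 add0r.
by move=> k kj; rewrite !mxE (negbTE kj) andbF !mulr0 addr0.
Qed.

(** Vectors are determined by their pairings, which reduces identities between
    Fourier coefficients to identities between real integrals. *)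
Lemma rdot_inj z w : (forall b, rdot z b = rdot w b) -> z = w.
Proof.
move=> H; rewrite [z]surjective_pairing [w]surjective_pairing; congr pair.
  by apply/rowP => j; rewrite -!rdot_e1 H.
by apply/rowP => j; rewrite -!rdot_e2 H.
Qed.

Lemma cspace_basis z : z = \sum_j (z.1 ord0 j *: e1 j) + \sum_j (z.2 ord0 j *: e2 j).
Proof.
apply: rdot_inj => b; rewrite rdotDl !rdot_suml -big_split.
by apply: eq_bigr => j _; rewrite !rdotZl ![rdot _ b]rdotC rdot_e1 rdot_e2.
Qed.

Lemma rdot_CS2 z w : rdot z w ^+ 2 <= rdot z z * rdot w w.
Proof.
apply: quad_CS => [||a c]; [exact: rdot_ge0|exact: rdot_ge0|].
have := rdot_ge0 (a *: z + c *: w).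
rewrite rdotDl !rdotDr !rdotZl !rdotZr (rdotC w z).
by congr (_ <= _); ring.
Qed.

Lemma rdot_CS z w : `|rdot z w| <= enorm z * enorm w.
Proof.
rewrite -(@ler_pXn2r _ 2%N) ?nnegrE ?mulr_ge0 ?enorm_ge0 //.
by rewrite exprMn !enorm_sqr real_normK ?num_real // rdot_CS2.
Qed.

Lemma enormZ a z : enorm (a *: z) = `|a| * enorm z.
Proof.
apply/eqP; rewrite -(@eqrXn2 _ 2%N) ?mulr_ge0 ?enorm_ge0 // exprMn !enorm_sqr rdotZl rdotZr.
by rewrite real_normK ?num_real // mulrA expr2.
Qed.

Lemma enormN z : enorm (- z) = enorm z.
Proof. by rewrite -scaleN1r enormZ normrN1 mul1r. Qed.

Lemma enorm0 : enorm (0 : cspace R n) = 0.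
Proof. by rewrite /enorm rdot0l sqrtr0. Qed.

Lemma enormD z w : enorm (z + w) <= enorm z + enorm w.
Proof.
rewrite -(@ler_pXn2r _ 2%N) ?nnegrE ?addr_ge0 ?enorm_ge0 //.
rewrite sqrrD !enorm_sqr rdotDl !rdotDr (rdotC w z).
have := ler_norm (rdot z w); have := rdot_CS z w; lra.
Qed.

Lemma enormB z w : enorm (z - w) <= enorm z + enorm w.
Proof. by rewrite -(enormN w) enormD. Qed.

Lemma enorm_distC z w : enorm (z - w) = enorm (w - z).
Proof. by rewrite -enormN opprB. Qed.

Lemma enorm_sum (I : Type) (r : seq I) (P : pred I) (F : I -> cspace R n) :
  enorm (\sum_(i <- r | P i) F i) <= \sum_(i <- r | P i) enorm (F i).
Proof.
elim: r => [|i r IH]; first by rewrite !big_nil enorm0.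
rewrite !big_cons; case: ifP => _ //.
by apply: le_trans (enormD _ _) _; rewrite lerD2l.
Qed.

Lemma enorm_eq0 z : enorm z = 0 -> z = 0.
Proof.
move=> z0; apply: rdot_inj => b; rewrite rdot0l; apply/eqP; rewrite -normr_le0.
by rewrite (le_trans (rdot_CS z b)) // z0 mul0r.
Qed.

Lemma coord1_le z j : `|z.1 ord0 j| <= enorm z.
Proof.
rewrite -(@ler_pXn2r _ 2%N) ?nnegrE ?enorm_ge0 // enorm_sqr real_normK ?num_real //.
rewrite /rdot (bigD1 j) //= expr2 -addrA lerDl addr_ge0 -?expr2 ?sqr_ge0 //.
by apply: sumr_ge0 => k _; rewrite addr_ge0 -?expr2 ?sqr_ge0.
Qed.

Lemma coord2_le z j : `|z.2 ord0 j| <= enorm z.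
Proof.
rewrite -(@ler_pXn2r _ 2%N) ?nnegrE ?enorm_ge0 // enorm_sqr real_normK ?num_real //.
rewrite /rdot (bigD1 j) //= expr2 addrAC addrC lerDl addr_ge0 -?expr2 ?sqr_ge0 //.
by apply: sumr_ge0 => k _; rewrite addr_ge0 -?expr2 ?sqr_ge0.
Qed.

Lemma JmulD z w : Jmul (z + w) = Jmul z + Jmul w.
Proof. by rewrite /Jmul /= opprD. Qed.

Lemma JmulZ a z : Jmul (a *: z) = a *: Jmul z.
Proof. by rewrite /Jmul /= -scalerN. Qed.

Lemma JmulJ z : Jmul (Jmul z) = - z.
Proof. by rewrite /Jmul /=. Qed.

Lemma rdotJl z w : rdot (Jmul z) w = - rdot z (Jmul w).
Proof. by rewrite /rdot -sumrN; apply: eq_bigr => j _; rewrite /Jmul /= !mxE; ring. Qed.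

Lemma rdotJJ z w : rdot (Jmul z) (Jmul w) = rdot z w.
Proof. by rewrite rdotJl JmulJ rdotNr opprK. Qed.

Lemma cisD t z w : cis t (z + w) = cis t z + cis t w.
Proof. by rewrite /cis JmulD !scalerDr addrACA. Qed.

Lemma cisZ t a z : cis t (a *: z) = a *: cis t z.
Proof. by rewrite /cis JmulZ scalerDr !scalerA [cos t * a]mulrC [sin t * a]mulrC. Qed.

Lemma cis0 z : cis 0 z = z.
Proof. by rewrite /cis cos0 sin0 scale1r scale0r addr0. Qed.

Lemma cis_add s t z : cis s (cis t z) = cis (s + t) z.
Proof.
rewrite /cis JmulD !JmulZ JmulJ cosD sinD !scalerDr !scalerBl !scalerDl !scalerA !scalerN.
rewrite -!addrA; congr (_ + _); rewrite addrA addrC; congr (_ + _); exact: addrC.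
Qed.

Lemma rdot_cis t z w : rdot (cis t z) w = rdot z (cis (- t) w).
Proof. by rewrite /cis !rdotDl !rdotDr !rdotZl !rdotZr cosN sinN rdotJl; ring. Qed.

Lemma rdot_ciscis t z w : rdot (cis t z) (cis t w) = rdot z w.
Proof. by rewrite rdot_cis cis_add addNr cis0. Qed.

Lemma enorm_cis t z : enorm (cis t z) = enorm z.
Proof. by rewrite /enorm rdot_ciscis. Qed.

End Pointwise.

Section Pairing.
Context {R : realType} {n : nat}.
Local Notation mu := (@lebesgue_measure R).
Local Notation S1 := (@circle R).
Implicit Types (z w b : cspace R n) (g h k : loop R n).

Lemma square_integrableP g : square_integrable g <->
  (forall j, sqint (fun t => (g t).1 ord0 j)) /\ (forall j, sqint (fun t => (g t).2 ord0 j)).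
Proof.
split=> [[m1 [m2 ig]]|[s1 s2]].
  split=> j; (split; first by []).
    apply: (circle_integrable_le _ ig); first exact: measurable_funX.
    move=> t _; rewrite normrX -enorm_sqr lerXn2r ?nnegrE ?enorm_ge0 //; exact: coord1_le.
  apply: (circle_integrable_le _ ig); first exact: measurable_funX.
  by move=> t _; rewrite normrX -enorm_sqr lerXn2r ?nnegrE ?enorm_ge0 //; exact: coord2_le.
split; first by move=> j; case: (s1 j).
split; first by move=> j; case: (s2 j).
apply: circle_integrable_sum => j _; apply: circle_integrableD; apply: circle_integrable_eq (_ : circle_integrable (fun t => _ ^+ 2)).
- by move=> t _; exact: expr2.
- exact: (s1 j).2.
- by move=> t _; exact: expr2.
- exact: (s2 j).2.
Qed.

Lemma sqiD g h : square_integrable g -> square_integrable h -> square_integrable (g + h).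
Proof.
move=> /square_integrableP[g1 g2] /square_integrableP[h1 h2]; apply/square_integrableP.
split=> j.
  have := sqintD (g1 j) (h1 j); congr sqint; apply/funext => t; by rewrite /= mxE.
have := sqintD (g2 j) (h2 j); congr sqint; apply/funext => t; by rewrite /= mxE.
Qed.

Lemma sqiZ a g : square_integrable g -> square_integrable (a *: g).
Proof.
move=> /square_integrableP[g1 g2]; apply/square_integrableP; split=> j.
  have := sqintZ a (g1 j); congr sqint; apply/funext => t; by rewrite /= mxE.
have := sqintZ a (g2 j); congr sqint; apply/funext => t; by rewrite /= mxE.
Qed.

Lemma sqiN g : square_integrable g -> square_integrable (- g).
Proof. by move=> /(sqiZ (-1)); rewrite scaleN1r. Qed.

Lemma sqiB g h : square_integrable g -> square_integrable h -> square_integrable (g - h).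
Proof. by move=> sg /sqiN; exact: sqiD. Qed.

Lemma circle_integrable_rdot g h : square_integrable g -> square_integrable h ->
  circle_integrable (fun t => rdot (g t) (h t)).
Proof.
move=> /square_integrableP[g1 g2] /square_integrableP[h1 h2].
by apply: circle_integrable_sum => j _; apply: circle_integrableD; exact: sqint_mul.
Qed.

Definition l2dot g h : R := circle_int (fun t => rdot (g t) (h t)).

Lemma l2dotC g h : l2dot g h = l2dot h g.
Proof. by apply: circle_int_eq => t _; rewrite rdotC. Qed.

Lemma l2dotDl g h k : square_integrable g -> square_integrable h -> square_integrable k ->
  l2dot (g + h) k = l2dot g k + l2dot h k.
Proof.
move=> sg sh sk; rewrite /l2dot -circle_intD; try exact: circle_integrable_rdot.
by apply: circle_int_eq => t _; rewrite rdotDl.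
Qed.

Lemma l2dotZl a g k : square_integrable g -> square_integrable k ->
  l2dot (a *: g) k = a * l2dot g k.
Proof.
move=> sg sk; rewrite /l2dot -circle_intZ; last exact: circle_integrable_rdot.
by apply: circle_int_eq => t _; rewrite rdotZl.
Qed.

Lemma l2dotDr g h k : square_integrable g -> square_integrable h -> square_integrable k ->
  l2dot k (g + h) = l2dot k g + l2dot k h.
Proof. by move=> *; rewrite !(l2dotC k) l2dotDl. Qed.

Lemma l2dotZr a g k : square_integrable g -> square_integrable k ->
  l2dot k (a *: g) = a * l2dot k g.
Proof. by move=> *; rewrite !(l2dotC k) l2dotZl. Qed.

Lemma l2dot_ge0 g : 0 <= l2dot g g.
Proof. by apply: circle_int_ge0 => t _; exact: rdot_ge0. Qed.

Lemma l2dot_sqD g h : square_integrable g -> square_integrable h ->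
  l2dot (g + h) (g + h) = l2dot g g + 2 * l2dot g h + l2dot h h.
Proof.
by move=> sg sh; have sgh := sqiD sg sh; rewrite l2dotDl // !l2dotDr // (l2dotC h g); ring.
Qed.

Lemma l2dot_sqB g h : square_integrable g -> square_integrable h ->
  l2dot (g - h) (g - h) = l2dot g g - 2 * l2dot g h + l2dot h h.
Proof.
move=> sg sh; have sN := sqiN sh.
rewrite l2dot_sqD // -scaleN1r l2dotZr // l2dotZl // ?l2dotZr //; [by ring|exact: sqiZ].
Qed.

Lemma l2dot_CS2 g h : square_integrable g -> square_integrable h ->
  l2dot g h ^+ 2 <= l2dot g g * l2dot h h.
Proof.
move=> sg sh; apply: quad_CS => [||a c]; [exact: l2dot_ge0|exact: l2dot_ge0|].
have := l2dot_ge0 (a *: g + c *: h).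
rewrite l2dot_sqD; try exact: sqiZ.
rewrite !l2dotZl ?l2dotZr //; try exact: sqiZ.
by congr (_ <= _); ring.
Qed.

End Pairing.

(** * Fourier series of loops *)

Section FTC.
Context {R : realType}.
Local Notation mu := (@lebesgue_measure R).
Local Notation S1 := (@circle R).

Lemma circle_int_deriv (F f : R -> R) : (forall t : R, is_derive t (1 : R) F (f t)) -> continuous f ->
  circle_int f = F (2 * pi) - F 0.
Proof.
move=> dF cf; have p0 := @pi2_gt0 R.
have cF : continuous F.
  by move=> t; apply: differentiable_continuous; apply/derivable1_diffP; have [] := dF t.
have := @continuous_FTC2 R f F 0 (2 * pi) p0 _ _ _.
rewrite /circle_int /Rintegral /circle => -> //.
- exact: continuous_subspaceT.
- split; [by move=> t _; have [] := dF t| |].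
    by apply: cvg_at_right_filter; exact: cF.
  by apply: cvg_at_left_filter; exact: cF.
- by move=> t _; rewrite derive1E; have [_ ->] := dF t.
Qed.

Lemma cos_sin_nat2pi (k : nat) : cos (k%:R * (2 * pi)) = 1 :> R /\ sin (k%:R * (2 * pi)) = 0 :> R.
Proof.
have c1 : cos (2 * pi) = 1 :> R by rewrite mulr_natl cos2pi.
have s1 : sin (2 * pi) = 0 :> R by rewrite mulr_natl sin2pi.
elim: k => [|k [c s]]; first by rewrite mul0r cos0 sin0.
by rewrite -natr1 mulrDl mul1r cosD sinD c s c1 s1; split; ring.
Qed.

Lemma cos_int2pi (m : int) : cos (m%:~R * (2 * pi)) = 1 :> R.
Proof.
case: m => k; first exact: (cos_sin_nat2pi k).1.
by rewrite NegzE mulrNz mulNr cosN; exact: (cos_sin_nat2pi k.+1).1.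
Qed.

Lemma sin_int2pi (m : int) : sin (m%:~R * (2 * pi)) = 0 :> R.
Proof.
case: m => k; first exact: (cos_sin_nat2pi k).2.
rewrite NegzE mulrNz mulNr sinN; apply/eqP; rewrite oppr_eq0; apply/eqP.
exact: (cos_sin_nat2pi k.+1).2.
Qed.

Lemma is_derive_scale (c t : R) : is_derive t 1 (fun s : R => c * s) c.
Proof.
have := @is_deriveZ _ _ _ (id : R -> R) c t 1 1 _; rewrite /GRing.scale /= mulr1; exact.
Qed.

Lemma is_derive_cosm (c t : R) : is_derive t 1 (fun s : R => cos (c * s)) (- c * sin (c * t)).
Proof.
have := @is_derive1_comp _ (@cos R) (fun s => c * s) t _ _ (is_derive_cos _) (is_derive_scale c t).
by rewrite (_ : - c * sin (c * t) = - sin (c * t) * c) //; ring.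
Qed.

Lemma is_derive_sinm (c t : R) : is_derive t 1 (fun s : R => sin (c * s)) (c * cos (c * t)).
Proof.
have := @is_derive1_comp _ (@sin R) (fun s => c * s) t _ _ (is_derive_sin _) (is_derive_scale c t).
by rewrite mulrC.
Qed.

Lemma circle_int_cosm (m : int) : circle_int (fun t : R => cos (m%:~R * t)) = if m == 0 then 2 * pi else 0.
Proof.
case: eqVneq => [->|m0].
  by rewrite (_ : (fun t => _) = fun=> 1) ?circle_int_cst ?mul1r //; apply/funext => t; rewrite mul0r cos0.
have mr0 : m%:~R != 0 :> R by rewrite intr_eq0.
have := @circle_int_deriv (fun t => sin (m%:~R * t)) (fun t => m%:~R * cos (m%:~R * t))
  (fun t => is_derive_sinm _ _) (trigp_continuous (trigp_scale _ (trigp_cos m))).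
rewrite circle_intZ; last exact: circle_integrable_cont (trigp_continuous (trigp_cos m)).
rewrite sin_int2pi mulr0 sin0 subrr => /eqP; rewrite mulf_eq0 (negbTE mr0) /=.
by move/eqP.
Qed.

Lemma circle_int_sinm (m : int) : circle_int (fun t : R => sin (m%:~R * t)) = 0.
Proof.
have [->|m0] := eqVneq m 0.
  by rewrite (_ : (fun t => _) = fun=> 0) ?circle_int_cst ?mul0r //; apply/funext => t; rewrite mul0r sin0.
have mr0 : - m%:~R != 0 :> R by rewrite oppr_eq0 intr_eq0.
have := @circle_int_deriv (fun t => cos (m%:~R * t)) (fun t => - m%:~R * sin (m%:~R * t))
  (fun t => is_derive_cosm _ _) (trigp_continuous (trigp_scale _ (trigp_sin m))).
rewrite circle_intZ; last exact: circle_integrable_cont (trigp_continuous (trigp_sin m)).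
rewrite cos_int2pi mulr0 cos0 subrr => /eqP; rewrite mulf_eq0 (negbTE mr0) /=.
by move/eqP.
Qed.

End FTC.

Section Modes.

Definition modes (N : nat) : seq int := [seq (i%:Z - N%:Z) | i <- iota 0 N.*2.+1].

Lemma mem_modes N m : (m \in modes N) = (`|m| <= N)%N.
Proof.
apply/mapP/idP => [[i]|mN]; first by rewrite mem_iota => /andP[_ iN] ->; lia.
by exists `|(m + N%:Z)%R|%N; [rewrite mem_iota|]; lia.
Qed.

Lemma uniq_modes N : uniq (modes N).
Proof. by rewrite map_inj_uniq ?iota_uniq // => i j /addIr []. Qed.

Lemma sum_modes_widen (V : nmodType) N M (F : int -> V) : (N <= M)%N ->
  \sum_(m <- modes N) F m = \sum_(m <- modes M | (`|m| <= N)%N) F m.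
Proof.
move=> NM; rewrite -[RHS]big_filter; apply: perm_big; apply: uniq_perm.
- exact: uniq_modes.
- by rewrite filter_uniq // uniq_modes.
- move=> m; rewrite mem_filter !mem_modes.
  by case: leqP => //= mN; rewrite (leq_trans mN).
Qed.

Lemma sum_modes_eq (V : nmodType) N (F G : int -> V) : (forall m, (`|m| <= N)%N -> F m = G m) ->
  \sum_(m <- modes N) F m = \sum_(m <- modes N) G m.
Proof. by move=> FG; apply: eq_big_seq => m; rewrite mem_modes => /FG. Qed.

Lemma sum_modes_le (R : numDomainType) N (F G : int -> R) : (forall m, (`|m| <= N)%N -> F m <= G m) ->
  \sum_(m <- modes N) F m <= \sum_(m <- modes N) G m.
Proof. by move=> FG; rewrite !big_seq; apply: ler_sum => m; rewrite mem_modes => /FG. Qed.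

Lemma sum_modes_mono (R : numDomainType) N M (F : int -> R) : (N <= M)%N -> (forall m, 0 <= F m) ->
  \sum_(m <- modes N) F m <= \sum_(m <- modes M) F m.
Proof.
move=> NM F0; rewrite (sum_modes_widen _ NM) [leRHS](bigID (fun m : int => (`|m| <= N)%N)) /=.
by rewrite lerDl sumr_ge0.
Qed.

Lemma sum_modes_term (R : numDomainType) N (F : int -> R) m : (`|m| <= N)%N -> (forall m, 0 <= F m) ->
  F m <= \sum_(k <- modes N) F k.
Proof.
move=> mN F0; rewrite (big_rem m) /= ?mem_modes // lerDl sumr_ge0 //.
Qed.

Lemma sum_modes_single (V : nmodType) N (F : int -> V) m : (forall k, k != m -> F k = 0) ->
  \sum_(k <- modes N) F k = if (`|m| <= N)%N then F m else 0.
Proof.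
move=> F0; case: ifP => mN.
  have mm : m \in modes N by rewrite mem_modes.
  by rewrite (bigD1_seq m mm (uniq_modes N)) /= big1 ?addr0.
rewrite big1_seq // => k /andP[_]; rewrite mem_modes => kN; apply: F0.
by apply: contraTneq kN => ->; rewrite mN.
Qed.

End Modes.

Lemma JmulN (R : realType) (n : nat) (z : cspace R n) : Jmul (- z) = - Jmul z.
Proof. by rewrite -scaleN1r JmulZ scaleN1r. Qed.

Section Fourier.
Context {R : realType} {n : nat}.
Local Notation mu := (@lebesgue_measure R).
Local Notation S1 := (@circle R).
Implicit Types (z w a b : cspace R n) (g h k : loop R n) (m l : int) (c d : int -> cspace R n).

Lemma loopDE g h t : (g + h) t = g t + h t. Proof. by []. Qed.
Lemma loopZE x g t : (x *: g) t = x *: g t. Proof. by []. Qed.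

Lemma sum_loopE (I : Type) (r : seq I) (P : pred I) (F : I -> loop R n) t :
  (\sum_(j <- r | P j) F j) t = \sum_(j <- r | P j) F j t.
Proof. by elim/big_rec2: _ => // j x y _ <-. Qed.

(** The loop e^{imt} b. *)
Definition trig m b : loop R n := fun t => cis (m%:~R * t) b.

Lemma trigp_trig1 m b j : trigp (fun t => (trig m b t).1 ord0 j).
Proof.
apply: trigp_ext (trigp_add (trigp_scale (b.1 ord0 j) (trigp_cos m)) (trigp_scale (- b.2 ord0 j) (trigp_sin m))) _ => t.
by rewrite /trig /cis /= !mxE mulrC [X in _ + X]mulrC.
Qed.

Lemma trigp_trig2 m b j : trigp (fun t => (trig m b t).2 ord0 j).
Proof.
apply: trigp_ext (trigp_add (trigp_scale (b.2 ord0 j) (trigp_cos m)) (trigp_scale (b.1 ord0 j) (trigp_sin m))) _ => t.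
by rewrite /trig /cis /= !mxE mulrC [X in _ + X]mulrC.
Qed.

Lemma sqi_trig m b : square_integrable (trig m b).
Proof.
by apply/square_integrableP; split=> j; apply: sqint_trigp; [exact: trigp_trig1|exact: trigp_trig2].
Qed.

Lemma rdot_trig m l a b t : rdot (trig m a t) (trig l b t) =
  rdot a b * cos ((m - l)%:~R * t) + rdot (Jmul a) b * sin ((m - l)%:~R * t).
Proof.
rewrite /trig -{1}[m%:~R * t](subrK (l%:~R * t)) addrC -cis_add rdot_ciscis -mulrBl -intrB.
by rewrite /cis rdotDl !rdotZl; ring.
Qed.

Lemma l2dot_trig m l a b : l2dot (trig m a) (trig l b) = if m == l then 2 * pi * rdot a b else 0.
Proof.
rewrite /l2dot (circle_int_eq (g := fun t => rdot a b * cos ((m - l)%:~R * t) + rdot (Jmul a) b * sin ((m - l)%:~R * t))); last first.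
  by move=> t _; exact: rdot_trig.
have ic : circle_integrable (fun t : R => cos ((m - l)%:~R * t)) by exact: circle_integrable_cont (trigp_continuous (trigp_cos _)).
have is_ : circle_integrable (fun t : R => sin ((m - l)%:~R * t)) by exact: circle_integrable_cont (trigp_continuous (trigp_sin _)).
rewrite circle_intD; try exact: circle_integrableZ.
rewrite !circle_intZ // circle_int_cosm circle_int_sinm mulr0 addr0 subr_eq0.
by case: eqP => _; rewrite ?mulr0 // mulrC.
Qed.

Lemma cint_rdot g b : (forall j, circle_integrable (fun t => (g t).1 ord0 j)) ->
  (forall j, circle_integrable (fun t => (g t).2 ord0 j)) ->
  rdot (cint g) b = circle_int (fun t => rdot (g t) b).
Proof.
move=> i1 i2; rewrite /rdot circle_int_sum; last first.
  by move=> j _; apply: circle_integrableD; [have := circle_integrableZ (b.1 ord0 j) (i1 j)|have := circle_integrableZ (b.2 ord0 j) (i2 j)];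
    apply: circle_integrable_eq => t _; rewrite mulrC.
apply: eq_bigr => j _; rewrite /= !mxE.
rewrite (circle_int_eq (g := fun t => b.1 ord0 j * (g t).1 ord0 j + b.2 ord0 j * (g t).2 ord0 j)); last first.
  by move=> t _; ring.
by rewrite circle_intD ?circle_intZ //; try exact: circle_integrableZ; rewrite /circle_int; ring.
Qed.

Lemma circle_integrable_twist1 g m j : square_integrable g ->
  circle_integrable (fun t => (cis (- (m%:~R * t)) (g t)).1 ord0 j).
Proof.
move=> /square_integrableP[g1 g2].
apply: circle_integrable_eq (circle_integrableD (sqint_mul (sqint_trigp (trigp_cos m)) (g1 j)) (sqint_mul (sqint_trigp (trigp_sin m)) (g2 j))) => t _.
by rewrite /cis /Jmul /= !mxE cosN sinN mulrNN.
Qed.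

Lemma circle_integrable_twist2 g m j : square_integrable g ->
  circle_integrable (fun t => (cis (- (m%:~R * t)) (g t)).2 ord0 j).
Proof.
move=> /square_integrableP[g1 g2].
apply: circle_integrable_eq (circle_integrableD (sqint_mul (sqint_trigp (trigp_cos m)) (g2 j)) (circle_integrableZ (-1) (sqint_mul (sqint_trigp (trigp_sin m)) (g1 j)))) => t _.
by rewrite /cis /Jmul /= !mxE cosN sinN mulN1r mulNr.
Qed.

Lemma l2dot_fcoef g m b : square_integrable g ->
  l2dot g (trig m b) = 2 * pi * rdot (fcoef g m) b.
Proof.
move=> sg; rewrite /fcoef rdotZl mulrA divff ?gt_eqF ?pi2_gt0 // mul1r cint_rdot.
- by apply: circle_int_eq => t _; rewrite /trig rdot_cis opprK.
- by move=> j; exact: circle_integrable_twist1.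
- by move=> j; exact: circle_integrable_twist2.
Qed.

(** The Fourier coefficient is determined by the pairing with trigonometric
    monomials, so its algebra follows from the bilinearity of the pairing. *)
Lemma fcoefP g m z : square_integrable g ->
  (forall b, l2dot g (trig m b) = 2 * pi * rdot z b) -> fcoef g m = z.
Proof.
move=> sg H; apply: rdot_inj => b; apply: (mulfI (x := 2 * pi)); first by rewrite gt_eqF ?pi2_gt0.
by rewrite -l2dot_fcoef.
Qed.

Lemma fcoefD g h m : square_integrable g -> square_integrable h ->
  fcoef (g + h) m = fcoef g m + fcoef h m.
Proof.
move=> sg sh; apply: fcoefP => [|b]; first exact: sqiD.
have st := @sqi_trig m b.
by rewrite l2dotDl // !l2dot_fcoef // -mulrDr -rdotDl.
Qed.

Lemma fcoefZ x g m : square_integrable g -> fcoef (x *: g) m = x *: fcoef g m.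
Proof.
move=> sg; apply: fcoefP => [|b]; first exact: sqiZ.
have st := @sqi_trig m b.
by rewrite l2dotZl // l2dot_fcoef // [rdot (x *: _) b]rdotZl mulrCA.
Qed.

Lemma fcoefN g m : square_integrable g -> fcoef (- g) m = - fcoef g m.
Proof. by move=> sg; rewrite -scaleN1r fcoefZ // scaleN1r. Qed.

Lemma fcoefB g h m : square_integrable g -> square_integrable h ->
  fcoef (g - h) m = fcoef g m - fcoef h m.
Proof. by move=> sg sh; rewrite fcoefD ?fcoefN //; exact: sqiN. Qed.

Lemma fcoef_trig l b m : fcoef (trig l b) m = if m == l then b else 0.
Proof.
apply: fcoefP => [|a]; first exact: sqi_trig.
by rewrite l2dot_trig eq_sym; case: eqP => _ //; rewrite rdot0l mulr0.
Qed.

Definition tpoly N c : loop R n := \sum_(m <- modes N) trig m (c m).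

Lemma sqi_sum (I : Type) (r : seq I) (F : I -> loop R n) :
  (forall i, square_integrable (F i)) -> square_integrable (\sum_(i <- r) F i).
Proof.
move=> sF; elim: r => [|i r IH]; last by rewrite big_cons; exact: sqiD.
rewrite big_nil -(scale0r (trig 0 0)); apply: sqiZ; exact: sqi_trig.
Qed.

Lemma sqi_tpoly N c : square_integrable (tpoly N c).
Proof. by apply: sqi_sum => m; exact: sqi_trig. Qed.

Lemma sqi0 : square_integrable (0 : loop R n).
Proof. by have := @sqi_sum int [::] (fun=> trig 0 0) (fun=> sqi_trig _ _); rewrite big_nil. Qed.

Lemma fcoef_sum (I : Type) (r : seq I) (F : I -> loop R n) m :
  (forall i, square_integrable (F i)) ->
  fcoef (\sum_(i <- r) F i) m = \sum_(i <- r) fcoef (F i) m.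
Proof.
move=> sF; elim: r => [|i r IH]; last by rewrite !big_cons fcoefD ?IH //; exact: sqi_sum.
by rewrite !big_nil -(scale0r (0 : loop R n)) fcoefZ ?scale0r //; exact: sqi0.
Qed.

Lemma fcoef_tpoly N c m : fcoef (tpoly N c) m = if (`|m| <= N)%N then c m else 0.
Proof.
rewrite fcoef_sum; last by move=> i; exact: sqi_trig.
rewrite (@sum_modes_single _ _ _ m) ?fcoef_trig ?eqxx // => k km.
by rewrite fcoef_trig eq_sym (negbTE km).
Qed.

Lemma l2dot_sumr (I : Type) (r : seq I) (F : I -> loop R n) g :
  square_integrable g -> (forall i, square_integrable (F i)) ->
  l2dot g (\sum_(i <- r) F i) = \sum_(i <- r) l2dot g (F i).
Proof.
move=> sg sF; elim: r => [|i r IH]; last by rewrite !big_cons l2dotDr ?IH //; exact: sqi_sum.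
by rewrite !big_nil -(scale0r (0 : loop R n)) l2dotZr ?mul0r //; exact: sqi0.
Qed.

Lemma l2dot_tpoly g N c : square_integrable g ->
  l2dot g (tpoly N c) = 2 * pi * \sum_(m <- modes N) rdot (fcoef g m) (c m).
Proof.
move=> sg; rewrite l2dot_sumr //; last by move=> m; exact: sqi_trig.
by rewrite mulr_sumr; apply: eq_bigr => m _; rewrite l2dot_fcoef.
Qed.

Lemma l2dot_tpoly2 N c : l2dot (tpoly N c) (tpoly N c) = 2 * pi * \sum_(m <- modes N) enorm (c m) ^+ 2.
Proof.
rewrite l2dot_tpoly; last exact: sqi_tpoly.
by congr (_ * _); apply: sum_modes_eq => m mN; rewrite fcoef_tpoly mN enorm_sqr.
Qed.

Definition fourier_energy N g : R := \sum_(m <- modes N) enorm (fcoef g m) ^+ 2.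

(** The partial Fourier sum is the best approximation of its degree: the
    left-hand side is its squared distance to g. *)
Lemma l2dot_best N g c : square_integrable g ->
  l2dot g g - 2 * pi * fourier_energy N g <= l2dot (g - tpoly N c) (g - tpoly N c).
Proof.
move=> sg; rewrite l2dot_sqB ?l2dot_tpoly2 ?l2dot_tpoly //; try exact: sqi_tpoly.
rewrite -addrA lerD2l -subr_ge0 opprK.
have -> : - (2 * (2 * pi * \sum_(m <- modes N) rdot (fcoef g m) (c m))) +
  2 * pi * (\sum_(m <- modes N) enorm (c m) ^+ 2) + 2 * pi * fourier_energy N g =
  2 * pi * \sum_(m <- modes N) enorm (fcoef g m - c m) ^+ 2.
  have -> : \sum_(m <- modes N) enorm (fcoef g m - c m) ^+ 2 = \sum_(m <- modes N)
      (enorm (fcoef g m) ^+ 2 - 2 * rdot (fcoef g m) (c m) + enorm (c m) ^+ 2).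
    apply: eq_bigr => m _; rewrite !enorm_sqr rdotBl ![rdot _ (fcoef g m - _)]rdotC !rdotBl.
    by rewrite (rdotC (c m) (fcoef g m)); ring.
  by rewrite !big_split /= sumrN -mulr_sumr /fourier_energy; ring.
by apply: mulr_ge0; [exact: ltW (pi2_gt0)|apply: sumr_ge0 => m _; exact: sqr_ge0].
Qed.

Lemma l2dot_fpart N g : square_integrable g ->
  l2dot (g - tpoly N (fcoef g)) (g - tpoly N (fcoef g)) = l2dot g g - 2 * pi * fourier_energy N g.
Proof.
move=> sg; rewrite l2dot_sqB ?l2dot_tpoly2 ?l2dot_tpoly //; try exact: sqi_tpoly.
rewrite -/(fourier_energy N g) (_ : \sum_(m <- modes N) rdot _ _ = fourier_energy N g); first by ring.
by apply: eq_bigr => m _; rewrite enorm_sqr.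
Qed.

Lemma bessel N g : square_integrable g -> 2 * pi * fourier_energy N g <= l2dot g g.
Proof. by move=> sg; rewrite -subr_ge0 -l2dot_fpart // l2dot_ge0. Qed.

Definition is_tpoly g := exists N c, g = tpoly N c.

Lemma tpoly_widen N M c : (N <= M)%N ->
  tpoly N c = tpoly M (fun m => if (`|m| <= N)%N then c m else 0).
Proof.
move=> NM; rewrite /tpoly (sum_modes_widen _ NM) big_mkcond /=; apply: eq_bigr => m _.
by case: ifP => // _; apply/funext => t; rewrite /trig /cis /Jmul /= oppr0 !scaler0 addr0.
Qed.

Lemma tpolyD N c d : tpoly N c + tpoly N d = tpoly N (fun m => c m + d m).
Proof.
by rewrite /tpoly -big_split; apply: eq_bigr => m _; apply/funext => t; rewrite /trig cisD.
Qed.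

Lemma tpolyZ N x c : x *: tpoly N c = tpoly N (fun m => x *: c m).
Proof.
by rewrite /tpoly scaler_sumr; apply: eq_bigr => m _; apply/funext => t; rewrite /trig cisZ.
Qed.

Lemma is_tpolyD g h : is_tpoly g -> is_tpoly h -> is_tpoly (g + h).
Proof.
move=> [N [c ->]] [M [d ->]].
exists (maxn N M); rewrite (tpoly_widen c (leq_maxl N M)) (tpoly_widen d (leq_maxr N M)) tpolyD.
by eexists.
Qed.

Lemma is_tpolyZ x g : is_tpoly g -> is_tpoly (x *: g).
Proof. by move=> [N [c ->]]; rewrite tpolyZ; exists N; eexists. Qed.

Lemma is_tpoly_trig m b : is_tpoly (trig m b).
Proof.
exists (absz m), (fun k : int => if k == m then b else 0).
have mm : m \in modes (absz m) by rewrite mem_modes.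
rewrite /tpoly (bigD1_seq m mm (uniq_modes _)) /= eqxx big1 ?addr0 // => k /negbTE ->.
by apply/funext => t; rewrite /trig /cis /Jmul /= oppr0 !scaler0 addr0.
Qed.

Lemma is_tpoly0 : is_tpoly 0.
Proof. by rewrite -(scale0r (trig 0 0)); apply: is_tpolyZ; exact: is_tpoly_trig. Qed.

Lemma is_tpoly_sum (I : Type) (r : seq I) (F : I -> loop R n) :
  (forall i, is_tpoly (F i)) -> is_tpoly (\sum_(i <- r) F i).
Proof.
move=> sF; elim: r => [|i r IH]; last by rewrite big_cons; exact: is_tpolyD.
by rewrite big_nil; exact: is_tpoly0.
Qed.

Lemma is_tpoly_trigp f b : trigp f -> is_tpoly (fun t => f t *: b).
Proof.
elim=> {f} [m|m|f g _ H1 _ H2|x f _ H].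
- have -> : (fun t => cos (m%:~R * t) *: b) = 2^-1 *: (trig m b + trig (- m) b).
    apply/funext => t; rewrite loopZE loopDE /trig /cis mulrNz mulNr cosN sinN scaleNr addrACA subrr addr0.
    by rewrite -scalerDl scalerA; congr (_ *: _); field.
  by apply: is_tpolyZ; apply: is_tpolyD; exact: is_tpoly_trig.
- have -> : (fun t => sin (m%:~R * t) *: b) = 2^-1 *: (trig m (- Jmul b) + trig (- m) (Jmul b)).
    apply/funext => t; rewrite loopZE loopDE /trig /cis mulrNz mulNr cosN sinN scaleNr.
    rewrite JmulN JmulJ opprK scalerN (scalerN (sin _)) opprK addrACA addNr add0r.
    rewrite -scalerDl scalerA.
    by congr (_ *: _); field.
  by apply: is_tpolyZ; apply: is_tpolyD; exact: is_tpoly_trig.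
- rewrite (_ : (fun t => _) = (fun t => f t *: b) + (fun t => g t *: b)); first exact: is_tpolyD.
  by apply/funext => t; rewrite scalerDl.
- rewrite (_ : (fun t => _) = x *: (fun t => f t *: b)); first exact: is_tpolyZ.
  by apply/funext => t; rewrite loopZE scalerA.
Qed.

(** Approximate each of the 2 n real coordinates. *)
Lemma tpoly_dense g e : square_integrable g -> 0 < e ->
  exists2 h, is_tpoly h & l2dot (g - h) (g - h) < e.
Proof.
move=> /square_integrableP[g1 g2] e0.
pose e' := e / (n.*2.+1)%:R.
have e'0 : 0 < e' by rewrite divr_gt0 ?ltr0n.
have A1 j := trig_dense_sqint (g1 j) e'0; have A2 j := trig_dense_sqint (g2 j) e'0.
have [f1 H1] : exists f1 : 'I_n -> R -> R, forall j, trigp (f1 j) /\ l2sq (fun t => (g t).1 ord0 j - f1 j t) < e'.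
  have X j : exists f, trigp f /\ l2sq (fun t => (g t).1 ord0 j - f t) < e'.
    by have [f tf lf] := A1 j; exists f.
  by have [f H] := choice X; exists f.
have [f2 H2] : exists f2 : 'I_n -> R -> R, forall j, trigp (f2 j) /\ l2sq (fun t => (g t).2 ord0 j - f2 j t) < e'.
  have X j : exists f, trigp f /\ l2sq (fun t => (g t).2 ord0 j - f t) < e'.
    by have [f tf lf] := A2 j; exists f.
  by have [f H] := choice X; exists f.
pose F1 j : loop R n := fun t => f1 j t *: e1 j.
pose F2 j : loop R n := fun t => f2 j t *: e2 j.
pose h : loop R n := \sum_j F1 j + \sum_j F2 j.
have h1 t j : (h t).1 ord0 j = f1 j t.
  rewrite -rdot_e1 /h loopDE !sum_loopE /F1 /F2 rdotDl !rdot_suml (bigD1 j) //= !big1 ?addr0 //.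
  - by rewrite rdotZl rdot_e1 !mxE !eqxx mulr1.
  - by move=> i _; rewrite rdotZl rdot_e1 !mxE mulr0.
  - by move=> i ij; rewrite rdotZl rdot_e1 !mxE eq_sym (negbTE ij) andbF mulr0.
have h2 t j : (h t).2 ord0 j = f2 j t.
  rewrite -rdot_e2 /h loopDE !sum_loopE /F1 /F2 rdotDl !rdot_suml [X in _ + X](bigD1 j) //= !big1 ?addr0 ?add0r //.
  - by rewrite rdotZl rdot_e2 !mxE !eqxx mulr1.
  - by move=> i ij; rewrite rdotZl rdot_e2 !mxE eq_sym (negbTE ij) andbF mulr0.
  - by move=> i _; rewrite rdotZl rdot_e2 !mxE mulr0.
exists h.
  by apply: is_tpolyD; apply: is_tpoly_sum => j; apply: is_tpoly_trigp; [exact: (H1 j).1|exact: (H2 j).1].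
have E : l2dot (g - h) (g - h) = \sum_j (l2sq (fun t => (g t).1 ord0 j - f1 j t) + l2sq (fun t => (g t).2 ord0 j - f2 j t)).
  have i1 j := (sqintB (g1 j) (sqint_trigp (H1 j).1)).2.
  have i2 j := (sqintB (g2 j) (sqint_trigp (H2 j).1)).2.
  rewrite /l2sq; under [RHS]eq_bigr do rewrite -circle_intD //.
  rewrite -circle_int_sum; last by move=> j _; exact: circle_integrableD.
  apply: circle_int_eq => t _; apply: eq_bigr => j _; rewrite -h1 -h2 (_ : (g - h) t = g t - h t) //.
  by case: (g t) => ? ?; case: (h t) => ? ? /=; rewrite !mxE -!expr2.
rewrite E; apply: (@le_lt_trans _ _ (\sum_(j < n) (e' + e'))).
  by apply: ler_sum => j _; rewrite lerD // ltW // ?(H1 j).2 ?(H2 j).2.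
rewrite sumr_const card_ord -mulr2n -mulrnA mul2n -[_ *+ _]mulr_natr /e'.
by rewrite mulrAC ltr_pdivrMr ?ltr0n // ltr_pM2l // ltr_nat.
Qed.

(** A trigonometric polynomial close to g is not closer than the partial
    Fourier sum of the same degree. *)
Theorem parseval g e : square_integrable g -> 0 < e ->
  exists N0, forall N, (N0 <= N)%N -> l2dot g g - 2 * pi * fourier_energy N g < e.
Proof.
move=> sg e0; have [h [N0 [c ->]] Hh] := tpoly_dense sg e0.
exists N0 => N NN; rewrite (tpoly_widen c NN) in Hh.
exact: le_lt_trans (l2dot_best _ _ sg) Hh.
Qed.

End Fourier.

(** * The space L^2_{1/2} *)

Lemma sqr_triangle (R : realFieldType) (w x y v : R) : 0 <= w -> 0 <= x -> x <= v + y ->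
  w * x ^+ 2 <= w * v ^+ 2 + 2 * (w * (v * y)) + w * y ^+ 2.
Proof.
move=> w0 x0 xvy; have -> : w * v ^+ 2 + 2 * (w * (v * y)) + w * y ^+ 2 = w * (v + y) ^+ 2 by ring.
by rewrite ler_wpM2l // lerXn2r // nnegrE // (le_trans x0).
Qed.

Lemma cis_int2pi (R : realType) (n : nat) (m : int) (z : cspace R n) : cis (m%:~R * (2 * pi)) z = z.
Proof. by rewrite /cis cos_int2pi sin_int2pi scale1r scale0r addr0. Qed.

Lemma enorm_sqrD (R : realType) (n : nat) (z w : cspace R n) :
  enorm (z + w) ^+ 2 = enorm z ^+ 2 + 2 * rdot z w + enorm w ^+ 2.
Proof. by rewrite !enorm_sqr rdotDl !rdotDr (rdotC w z); ring. Qed.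

Lemma enorm_J (R : realType) (n : nat) (z : cspace R n) : enorm (Jmul z) = enorm z.
Proof. by rewrite /enorm rdotJJ. Qed.

Opaque fcoef l2dot cis rdot enorm square_integrable.

Section Seminorm.
Context {R : realType} {n : nat}.
Implicit Types (z w a b : cspace R n) (g h k : loop R n) (m l : int) (c d : int -> cspace R n).

(** The weight of |g_m|^2 in the squared norm of L^2_{1/2}. *)
Definition sob_weight m : R := `|m%:~R| + (m == 0)%:R.

Lemma sob_weight_ge1 m : 1 <= sob_weight m.
Proof.
rewrite /sob_weight; case: eqVneq => [->|m0]; first by rewrite normr0 add0r.
by rewrite addr0 -intr_norm -[1]/(1%:~R) ler_int; lia.
Qed.

Lemma sob_weight_ge0 m : 0 <= sob_weight m. Proof. exact: le_trans (sob_weight_ge1 m). Qed.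

Lemma norm_le_sob_weight m : `|m%:~R : R| <= sob_weight m. Proof. by rewrite /sob_weight lerDl. Qed.

Definition sob_partial N g : R := \sum_(m <- modes N) sob_weight m * enorm (fcoef g m) ^+ 2.

Lemma sob_partialE N g :
  sob_partial N g = \sum_(m <- modes N) enorm (fcoef g m) ^+ 2 * `|m%:~R| + enorm (fcoef g 0) ^+ 2.
Proof.
rewrite /sob_partial; under eq_bigr do rewrite /sob_weight mulrDl mulrC.
rewrite big_split /=; congr (_ + _); rewrite (@sum_modes_single _ _ _ 0) /= ?eqxx ?mul1r //.
by move=> k /negbTE ->; rewrite mul0r.
Qed.

Lemma sob_partial_le_lnorm2 N g : ((sob_partial N g)%:E <= lnorm2 g)%E.
Proof.
rewrite sob_partialE EFinD /lnorm2 leeD2r //; apply: esum_ge; exists [set` modes N].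
  by split; [exact: finite_seq|].
by rewrite -fsbig_seq ?uniq_modes // sumEFin.
Qed.

Lemma lnorm2_le g B : (forall N, sob_partial N g <= B) -> (lnorm2 g <= B%:E)%E.
Proof.
move=> HB; rewrite /lnorm2 -leeBrDr // -EFinB; apply: ge_ereal_sup => _ [X [fX _] <-].
pose N := \max_(m <- fset_set X) absz m.
apply: (@le_trans _ _ (\sum_(m \in [set` modes N]) (enorm (fcoef g m) ^+ 2 * `|m%:~R|)%:E)%E).
  apply: lee_fsum_nneg_subset => //; [exact: finite_seq| |].
    move=> m mX; apply/mem_set => /=; rewrite mem_modes; rewrite /N (big_rem m) ?leq_maxl //.
    by rewrite in_fset_set.
  by move=> m _; rewrite lee_fin mulr_ge0 ?sqr_ge0.
by rewrite -fsbig_seq ?uniq_modes // sumEFin lee_fin lerBrDr -sob_partialE.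
Qed.

Lemma lnorm2_ge0 g : (0 <= lnorm2 g)%E.
Proof.
apply: le_trans (sob_partial_le_lnorm2 0 g); rewrite lee_fin.
by apply: sumr_ge0 => m _; rewrite mulr_ge0 ?sqr_ge0 ?sob_weight_ge0.
Qed.

Lemma lnorm_sqr g : lnorm g ^+ 2 = fine (lnorm2 g).
Proof. by rewrite sqr_sqrtr // fine_ge0 // lnorm2_ge0. Qed.

Lemma lnorm_ge0 g : 0 <= lnorm g. Proof. exact: sqrtr_ge0. Qed.

Opaque lnorm.

Definition lnorm_finite g := (lnorm2 g < +oo)%E.

Lemma sob_partial_le N g : lnorm_finite g -> sob_partial N g <= lnorm g ^+ 2.
Proof.
move=> fg; rewrite lnorm_sqr -lee_fin fineK ?sob_partial_le_lnorm2 //.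
by rewrite ge0_fin_numE // lnorm2_ge0.
Qed.

(** Membership in L^2_{1/2} is tested on the partial sums, which exhaust the
    sums over arbitrary finite sets of indices in the definition of the norm. *)
Lemma lnorm_finiteP g B : (forall N, sob_partial N g <= B) -> lnorm_finite g /\ lnorm g ^+ 2 <= B.
Proof.
move=> /lnorm2_le HB; have fg : lnorm_finite g by rewrite /lnorm_finite (le_lt_trans HB) // ltry.
by split=> //; rewrite lnorm_sqr -lee_fin fineK // ge0_fin_numE // lnorm2_ge0.
Qed.

Lemma sob_partial_ge0 N g : 0 <= sob_partial N g.
Proof. by apply: sumr_ge0 => m _; rewrite mulr_ge0 ?sqr_ge0 ?sob_weight_ge0. Qed.

Definition sob_form N g h : R := \sum_(m <- modes N) sob_weight m * (enorm (fcoef g m) * enorm (fcoef h m)).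

Lemma sob_form_le N g h : lnorm_finite g -> lnorm_finite h -> sob_form N g h <= lnorm g * lnorm h.
Proof.
move=> fg fh; rewrite (le_trans (ler_norm _)) //.
rewrite -(@ler_pXn2r _ 2%N) ?nnegrE ?mulr_ge0 ?lnorm_ge0 // real_normK ?num_real // exprMn.
apply: le_trans (weighted_CS _ _ _ sob_weight_ge0) _.
by apply: ler_pM; [exact: sob_partial_ge0|exact: sob_partial_ge0|exact: sob_partial_le|exact: sob_partial_le].
Qed.

Lemma sob_partialD N g h : square_integrable g -> square_integrable h ->
  sob_partial N (g + h) <= sob_partial N g + 2 * sob_form N g h + sob_partial N h.
Proof.
move=> sg sh; rewrite /sob_partial /sob_form mulr_sumr -!big_split /=; apply: ler_sum => m _.
by rewrite fcoefD //; apply: sqr_triangle; rewrite ?sob_weight_ge0 ?enorm_ge0 ?enormD.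
Qed.

Lemma lnorm_finiteD g h : square_integrable g -> square_integrable h -> lnorm_finite g -> lnorm_finite h ->
  lnorm_finite (g + h) /\ lnorm (g + h) <= lnorm g + lnorm h.
Proof.
move=> sg sh fg fh.
have [N|f l] := @lnorm_finiteP (g + h) ((lnorm g + lnorm h) ^+ 2).
  apply: le_trans (sob_partialD _ sg sh) _.
  rewrite sqrrD -(mulr_natl (lnorm g * lnorm h)); apply: lerD; last exact: sob_partial_le.
  by apply: lerD; [exact: sob_partial_le|rewrite ler_pM2l // sob_form_le].
by split=> //; rewrite -(@ler_pXn2r _ 2%N) ?nnegrE ?addr_ge0 ?lnorm_ge0.
Qed.

Lemma sob_partialZ N x g : square_integrable g -> sob_partial N (x *: g) = x ^+ 2 * sob_partial N g.
Proof.
move=> sg; rewrite mulr_sumr; apply: eq_bigr => m _.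
by rewrite fcoefZ // enormZ exprMn real_normK ?num_real //; ring.
Qed.

Lemma lnorm_finiteZ x g : square_integrable g -> lnorm_finite g -> lnorm_finite (x *: g) /\ lnorm (x *: g) <= `|x| * lnorm g.
Proof.
move=> sg fg; have [N|f l] := @lnorm_finiteP (x *: g) ((`|x| * lnorm g) ^+ 2).
  by rewrite sob_partialZ // exprMn real_normK ?num_real // ler_wpM2l ?sqr_ge0 // sob_partial_le.
by split=> //; rewrite -(@ler_pXn2r _ 2%N) ?nnegrE ?mulr_ge0 ?lnorm_ge0.
Qed.

Lemma sobP g : loop_periodic g -> square_integrable g -> lnorm_finite g -> sob_half g. Proof. by []. Qed.
Lemma sob_per g : sob_half g -> loop_periodic g. Proof. by case. Qed.
Lemma sob_sqi g : sob_half g -> square_integrable g. Proof. by case=> _ []. Qed.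
Lemma sob_fin g : sob_half g -> lnorm_finite g. Proof. by case=> _ []. Qed.

Opaque sob_half.

Lemma sobD g h : sob_half g -> sob_half h -> sob_half (g + h).
Proof.
move=> sg sh; apply: sobP.
- by move=> t; rewrite !loopDE sob_per // sob_per.
- by apply: sqiD; exact: sob_sqi.
- by have [] := lnorm_finiteD (sob_sqi sg) (sob_sqi sh) (sob_fin sg) (sob_fin sh).
Qed.

Lemma sobZ x g : sob_half g -> sob_half (x *: g).
Proof.
move=> sg; apply: sobP.
- by move=> t; rewrite !loopZE sob_per.
- by apply: sqiZ; exact: sob_sqi.
- by have [] := lnorm_finiteZ x (sob_sqi sg) (sob_fin sg).
Qed.

Lemma sobN g : sob_half g -> sob_half (- g).
Proof. by move=> /(sobZ (-1)); rewrite scaleN1r. Qed.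

Lemma sobB g h : sob_half g -> sob_half h -> sob_half (g - h).
Proof. by move=> sg /sobN; exact: sobD. Qed.

Lemma lnormD g h : sob_half g -> sob_half h -> lnorm (g + h) <= lnorm g + lnorm h.
Proof.
by move=> sg sh; have [] := lnorm_finiteD (sob_sqi sg) (sob_sqi sh) (sob_fin sg) (sob_fin sh).
Qed.

Lemma lnormZ_le x g : sob_half g -> lnorm (x *: g) <= `|x| * lnorm g.
Proof. by move=> sg; have [] := lnorm_finiteZ x (sob_sqi sg) (sob_fin sg). Qed.

Lemma lnormN g : sob_half g -> lnorm (- g) = lnorm g.
Proof.
move=> sg; have H h : sob_half h -> lnorm (- h) <= lnorm h.
  by move=> sh; have := lnormZ_le (-1) sh; rewrite scaleN1r normrN1 mul1r.
apply/eqP; rewrite eq_le; apply/andP; split; first exact: H.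
by have := H _ (sobN sg); rewrite opprK.
Qed.

Lemma lnorm_distC g h : sob_half g -> sob_half h -> lnorm (g - h) = lnorm (h - g).
Proof. by move=> sg sh; rewrite -[LHS]lnormN; [rewrite opprB|exact: sobB]. Qed.

Lemma enorm_fcoef_le g m : lnorm_finite g -> enorm (fcoef g m) <= lnorm g.
Proof.
move=> fg; rewrite -(@ler_pXn2r _ 2%N) ?nnegrE ?enorm_ge0 ?lnorm_ge0 //.
apply: le_trans (sob_partial_le (absz m) fg).
apply: (@le_trans _ _ (sob_weight m * enorm (fcoef g m) ^+ 2)).
  by rewrite ler_peMl ?sqr_ge0 ?sob_weight_ge1.
apply: (@sum_modes_term _ _ (fun m => sob_weight m * enorm (fcoef g m) ^+ 2)) => // k.
by rewrite mulr_ge0 ?sqr_ge0 ?sob_weight_ge0.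
Qed.

Lemma fourier_energy_le N g : fourier_energy N g <= sob_partial N g.
Proof. by apply: ler_sum => m _; rewrite ler_peMl ?sqr_ge0 ?sob_weight_ge1. Qed.

Lemma l2dot_le_lnorm g : sob_half g -> l2dot g g <= 2 * pi * lnorm g ^+ 2.
Proof.
move=> sg; apply/ler_addgt0Pr => e e0.
have [N0 /(_ N0 (leqnn _))] := parseval (sob_sqi sg) e0.
have := le_trans (fourier_energy_le N0 g) (sob_partial_le N0 (sob_fin sg)).
rewrite -(ler_pM2l (@pi2_gt0 R)).
move: (l2dot g g) (2 * pi * fourier_energy N0 g) (2 * pi * lnorm g ^+ 2) => x y z; lra.
Qed.

(** The polarized Parseval identity: the pairing of h with the remainder of the
    Fourier series of g tends to zero by Cauchy-Schwarz. *)
Lemma l2dot_cvg g h : square_integrable g -> square_integrable h ->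
  2 * pi * \sum_(m <- modes N) rdot (fcoef g m) (fcoef h m) @[N --> \oo] --> l2dot g h.
Proof.
move=> sg sh; apply/cvgrPdist_lt => e e0.
have G0 : 0 < l2dot g g + 1 by rewrite ltr_wpDl // l2dot_ge0.
have e1 : 0 < e ^+ 2 / (l2dot g g + 1) by rewrite divr_gt0 // exprn_gt0.
have [N0 HN] := parseval sh e1; exists N0 => // N /= NN.
rewrite -l2dot_tpoly //.
have -> : l2dot g h - l2dot g (tpoly N (fcoef h)) = l2dot g (h - tpoly N (fcoef h)).
  have st := @sqi_tpoly R n N (fcoef h).
  by rewrite -scaleN1r l2dotDr ?l2dotZr ?mulN1r //; exact: sqiZ.
rewrite -(@ltr_pXn2r _ 2%N) ?nnegrE ?normr_ge0 ?(ltW e0) // real_normK ?num_real //.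
apply: le_lt_trans (l2dot_CS2 _ _) _ => //; first by apply: sqiB => //; exact: sqi_tpoly.
rewrite l2dot_fpart //; have := HN N NN; rewrite ltr_pdivlMr // => H.
have := l2dot_ge0 (h - tpoly N (fcoef h)); rewrite l2dot_fpart //.
have := l2dot_ge0 g; move: H G0.
move: (l2dot g g) (l2dot h h - _) (e ^+ 2) => a b c; nra.
Qed.

Definition action_form_partial N g : R := \sum_(m <- modes N) m%:~R * enorm (fcoef g m) ^+ 2.
Definition action_bilin N g h : R := \sum_(m <- modes N) m%:~R * rdot (fcoef g m) (fcoef h m).
(** The quadratic form sum_m m |g_m|^2 of -J d/dt, up to a factor 2 pi. *)
Definition action_form g : R := limn (fun N => action_form_partial N g).

Lemma action_form_partialD N g h : square_integrable g -> square_integrable h ->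
  action_form_partial N (g + h) = action_form_partial N g + 2 * action_bilin N g h + action_form_partial N h.
Proof.
move=> sg sh; rewrite /action_form_partial /action_bilin mulr_sumr -!big_split /=; apply: eq_bigr => m _.
by rewrite fcoefD // enorm_sqrD !mulrDr (mulrCA _ 2).
Qed.

Lemma action_bilin_le N g h : lnorm_finite g -> lnorm_finite h -> `|action_bilin N g h| <= lnorm g * lnorm h.
Proof.
move=> fg fh; apply: le_trans (sob_form_le N fg fh).
apply: le_trans (ler_norm_sum _ _ _) _; apply: ler_sum => m _.
by rewrite normrM ler_pM ?rdot_CS ?norm_le_sob_weight.
Qed.

Lemma action_form_partial_le N g : lnorm_finite g -> `|action_form_partial N g| <= lnorm g ^+ 2.
Proof.
move=> fg; have := action_bilin_le N fg fg; rewrite expr2; congr (`|_| <= _).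
by apply: eq_bigr => m _; rewrite enorm_sqr.
Qed.

(** The partial sums are the difference of two bounded monotone sequences,
    those of the weights |m| and |m| - m. *)
Lemma action_form_partial_cvg g : lnorm_finite g -> action_form_partial N g @[N --> \oo] --> action_form g.
Proof.
move=> fg; suff : cvgn (fun N => action_form_partial N g) by [].
pose F m := sob_weight m * enorm (fcoef g m) ^+ 2.
pose G (m : int) := (`|m%:~R| - m%:~R : R) * enorm (fcoef g m) ^+ 2.
pose P (m : int) := `|m%:~R : R| * enorm (fcoef g m) ^+ 2.
have bd (K : int -> R) : (forall m, 0 <= K m <= 2 * F m) -> cvgn (fun N => \sum_(m <- modes N) K m).
  move=> K0; apply: nondecreasing_is_cvgn.
    by move=> N M NM; apply: sum_modes_mono => // m; have /andP[] := K0 m.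
  exists (2 * lnorm g ^+ 2) => _ [N _ <-].
  apply: (@le_trans _ _ (2 * sob_partial N g)); last by rewrite ler_pM2l ?sob_partial_le.
  by rewrite mulr_sumr; apply: ler_sum => m _; have /andP[] := K0 m.
have -> : (fun N => action_form_partial N g) = (fun N => \sum_(m <- modes N) P m - \sum_(m <- modes N) G m).
  apply/funext => N; rewrite -sumrB; apply: eq_bigr => m _.
  by rewrite /P /G -mulrBl opprB addrC subrK.
apply: is_cvgB; apply: bd => m; rewrite /P /G /F; have := sqr_ge0 (enorm (fcoef g m)).
  have := norm_le_sob_weight m; have := normr_ge0 (m%:~R : R).
  by move: (`|m%:~R : R|) (sob_weight m) (enorm _ ^+ 2) => x y z; nra.
have := norm_le_sob_weight m; have := ler_norm (m%:~R : R); have := ler_norm (- m%:~R : R); rewrite normrN.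
move: (`|m%:~R : R|) (m%:~R : R) (sob_weight m) (enorm _ ^+ 2) => x u y z h1 h2 h3 h4.
by apply/andP; split; [rewrite mulr_ge0 // subr_ge0|rewrite mulrA ler_wpM2r //; lra].
Qed.

Lemma action_form_le g : lnorm_finite g -> `|action_form g| <= lnorm g ^+ 2.
Proof.
by move=> fg; apply: (norm_lim_le _ (action_form_partial_cvg fg)) => N; exact: action_form_partial_le.
Qed.

Lemma action_form_dist g h : sob_half g -> sob_half h ->
  `|action_form (g + h) - action_form g| <= 2 * lnorm g * lnorm h + lnorm h ^+ 2.
Proof.
move=> sg sh.
apply: (norm_lim_le _ (cvgB (action_form_partial_cvg (sob_fin (sobD sg sh))) (action_form_partial_cvg (sob_fin sg)))) => N /=.
rewrite -[X in `|X|]/(action_form_partial N (g + h) - action_form_partial N g) (action_form_partialD _ (sob_sqi sg) (sob_sqi sh)).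
rewrite (_ : _ - _ = 2 * action_bilin N g h + action_form_partial N h); last by rewrite addrC !addrA addNr add0r.
have := action_bilin_le N (sob_fin sg) (sob_fin sh); have := action_form_partial_le N (sob_fin sh).
move: (action_bilin N g h) (action_form_partial N h) (lnorm g) (lnorm h) => x y a b.
by rewrite !ler_norml => /andP[a1 a2] /andP[b1 b2]; apply/andP; split; lra.
Qed.

Lemma sob_tpoly N c : sob_half (tpoly N c).
Proof.
apply: sobP; [|exact: sqi_tpoly|].
  move=> t; rewrite /tpoly !sum_loopE; apply: eq_bigr => m _.
  by rewrite /trig mulrDr -cis_add cis_int2pi.
have [M|//] := @lnorm_finiteP (tpoly N c) (\sum_(m <- modes N) sob_weight m * enorm (c m) ^+ 2).
apply: (@le_trans _ _ (\sum_(m <- modes M | (`|m| <= N)%N) sob_weight m * enorm (c m) ^+ 2)).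
  rewrite [leRHS]big_mkcond; apply: ler_sum => m _; rewrite fcoef_tpoly.
  by case: ifP => // _; rewrite enorm0 expr0n mulr0.
have w0 m : 0 <= sob_weight m * enorm (c m) ^+ 2 by rewrite mulr_ge0 ?sqr_ge0 ?sob_weight_ge0.
case: (leqP M N) => MN; last by rewrite -sum_modes_widen // ltnW.
rewrite big_mkcond; apply: le_trans (sum_modes_mono MN w0).
by apply: ler_sum => m _; case: ifP.
Qed.

Lemma sob0 : sob_half (0 : loop R n).
Proof. by rewrite -(scale0r (tpoly 0 (fun=> 0) : loop R n)); exact: sobZ (sob_tpoly _ _). Qed.

Lemma lnormZ x g : sob_half g -> lnorm (x *: g) = `|x| * lnorm g.
Proof.
move=> sg; apply/eqP; rewrite eq_le (lnormZ_le x sg) /=.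
have [->|x0] := eqVneq x 0; first by rewrite normr0 mul0r lnorm_ge0.
have := lnormZ_le x^-1 (sobZ x sg); rewrite scalerA mulVf // scale1r.
by rewrite normfV mulrC ler_pdivlMr ?normr_gt0 // mulrC.
Qed.

Lemma lnorm0 : lnorm (0 : loop R n) = 0.
Proof. by have := lnormZ 0 sob0; rewrite scale0r normr0 mul0r. Qed.

Lemma sob_partial_tail g e : lnorm_finite g -> 0 < e -> exists N0, forall N M, (N0 <= N)%N -> (N <= M)%N -> sob_partial M g - sob_partial N g < e.
Proof.
move=> fg e0.
have C : cvgn (fun N => sob_partial N g).
  apply: nondecreasing_is_cvgn; last by exists (lnorm g ^+ 2) => _ [N _ <-]; exact: sob_partial_le.
  by move=> N M NM; apply: sum_modes_mono => // m; rewrite mulr_ge0 ?sqr_ge0 ?sob_weight_ge0.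
have /cvgrPdist_lt/(_ (e / 2) _) [|N0 _ H] := C; first by rewrite divr_gt0.
exists N0 => N M NN NM; have := H N NN; have := H M (leq_trans NN NM) => /=.
move: (limn _) (sob_partial N g) (sob_partial M g) => x y z; rewrite !ltr_norml => /andP[a1 a2] /andP[b1 b2]; lra.
Qed.

Lemma lnorm_fpart_cvg g e : sob_half g -> 0 < e ->
  exists N0, forall N, (N0 <= N)%N -> lnorm (g - tpoly N (fcoef g)) < e.
Proof.
move=> sg e0; have e2 : 0 < (e / 2) ^+ 2 by rewrite exprn_gt0 // divr_gt0.
have [N0 HN] := sob_partial_tail (sob_fin sg) e2; exists N0 => N NN.
have st := @sqi_tpoly R n N (fcoef g).
have w0 m : 0 <= sob_weight m * enorm (fcoef g m) ^+ 2 by rewrite mulr_ge0 ?sqr_ge0 ?sob_weight_ge0.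
have [M|_ l] := @lnorm_finiteP (g - tpoly N (fcoef g)) ((e / 2) ^+ 2); last first.
  apply: (@le_lt_trans _ _ (e / 2)); last by rewrite ltr_pdivrMr // mulr_natr mulr2n ltrDl.
  by rewrite -(@ler_pXn2r _ 2%N) ?nnegrE ?lnorm_ge0 // ltW // divr_gt0.
pose K := maxn M N.
apply: (@le_trans _ _ (sob_partial K (g - tpoly N (fcoef g)))).
  apply: sum_modes_mono; first exact: leq_maxl.
  by move=> m; rewrite mulr_ge0 ?sqr_ge0 ?sob_weight_ge0.
apply: ltW; apply: le_lt_trans (HN N K NN (leq_maxr _ _)).
rewrite lerBrDr /sob_partial (sum_modes_widen _ (leq_maxr M N : (N <= K)%N)) [X in _ + X]big_mkcond -big_split /=.
apply: ler_sum => m _; rewrite fcoefB //; last exact: sob_sqi.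
rewrite fcoef_tpoly; case: ifP => _; last by rewrite subr0 addr0.
by rewrite subrr enorm0 expr0n mulr0 add0r.
Qed.

End Seminorm.

(** * The quadratic part of the action *)

Section C1Loops.
Context {R : realType} {n : nat}.
Implicit Types (z w a b : cspace R n) (g h k : loop R n) (m l : int) (c d : int -> cspace R n).

Lemma continuous_coord1 j : continuous (fun z : cspace R n => z.1 ord0 j).
Proof.
move=> z; apply: (@cvg_comp _ _ _ fst (fun M : 'rV[R]_n => M ord0 j)); first exact: cvg_fst.
exact: coord_continuous.
Qed.

Lemma continuous_coord2 j : continuous (fun z : cspace R n => z.2 ord0 j).
Proof.
move=> z; apply: (@cvg_comp _ _ _ snd (fun M : 'rV[R]_n => M ord0 j)); first exact: cvg_snd.
exact: coord_continuous.
Qed.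

Lemma continuous_sum (T : topologicalType) (I : Type) (r : seq I) (F : I -> T -> R) :
  (forall i, continuous (F i)) -> continuous (fun x => \sum_(i <- r) F i x).
Proof.
move=> cF; elim: r => [|i r IH] x.
  by under eq_fun do rewrite big_nil; exact: cvg_cst.
by under eq_fun do rewrite big_cons; apply: cvgD; [exact: cF|exact: IH].
Qed.

Lemma continuous_rdot b : continuous (fun z : cspace R n => rdot z b).
Proof.
Transparent rdot.
rewrite /rdot; apply: continuous_sum => j z.
apply: cvgD; apply: cvgM; try exact: cvg_cst; [exact: continuous_coord1|exact: continuous_coord2].
Opaque rdot.
Qed.

Lemma continuous_rdot_loop g b : continuous g -> continuous (fun t => rdot (g t) b).
Proof.
by move=> cg t; exact: (@cvg_comp _ _ _ g (fun z => rdot z b) _ _ _ (cg t) (@continuous_rdot b (g t))).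
Qed.

Lemma sqi_cont g : continuous g -> square_integrable g.
Proof.
move=> cg; apply/square_integrableP; split=> j; apply: sqint_cont => t.
  under eq_fun do rewrite -rdot_e1; exact: continuous_rdot_loop.
under eq_fun do rewrite -rdot_e2; exact: continuous_rdot_loop.
Qed.

Lemma is_derive_rdot g (t : R) b : derivable g t 1 ->
  is_derive t (1 : R) (fun s => rdot (g s) b) (rdot (derive1 g t) b).
Proof.
move=> dg.
have C : h^-1 *: (rdot (g (h *: (1 : R) + t)) b - rdot (g t) b) @[h --> (0 : R)^'] --> rdot (derive1 g t) b.
  rewrite derive1E.
  rewrite (_ : (fun h : R => _) = (fun z => rdot z b) \o (fun h : R => h^-1 *: (g (h *: (1 : R) + t) - g t))); last first.
    by apply/funext => h /=; rewrite rdotZl rdotBl.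
  exact: (@cvg_comp _ _ _ _ (fun z => rdot z b) _ _ _ dg (@continuous_rdot b _)).
by split; [apply/cvg_ex; eexists; exact: C|exact: cvg_lim C].
Qed.

Lemma C1_continuous g : C1loop g -> continuous g.
Proof.
by move=> [_ [dg _]] t; apply: differentiable_continuous; apply/derivable1_diffP.
Qed.

Lemma trig_cosE m b t : trig m b t = cos (m%:~R * t) *: b + sin (m%:~R * t) *: Jmul b.
Proof. by []. Qed.

(** Integration by parts; the boundary terms cancel by periodicity. *)
Lemma l2dot_derive g m b : C1loop g -> l2dot (derive1 g) (trig m b) = - m%:~R * l2dot g (trig m (Jmul b)).
Proof.
move=> c1g; have [pg [dg cdg]] := c1g; have cg := C1_continuous c1g.
have sg := sqi_cont cg; have sdg := sqi_cont cdg.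
pose F (t : R) := cos (m%:~R * t) * rdot (g t) b + sin (m%:~R * t) * rdot (g t) (Jmul b).
pose f (t : R) := rdot (derive1 g t) (trig m b t) + m%:~R * rdot (g t) (trig m (Jmul b) t).
have dF (t : R) : is_derive t (1 : R) F (f t).
  have d1 := is_derive_rdot b (dg t); have d2 := is_derive_rdot (Jmul b) (dg t).
  have d3 := @is_derive_cosm R m%:~R t; have d4 := @is_derive_sinm R m%:~R t.
  have := is_deriveD (is_deriveM d3 d1) (is_deriveM d4 d2).
  congr is_derive; rewrite /f !trig_cosE !rdotDr !rdotZr JmulJ rdotNr /GRing.scale /=.
  by ring.
have cf : continuous f.
  have E : f = fun t => (cos (m%:~R * t) * rdot (derive1 g t) b + sin (m%:~R * t) * rdot (derive1 g t) (Jmul b))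
    + m%:~R * (cos (m%:~R * t) * rdot (g t) (Jmul b) + sin (m%:~R * t) * rdot (g t) (- b)).
    by apply/funext => t; rewrite /f !trig_cosE !rdotDr !rdotZr JmulJ.
  rewrite E => t; have cc := trigp_continuous (@trigp_cos R m) (x := t).
  have cs := trigp_continuous (@trigp_sin R m) (x := t).
  by apply: cvgD; [apply: cvgD|apply: cvgM; [exact: cvg_cst|apply: cvgD]];
    (apply: cvgM; [assumption|exact: continuous_rdot_loop]).
have := circle_int_deriv dF cf; rewrite /f /F.
have g2 : g (2 * pi) = g 0 by rewrite -[LHS]/(g (2 * pi)) -(add0r (2 * pi)) pg.
rewrite cos_int2pi sin_int2pi g2 mulr0 cos0 sin0 subrr circle_intD; last 2 first.
- exact: circle_integrable_rdot sdg (@sqi_trig _ _ _ _).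
- apply: circle_integrableZ; exact: circle_integrable_rdot sg (@sqi_trig _ _ _ _).
rewrite circle_intZ; last exact: circle_integrable_rdot sg (@sqi_trig _ _ _ _).
by move/eqP; rewrite addr_eq0 -mulNr => /eqP.
Qed.

Lemma fcoef_derive g m : C1loop g -> fcoef (derive1 g) m = m%:~R *: Jmul (fcoef g m).
Proof.
move=> c1g; have sg := sqi_cont (C1_continuous c1g); have sdg := sqi_cont c1g.2.2.
apply: fcoefP => // b.
by rewrite l2dot_derive // l2dot_fcoef // rdotZl rdotJl mulNr !mulrN mulrCA.
Qed.

Lemma sob_C1 g : C1loop g -> sob_half g.
Proof.
move=> c1g; have sg := sqi_cont (C1_continuous c1g); have sdg := sqi_cont c1g.2.2.
apply: sobP => //; first by case: c1g.
have [N|//] := @lnorm_finiteP R n g ((2 * pi)^-1 * l2dot (derive1 g) (derive1 g) + enorm (fcoef g 0) ^+ 2).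
rewrite sob_partialE lerD2r.
apply: (@le_trans _ _ (fourier_energy N (derive1 g))).
  apply: ler_sum => m _; rewrite fcoef_derive // enormZ exprMn.
  rewrite enorm_J.
  rewrite mulrC ler_wpM2r ?sqr_ge0 // -intr_norm -rmorphXn ler_int.
  have [->|m0] := eqVneq m 0; first by rewrite normr0.
  by rewrite ler_eXnr //; lia.
by rewrite -(ler_pM2l (@pi2_gt0 R)) mulrA divff ?gt_eqF ?pi2_gt0 // mul1r bessel.
Qed.

Definition Jderive g : loop R n := fun t => - Jmul (derive1 g t).

Lemma sqi_Jderive g : C1loop g -> square_integrable (Jderive g).
Proof.
move=> c1g; have /square_integrableP[s1 s2] := sqi_cont c1g.2.2; apply/square_integrableP; split=> j.
  by have := s2 j; congr sqint; apply/funext => t; rewrite /Jderive /Jmul /= !mxE opprK.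
have := sqintZ (-1) (s1 j); congr sqint; apply/funext => t.
by rewrite /Jderive /Jmul /= !mxE mulN1r.
Qed.

Lemma fcoef_Jderive g m : C1loop g -> fcoef (Jderive g) m = m%:~R *: fcoef g m.
Proof.
move=> c1g; have sg := sqi_cont (C1_continuous c1g).
apply: fcoefP => [|b]; first exact: sqi_Jderive.
transitivity (l2dot (derive1 g) (trig m (Jmul b))).
  Transparent l2dot.
  apply: circle_int_eq => t _; rewrite /Jderive rdotNl rdotJl opprK; congr (rdot _ _).
  by rewrite !trig_cosE JmulD !JmulZ.
  Opaque l2dot.
by rewrite l2dot_derive // JmulJ l2dot_fcoef // rdotNr rdotZl mulrN mulNr -mulrN opprK mulrCA.
Qed.

Lemma symplectic_action_C1 g : C1loop g -> symplectic_action g = pi * action_form g.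
Proof.
move=> c1g; have sg := sqi_cont (C1_continuous c1g).
set g' := Jderive g; have sg' : square_integrable g' := sqi_Jderive c1g.
have fg' m : fcoef g' m = m%:~R *: fcoef g m := fcoef_Jderive m c1g.
have -> : symplectic_action g = 2^-1 * l2dot g' g.
  Transparent l2dot.
  by rewrite /l2dot -circle_intZ //; exact: circle_integrable_rdot.
  Opaque l2dot.
have C1 := l2dot_cvg sg' sg; have C2 := action_form_partial_cvg (sob_fin (sob_C1 c1g)).
have C3 : 2 * pi * action_form_partial N g @[N --> \oo] --> 2 * pi * action_form g.
  by apply: cvgM; [exact: cvg_cst|exact: C2].
have -> : l2dot g' g = 2 * pi * action_form g.
  apply: (cvg_unique _ _ C3) => //.
  rewrite (_ : (fun N => 2 * pi * action_form_partial N g) = (fun N => 2 * pi * \sum_(m <- modes N) rdot (fcoef g' m) (fcoef g m))) //.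
  apply/funext => N; congr (_ * _).
  by apply: eq_bigr => m _; rewrite fg' rdotZl enorm_sqr.
by rewrite mulrA mulrA mulVf // mul1r.
Qed.

Lemma is_derive_scalel (f : R -> R) (df t : R) (b : cspace R n) :
  is_derive t (1 : R) f df -> is_derive t (1 : R) (fun s => f s *: b) (df *: b).
Proof.
move=> [fd fE].
have C : h^-1 *: (f (h *: (1 : R) + t) *: b - f t *: b) @[h --> (0 : R)^'] --> df *: b.
  rewrite (_ : (fun h : R => _) = (fun h : R => (h^-1 *: (f (h *: (1 : R) + t) - f t)) *: b)); last first.
    by apply/funext => h; rewrite -scalerBl scalerA.
  by rewrite -fE; apply: cvgZr_tmp; exact: fd.
by split; [apply/cvg_ex; eexists; exact: C|exact: cvg_lim C].
Qed.

Lemma is_derive_trig m b (t : R) :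
  is_derive t (1 : R) (trig m b : R -> cspace R n) (m%:~R *: trig m (Jmul b) t).
Proof.
have := is_deriveD (is_derive_scalel b (@is_derive_cosm R m%:~R t))
  (is_derive_scalel (Jmul b) (@is_derive_sinm R m%:~R t)).
congr is_derive; rewrite trig_cosE JmulJ scalerDr !scalerA scalerN addrC.
by rewrite mulNr scaleNr.
Qed.

Lemma is_derive_tpoly N c (t : R) :
  is_derive t (1 : R) (tpoly N c : R -> cspace R n) (tpoly N (fun m => m%:~R *: Jmul (c m)) t).
Proof.
rewrite /tpoly; elim: (modes N) => [|m r IH].
  by rewrite !big_nil; exact: is_derive_cst.
rewrite !big_cons; have := is_deriveD (is_derive_trig m (c m) t) IH.
congr is_derive; rewrite loopDE; congr (_ + _).
by rewrite !trig_cosE JmulZ scalerDr !scalerA ![m%:~R * _]mulrC.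
Qed.

Lemma C1_tpoly N c : C1loop (tpoly N c).
Proof.
split; first exact: sob_per (@sob_tpoly R n N c).
split; first by move=> t; case: (is_derive_tpoly N c t).
have -> : derive1 (tpoly N c) = tpoly N (fun m => m%:~R *: Jmul (c m)).
  by apply/funext => t; rewrite derive1E; case: (is_derive_tpoly N c t).
move=> t; apply: differentiable_continuous; apply/derivable1_diffP.
by case: (is_derive_tpoly N (fun m => m%:~R *: Jmul (c m)) t).
Qed.

(** Both sides agree on continuously differentiable loops, the right-hand side
    is continuous for the norm of L^2_{1/2}, and the truncations of the Fourier
    series are continuously differentiable loops that converge to g. *)
Lemma symplectic_action_extE g : sob_half g -> symplectic_action_ext g = pi * action_form g.
Proof.
move=> sg; pose B (e : R) := [set h : loop R n | C1loop h /\ lnorm (h - g) < e].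
have FF : Filter (filter_from [set e : R | 0 < e] B).
  apply: filter_from_filter; first by exists (1 : R); rewrite /= ltr01.
  move=> e1 e2 /= p1 p2; exists (Num.min e1 e2); first by rewrite lt_min p1 p2.
  by move=> h [c1 /=]; rewrite lt_min => /andP[l1 l2]; split; split.
have PF : ProperFilter (filter_from [set e : R | 0 < e] B).
  apply: filter_from_proper => e /= e0.
  have [N0 /(_ N0 (leqnn _)) H] := lnorm_fpart_cvg sg e0.
  exists (tpoly N0 (fcoef g)); split; first exact: C1_tpoly.
  by rewrite lnorm_distC; [exact: H|exact: sob_tpoly|exact: sg].
apply: cvg_lim => //; apply/cvgrPdist_lt => e e0.
pose K := pi * (2 * lnorm g + 1).
have K0 : 0 < K.
  by rewrite mulr_gt0 ?pi_gt0 // ltr_wpDl // mulr_ge0 // lnorm_ge0.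
exists (Num.min 1 (e / K)); first by rewrite /= lt_min ltr01 divr_gt0.
move=> h [c1 /=]; rewrite lt_min => /andP[l1 l2]; have sh := sob_C1 c1.
rewrite symplectic_action_C1 // -mulrBr normrM (gtr0_norm (pi_gt0 R)) distrC.
have := action_form_dist sg (sobB sh sg).
have -> : g + (h - g) = h by rewrite addrC subrK.
move: l1 l2; rewrite ltr_pdivlMr // /K; have := lnorm_ge0 (h - g); have := lnorm_ge0 g; have := pi_gt0 R.
move: (lnorm (h - g)) (lnorm g) (`|_|) => x y v p0 y0 x0 x1 xK v1.
apply: (@le_lt_trans _ _ (x * (pi * (2 * y + 1)))) => //.
rewrite mulrCA ler_pM2l //; nra.
Qed.

End C1Loops.

(** * Estimates for the Hamiltonian *)

Section Hamiltonian.
Context {R : realType} {n : nat}.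
Implicit Types (z w v b : cspace R n) (f : cspace R n -> R).

(** The set where f (g t) > c is the union, over the countably many boxes with
    rational centre and size on which f > c, of the sets where g t is in the
    box. *)
Lemma measurable_comp_cspace f (g : loop R n) : continuous f ->
  (forall j, measurable_fun setT (fun t => (g t).1 ord0 j)) ->
  (forall j, measurable_fun setT (fun t => (g t).2 ord0 j)) ->
  measurable_fun setT (fun t => f (g t)).
Proof.
move=> cf m1 m2 _; apply: (measurability _ (RGenOInfty.measurableE R)) => //.
move=> /= _ [_ [c ->] <-]; rewrite setTI.
pose I := (('rV[rat]_n * 'rV[rat]_n) * rat)%type.
pose near (i : I) (w : cspace R n) := forall j,
  `|w.1 ord0 j - ratr (i.1.1 ord0 j)| < ratr i.2 /\ `|w.2 ord0 j - ratr (i.1.2 ord0 j)| < ratr i.2.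
pose good (i : I) := 0 < (ratr i.2 : R) /\ forall w, near i w -> c < f w.
have -> : (fun t => f (g t)) @^-1` `]c, +oo[%classic = \bigcup_(i : I) [set t | good i /\ near i (g t)].
  apply/seteqP; split=> [t /=|t [i _ [/= [_ H] /H]]]; last by rewrite in_itv /= andbT.
  rewrite in_itv /= andbT => cft.
  have : nbhs (g t) [set w | c < f w].
    exact: (cf (g t) _ (open_nbhs_nbhs (conj (@open_gt R c) cft))).
  move=> /nbhs_ballP [e /= e0 He].
  have e2 : e / 4 < e / 2 by rewrite ltr_pM2l // ltf_pV2 ?posrE // ltr_nat.
  have [r /itvP rE] := rat_in_itvoo e2.
  have r0 : 0 < ratr r :> R by rewrite (lt_trans _ (_ : e / 4 < _)) ?rE // divr_gt0.
  have re : ratr r < e / 2 :> R by rewrite rE.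
  have apx (x : R) : exists q : rat, `|x - ratr q| < ratr r.
    have xr : x - ratr r < x by rewrite ltrBlDr ltrDl.
    have [q /itvP qE] := rat_in_itvoo xr; exists q; rewrite ltr_norml.
    have h1 : ratr q < x :> R by rewrite qE.
    have h2 : x - ratr r < ratr q by rewrite qE.
    by apply/andP; split; lra.
  have [q1 Hq1] := choice (fun j => apx ((g t).1 ord0 j)).
  have [q2 Hq2] := choice (fun j => apx ((g t).2 ord0 j)).
  exists ((\row_j q1 j, \row_j q2 j), r) => //=.
  split; last by move=> j /=; rewrite !mxE; split.
  split=> // w Hw; apply: He; split; split=> // i j; rewrite [i]ord1 /=.
    have [/= + _] := Hw j; rewrite mxE => H1; have H2 := Hq1 j.
    rewrite /ball /= -(subrKA (ratr (q1 j))) (le_lt_trans (ler_normD _ _)) //.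
    by rewrite [X in _ + X]distrC; lra.
  have [/= _ +] := Hw j; rewrite mxE => H1; have H2 := Hq2 j.
  rewrite /ball /= -(subrKA (ratr (q2 j))) (le_lt_trans (ler_normD _ _)) //.
  by rewrite [X in _ + X]distrC; lra.
apply: countable_bigcupT_measurable => [|i]; first exact: countableP.
have [gi|ngi] := pselect (good i); last first.
  by rewrite (_ : [set t | _] = set0) //; apply/seteqP; split=> t // [].
rewrite (_ : [set t | _] = \bigcap_(j in [set: 'I_n]) ([set t | `|(g t).1 ord0 j - ratr (i.1.1 ord0 j)| < ratr i.2] `&`
   [set t | `|(g t).2 ord0 j - ratr (i.1.2 ord0 j)| < ratr i.2])); last first.
  apply/seteqP; split=> [t [_ H] j _|t H]; first exact: H.
  by split=> // j; exact: (H j Logic.I).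
apply: fin_bigcap_measurable => // j _.
have M (h : R -> R) (q r : R) : measurable_fun setT h -> measurable [set t | `|h t - q| < r].
  move=> mh; rewrite (_ : [set t | _] = setT `&` h @^-1` `]q - r, q + r[%classic).
    by apply: mh => //; exact: measurable_itv.
  by rewrite setTI; apply/seteqP; split=> t /=; rewrite in_itv /= ltr_distl.
by apply: measurableI; exact: M.
Qed.

(** All derivatives of H that are computed explicitly are those of a function
    that is quadratic near z. *)
Lemma derive_along f z v (a b : R) :
  (\forall h \near (0 : R), f (h *: v + z) = f z + h * a + h ^+ 2 * b) -> 'D_v f z = a.
Proof.
move=> fE; apply: cvg_lim => //.
have C : a + h * b @[h --> (0 : R)^'] --> a.
  have C0 : (fun h : R => a + h * b) @ (0 : R) --> a + 0 * b.
    by apply: cvgD; [exact: cvg_cst|apply: cvgM; [exact: cvg_id|exact: cvg_cst]].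
  by rewrite mul0r addr0 in C0; exact: cvg_within_filter C0.
apply: cvg_trans C; apply: near_eq_cvg; near=> h.
have h0 : h != 0 by near: h; exact: nbhs_dnbhs_neq.
have -> : (f \o shift z) (h *: v) = f z + h * a + h ^+ 2 * b.
  by near: h; apply: cvg_within; exact: fE.
rewrite (_ : f z + h * a + h ^+ 2 * b - f z = h * (a + h * b)); first by rewrite /GRing.scale /= mulKf.
by move: (f z) => x; ring.
Unshelve. all: by end_near. Qed.

Definition grad f z : cspace R n :=
  (\row_j 'D_(e1 j) f z, \row_j 'D_(e2 j) f z).

Lemma derive_grad f z v : differentiable f z -> 'D_v f z = rdot (grad f z) v.
Proof.
move=> df; rewrite deriveE // {1}(cspace_basis v) linearD !linear_sum.
Transparent rdot.
rewrite /rdot -big_split; apply: eq_bigr => j _.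
Opaque rdot.
by rewrite !linearZ /= !mxE !deriveE // /GRing.scale /= ![_ * v.1 _ _]mulrC ![_ * v.2 _ _]mulrC.
Qed.

Lemma mean_value f z v : (forall x, differentiable f x) ->
  exists2 s : R, 0 <= s <= 1 & f (z + v) - f z = 'D_v f (z + s *: v).
Proof.
move=> df; pose phi (s : R) := f (z + s *: v).
have dphi (s : R) : is_derive s (1 : R) phi ('D_v f (z + s *: v)).
  have D : derivable f (z + s *: v) v by exact: diff_derivable.
  have C : h^-1 *: (phi (h *: (1 : R) + s) - phi s) @[h --> (0 : R)^'] --> 'D_v f (z + s *: v).
    rewrite (_ : (fun h : R => _) = (fun h : R => h^-1 *: ((f \o shift (z + s *: v)) (h *: v) - f (z + s *: v)))) //.
    apply/funext => h; rewrite /phi /=; congr (_ *: (f _ - _)).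
    by rewrite [h%:A]mulr1 scalerDl addrCA.
  by split; [apply/cvg_ex; eexists; exact: C|exact: cvg_lim C].
have cphi : {within `[0, 1], continuous phi}.
  apply: continuous_subspaceT => s; apply: differentiable_continuous; apply/derivable1_diffP.
  by case: (dphi s).
have [s s01 E] := @MVT_segment R phi (fun s => 'D_v f (z + s *: v)) 0 1 ler01 (fun x _ => dphi x) cphi.
exists s; first by move: s01; rewrite in_itv.
by move: E; rewrite /phi scale1r scale0r addr0 subr0 mulr1.
Qed.

Lemma enorm_e1 j : enorm (e1 j : cspace R n) = 1.
Proof.
by apply/eqP; rewrite -(@eqrXn2 _ 2%N) ?enorm_ge0 // enorm_sqr rdot_e1 /= mxE !eqxx expr1n.
Qed.

Lemma enorm_e2 j : enorm (e2 j : cspace R n) = 1.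
Proof.
by apply/eqP; rewrite -(@eqrXn2 _ 2%N) ?enorm_ge0 // enorm_sqr rdot_e2 /= mxE !eqxx expr1n.
Qed.

Lemma grad_norm_le f z (M : R) :
  (forall j, `|'D_(e1 j) f z| <= M) -> (forall j, `|'D_(e2 j) f z| <= M) -> 0 <= M ->
  enorm (grad f z) <= M * (2 * n%:R).
Proof.
move=> H1 H2 M0; rewrite (cspace_basis (grad f z)).
apply: le_trans (enormD _ _) _.
have S (F : 'I_n -> R) (E : 'I_n -> cspace R n) : (forall j, enorm (E j) = 1) -> (forall j, `|F j| <= M) ->
    enorm (\sum_j F j *: E j) <= M * n%:R.
  move=> E1 FM; apply: le_trans (enorm_sum _ _ _) _.
  rewrite mulr_natr -[X in _ *+ X](card_ord n) -sumr_const; apply: ler_sum => j _.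
  by rewrite enormZ E1 mulr1.
rewrite mulrCA mulr2n mulrDl mul1r; by apply: lerD; apply: S => // j; rewrite ?enorm_e1 ?enorm_e2 // mxE.
Qed.

Lemma bounded_outside_compact f (rho c : R) : continuous f ->
  (forall z, rho < enorm z -> f z = c) -> exists2 M, 0 <= M & forall z, `|f z| <= M.
Proof.
move=> cf fc.
pose B : set (cspace R n) := [set v : 'rV[R]_n | forall i, `[- rho, rho]%classic (v ord0 i)] `*`
  [set v : 'rV[R]_n | forall i, `[- rho, rho]%classic (v ord0 i)].
have cB : compact B by apply: compact_setX; apply: (@rV_compact R n (fun=> `[- rho, rho]%classic)) => i; exact: segment_compact.
have /compact_bounded[M [_ HM]] := continuous_compact (continuous_subspaceT cf) cB.
exists (`|M| + 1 + `|c|); first by rewrite !addr_ge0.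
move=> z; have [|zr] := ltP rho (enorm z); first by move=> /fc ->; rewrite lerDr addr_ge0.
have zB : B z.
  split=> i /=; rewrite in_itv /= -ler_norml; [apply: le_trans (coord1_le _ _) zr|apply: le_trans (coord2_le _ _) zr].
apply: (@le_trans _ _ (`|M| + 1)); last by rewrite lerDl.
by apply: HM; [rewrite (le_lt_trans (ler_norm _)) // ltrDl|exists z].
Qed.

Lemma lipschitz_of_derive f (rho : R) (c : cspace R n -> R) : (forall z, differentiable f z) ->
  (forall v, continuous ('D_v f)) -> (forall z v, rho < enorm z -> 'D_v f z = c v) ->
  exists2 K, 0 <= K & forall z v, `|f (z + v) - f z| <= K * enorm v.
Proof.
move=> df cD fc.
have [M1 HM1] := choice (fun j : 'I_n => let: ex_intro2 M M0 HM := bounded_outside_compact (cD (e1 j)) (fun z => fc z (e1 j)) in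
   ex_intro (fun M => 0 <= M /\ forall z, `|'D_(e1 j) f z| <= M) M (conj M0 HM)).
have [M2 HM2] := choice (fun j : 'I_n => let: ex_intro2 M M0 HM := bounded_outside_compact (cD (e2 j)) (fun z => fc z (e2 j)) in
   ex_intro (fun M => 0 <= M /\ forall z, `|'D_(e2 j) f z| <= M) M (conj M0 HM)).
pose M := \sum_j M1 j + \sum_j M2 j.
have S1 : 0 <= \sum_j M1 j by apply: sumr_ge0 => j _; exact: (HM1 j).1.
have S2 : 0 <= \sum_j M2 j by apply: sumr_ge0 => j _; exact: (HM2 j).1.
have M0 : 0 <= M by rewrite addr_ge0.
have le1 j z : `|'D_(e1 j) f z| <= M.
  apply: le_trans ((HM1 j).2 z) _; rewrite /M (bigD1 j) //= -addrA lerDl addr_ge0 //.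
  by apply: sumr_ge0 => i _; exact: (HM1 i).1.
have le2 j z : `|'D_(e2 j) f z| <= M.
  apply: le_trans ((HM2 j).2 z) _; rewrite /M [X in _ + X](bigD1 j) //= addrCA lerDl addr_ge0 //.
  by apply: sumr_ge0 => i _; exact: (HM2 i).1.
exists (M * (2 * n%:R)); first by rewrite !mulr_ge0.
move=> z v; have [s _ ->] := mean_value z v df.
rewrite derive_grad //; apply: le_trans (rdot_CS _ _) _.
by rewrite ler_wpM2r ?enorm_ge0 // grad_norm_le.
Qed.

(** The properties of H used in the sequel: [kap] is the slope of the gradient
    at infinity, [K] bounds the second derivatives, and the gradient differs
    from [kap] times the identity by at most [Cp], and only inside the ball of
    radius [rho]. *)
Record hamiltonian (H : cspace R n -> R) (dH : cspace R n -> cspace R n)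
    (kap K Cp rho : R) : Prop := Hamiltonian {
  ham_K : 0 < K;
  ham_rho : 0 < rho;
  ham_Cp : 0 <= Cp;
  ham_cont : continuous H;
  ham_dcont : forall b, continuous (fun z => rdot (dH z) b);
  ham_lip : forall z v, enorm (dH (z + v) - dH z) <= K * enorm v;
  ham_quad : forall z v, `|H (z + v) - H z - rdot (dH z) v| <= K * enorm v ^+ 2;
  ham_H0 : H 0 = 0;
  ham_d0 : dH 0 = 0;
  ham_inf : forall z, rho <= enorm z -> H z = kap / 2 * enorm z ^+ 2 /\ dH z = kap *: z;
  ham_bd : forall z, enorm (dH z - kap *: z) <= Cp }.

(** Outside a ball H is an explicit quadratic polynomial, so its second
    derivatives are constant there, and they are bounded inside by compactness.
    The mean value theorem turns this bound into the Lipschitz bound for the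
    gradient and the quadratic bound for the Taylor remainder. *)
Lemma smooth_hamiltonian (H : cspace R n -> R) (eps : R) : smooth H ->
  (\forall z \near (0 : cspace R n), H z = 0) ->
  (exists rho : R, forall z, rho <= enorm z -> H z = (1 + eps) * enorm z ^+ 2) ->
  exists K Cp rho, hamiltonian H (grad H) (2 * (1 + eps)) K Cp rho.
Proof.
move=> sH H0 [rho0 Hrho0]; pose kap := 2 * (1 + eps).
have [dH D1] := sH 1%N.
have cH : continuous H by exact: (sH 0%N).
have D2 v : (forall z, differentiable ('D_v H) z) /\ forall u, continuous ('D_u ('D_v H)).
  by have [_ /(_ v)[]] := sH 2%N.
pose rho := `|rho0| + 1.
have rho_gt0 : 0 < rho by rewrite /rho ltr_wpDl.
have rho0_lt : rho0 < rho by rewrite /rho (le_lt_trans (ler_norm _)) // ltrDl.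
(* The complement of the ball is open along lines, so the derivatives there are
   those of the formula for H. *)
have far z v : rho0 < enorm z -> \forall h \near (0 : R), rho0 < enorm (h *: v + z).
  move=> zr; have dz : 0 < (enorm z - rho0) / (enorm v + 1).
    by rewrite divr_gt0 ?subr_gt0 // ltr_wpDl ?enorm_ge0.
  near=> h.
  have hd : `|h| < (enorm z - rho0) / (enorm v + 1).
    near: h; apply/nbhs_ballP; exists ((enorm z - rho0) / (enorm v + 1)) => // y.
    by rewrite /ball /= sub0r normrN.
  have := enormB (h *: v + z) (h *: v); rewrite addrC addKr enormZ.
  move: hd; rewrite ltr_pdivlMr; last by rewrite ltr_wpDl ?enorm_ge0.
  have := enorm_ge0 v; have := normr_ge0 h; nra.
have D1far z v : rho0 < enorm z -> 'D_v H z = kap * rdot z v.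
  move=> zr; apply: (@derive_along _ _ _ _ ((1 + eps) * enorm v ^+ 2)).
  have := far z v zr; apply: filterS => h hr; rewrite !Hrho0 ?ltW // enorm_sqrD enormZ.
  rewrite rdotZl (rdotC v) exprMn real_normK ?num_real // /kap; ring.
have D2far z u v : rho0 < enorm z -> 'D_u ('D_v H) z = kap * rdot u v.
  move=> zr; apply: (@derive_along _ _ _ _ 0).
  have := far z u zr; apply: filterS => h hr; rewrite !D1far // rdotDl rdotZl; ring.
have gradE z v : 'D_v H z = rdot (grad H z) v by exact: derive_grad.
have L b := lipschitz_of_derive (D2 b).1 (D2 b).2 (fun z v => D2far z v b).
have [K1 HK1] := choice (fun j : 'I_n => let: ex_intro2 K K0 HK := L (e1 j) in
   ex_intro (fun K => 0 <= K /\ forall z v, `|'D_(e1 j) H (z + v) - 'D_(e1 j) H z| <= K * enorm v) K (conj K0 HK)).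
have [K2 HK2] := choice (fun j : 'I_n => let: ex_intro2 K K0 HK := L (e2 j) in
   ex_intro (fun K => 0 <= K /\ forall z v, `|'D_(e2 j) H (z + v) - 'D_(e2 j) H z| <= K * enorm v) K (conj K0 HK)).
pose K := \sum_j K1 j + \sum_j K2 j + 1.
have S1 : 0 <= \sum_j K1 j by apply: sumr_ge0 => j _; exact: (HK1 j).1.
have S2 : 0 <= \sum_j K2 j by apply: sumr_ge0 => j _; exact: (HK2 j).1.
have K0 : 0 < K by rewrite /K ltr_wpDl ?addr_ge0.
have lip z v : enorm (grad H (z + v) - grad H z) <= K * enorm v.
  rewrite (cspace_basis (_ - _)); apply: le_trans (enormD _ _) _.
  apply: (@le_trans _ _ (\sum_j K1 j * enorm v + \sum_j K2 j * enorm v)); last first.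
    by rewrite -!mulr_suml -mulrDl ler_wpM2r ?enorm_ge0 // /K lerDl.
  apply: lerD; (apply: le_trans (enorm_sum _ _ _) _; apply: ler_sum => j _; rewrite enormZ).
    by rewrite enorm_e1 mulr1 -rdot_e1 rdotBl -!gradE (HK1 j).2.
  by rewrite enorm_e2 mulr1 -rdot_e2 rdotBl -!gradE (HK2 j).2.
have H00 : H 0 = 0 by exact: nbhs_singleton H0.
have d00 : grad H 0 = 0.
  apply: rdot_inj => b; rewrite -gradE rdot0l; apply: (@derive_along _ _ _ _ 0).
  have /near0Z := H0; move=> /(_ b); apply: filterS => h; rewrite addr0 => ->.
  by rewrite H00 !mulr0 !addr0.
have inf z : rho <= enorm z -> H z = kap / 2 * enorm z ^+ 2 /\ grad H z = kap *: z.
  move=> zr; have zr0 : rho0 < enorm z by exact: lt_le_trans zr.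
  split; first by rewrite Hrho0 ?ltW // /kap [2 * _]mulrC mulfK.
  by apply: rdot_inj => b; rewrite -gradE D1far // rdotZl.
exists K, ((K + `|kap|) * rho), rho; split=> //.
- by rewrite mulr_ge0 ?addr_ge0 // ltW.
- by move=> b z; under eq_fun do rewrite -gradE; exact: D1.
- move=> z v; have [s /andP[s0 s1] ->] := mean_value z v dH.
  rewrite gradE -rdotBl; apply: le_trans (rdot_CS _ _) _.
  rewrite expr2 mulrA ler_wpM2r ?enorm_ge0 //; apply: le_trans (lip _ _) _.
  rewrite ler_wpM2l ?(ltW K0) // enormZ ger0_norm // ler_piMl ?enorm_ge0 //.
- move=> z; have [zr|/ltW zr] := leP rho (enorm z).
    by rewrite (inf z zr).2 subrr enorm0 mulr_ge0 ?addr_ge0 // ltW.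
  apply: le_trans (enormB _ _) _; rewrite [leRHS]mulrDl enormZ; apply: lerD; last by rewrite ler_wpM2l.
  have := lip 0 z; rewrite add0r d00 subr0 => /le_trans; apply.
  by rewrite ler_wpM2l // ltW.
Unshelve. all: by end_near. Qed.

End Hamiltonian.

(** * The action on L^2_{1/2} *)

Section Functional.
Context {R : realType} {n : nat}.
Context {H : cspace R n -> R} {dH : cspace R n -> cspace R n} {kap K Cp rho : R}.
Context (hH : hamiltonian H dH kap K Cp rho).
Implicit Types (g h v : loop R n).

Lemma ham_H_le z : `|H z| <= K * enorm z ^+ 2.
Proof.
by have := ham_quad hH 0 z; rewrite add0r (ham_H0 hH) (ham_d0 hH) rdot0l !subr0.
Qed.

Lemma ham_dH_le z : enorm (dH z) <= K * enorm z.
Proof. by have := ham_lip hH 0 z; rewrite add0r (ham_d0 hH) subr0. Qed.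

Lemma sqi_meas1 g j : square_integrable g -> measurable_fun setT (fun t => (g t).1 ord0 j).
Proof. by move=> /square_integrableP[s1 _]; case: (s1 j). Qed.

Lemma sqi_meas2 g j : square_integrable g -> measurable_fun setT (fun t => (g t).2 ord0 j).
Proof. by move=> /square_integrableP[_ s2]; case: (s2 j). Qed.

Lemma sqi_meas_comp g (f : cspace R n -> R) : square_integrable g -> continuous f ->
  measurable_fun setT (fun t => f (g t)).
Proof.
by move=> sg cf; apply: measurable_comp_cspace => // j; [exact: sqi_meas1|exact: sqi_meas2].
Qed.

Lemma circle_integrable_enorm2 g : square_integrable g -> circle_integrable (fun t => enorm (g t) ^+ 2).
Proof. by move=> sg; apply: circle_integrable_eq (circle_integrable_rdot sg sg) => t _; rewrite enorm_sqr. Qed.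

Lemma l2dot_enorm2 g : l2dot g g = circle_int (fun t => enorm (g t) ^+ 2).
Proof. Transparent l2dot. by apply: circle_int_eq => t _; rewrite enorm_sqr. Opaque l2dot. Qed.

Lemma circle_integrable_H g : square_integrable g -> circle_integrable (fun t => H (g t)).
Proof.
move=> sg; apply: (circle_integrable_le _ (circle_integrableZ K (circle_integrable_enorm2 sg))) => [|t _]; last exact: ham_H_le.
by apply: sqi_meas_comp => //; exact: ham_cont hH.
Qed.

Definition ham_int g : R := circle_int (fun t => H (g t)).
Definition grad_along g : loop R n := fun t => dH (g t).

Lemma sqi_of_bound g (F : R -> R) : (forall b, measurable_fun setT (fun t => rdot (g t) b)) ->
  circle_integrable F -> (forall t, enorm (g t) ^+ 2 <= F t) -> square_integrable g.
Proof.
move=> mg iF gF; apply/square_integrableP; split=> j.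
  have m1 : measurable_fun setT (fun t => (g t).1 ord0 j).
    rewrite (_ : (fun t => _) = (fun t => rdot (g t) (e1 j))); first exact: mg.
    by apply/funext => t; rewrite rdot_e1.
  split=> //; apply: (circle_integrable_le _ iF) => [|t _]; first exact: measurable_funX.
  rewrite ger0_norm ?sqr_ge0 // (le_trans _ (gF t)) // -[leLHS]real_normK ?num_real //.
  by rewrite lerXn2r ?nnegrE ?enorm_ge0 ?coord1_le.
have m2 : measurable_fun setT (fun t => (g t).2 ord0 j).
    rewrite (_ : (fun t => _) = (fun t => rdot (g t) (e2 j))); first exact: mg.
    by apply/funext => t; rewrite rdot_e2.
split=> //; apply: (circle_integrable_le _ iF) => [|t _]; first exact: measurable_funX.
rewrite ger0_norm ?sqr_ge0 // (le_trans _ (gF t)) // -[leLHS]real_normK ?num_real //.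
by rewrite lerXn2r ?nnegrE ?enorm_ge0 ?coord2_le.
Qed.

Lemma sqi_grad_along g : square_integrable g -> square_integrable (grad_along g).
Proof.
move=> sg; apply: (sqi_of_bound _ (circle_integrableZ (K ^+ 2) (circle_integrable_enorm2 sg))) => [b|t].
  by apply: (@sqi_meas_comp g (fun z => rdot (dH z) b)) => //; exact: ham_dcont hH b.
by rewrite -exprMn lerXn2r ?nnegrE ?mulr_ge0 ?enorm_ge0 ?(ltW (ham_K hH)) ?ham_dH_le.
Qed.

Lemma ham_int_quad g v : square_integrable g -> square_integrable v ->
  `|ham_int (g + v) - ham_int g - l2dot (grad_along g) v| <= K * l2dot v v.
Proof.
move=> sg sv; have sgv := sqiD sg sv; have sd := sqi_grad_along sg.
rewrite l2dot_enorm2 -circle_intZ; last exact: circle_integrable_enorm2.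
Transparent l2dot.
rewrite /l2dot /ham_int -circle_intB; [|exact: circle_integrable_H|exact: circle_integrable_H].
have i1 := circle_integrableB (circle_integrable_H sgv) (circle_integrable_H sg).
rewrite -circle_intB; [|exact: i1|exact: circle_integrable_rdot].
have i2 := circle_integrableB i1 (circle_integrable_rdot sd sv).
apply: le_trans (circle_int_norm i2) _; apply: circle_int_le; first exact: circle_integrable_norm i2.
  by apply: circle_integrableZ; exact: circle_integrable_enorm2.
by move=> t _; exact: ham_quad hH (g t) (v t).
Opaque l2dot.
Qed.

Lemma grad_along_lip g v : square_integrable g -> square_integrable v ->
  l2dot (grad_along (g + v) - grad_along g) (grad_along (g + v) - grad_along g) <= K ^+ 2 * l2dot v v.
Proof.
move=> sg sv; have sgv := sqiD sg sv; have s1 := sqi_grad_along sg; have s2 := sqi_grad_along sgv.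
rewrite !l2dot_enorm2 -circle_intZ; last exact: circle_integrable_enorm2.
apply: circle_int_le; [exact: circle_integrable_enorm2 (sqiB s2 s1)|apply: circle_integrableZ; exact: circle_integrable_enorm2|].
move=> t _; rewrite -exprMn lerXn2r ?nnegrE ?mulr_ge0 ?enorm_ge0 ?(ltW (ham_K hH)) //.
exact: ham_lip hH (g t) (v t).
Qed.

Lemma grad_along_le g : square_integrable g -> l2dot (grad_along g) (grad_along g) <= K ^+ 2 * l2dot g g.
Proof.
move=> sg; rewrite !l2dot_enorm2 -circle_intZ; last exact: circle_integrable_enorm2.
apply: circle_int_le; [exact: circle_integrable_enorm2 (sqi_grad_along sg)|apply: circle_integrableZ; exact: circle_integrable_enorm2|].
move=> t _; rewrite -exprMn lerXn2r ?nnegrE ?mulr_ge0 ?enorm_ge0 ?(ltW (ham_K hH)) //.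
exact: ham_dH_le.
Qed.

Lemma actionE g : sob_half g -> action H g = pi * action_form g - ham_int g.
Proof. by move=> sg; rewrite /action symplectic_action_extE. Qed.

Lemma enorm_fcoef_l2dot g m : square_integrable g -> 2 * pi * enorm (fcoef g m) ^+ 2 <= l2dot g g.
Proof.
move=> sg; apply: le_trans (bessel (absz m) sg); rewrite ler_pM2l ?pi2_gt0 //.
by apply: (@sum_modes_term R (absz m) (fun k => enorm (fcoef g k) ^+ 2)) => // k; exact: sqr_ge0.
Qed.

Lemma fcoef_grad_along_dist g v m : sob_half g -> sob_half v ->
  enorm (fcoef (grad_along (g + v)) m - fcoef (grad_along g) m) <= K * lnorm v.
Proof.
move=> sg sv; have qg := sob_sqi sg; have qv := sob_sqi sv.
have sd := sqi_grad_along qg; have sdv := sqi_grad_along (sqiD qg qv).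
rewrite -(fcoefB _ sdv sd).
rewrite -(@ler_pXn2r _ 2%N) ?nnegrE ?enorm_ge0 ?mulr_ge0 ?lnorm_ge0 ?(ltW (ham_K hH)) //.
rewrite -(ler_pM2l (@pi2_gt0 R)).
apply: le_trans (enorm_fcoef_l2dot m (sqiB sdv sd)) _.
apply: le_trans (grad_along_lip qg qv) _.
by rewrite exprMn mulrCA; rewrite ler_wpM2l ?sqr_ge0 // l2dot_le_lnorm.
Qed.

Definition action_lip : R := 2 * pi * (1 + K).

Lemma action_lip_gt0 : 0 < action_lip.
Proof. by rewrite /action_lip mulr_gt0 ?pi2_gt0 // addr_gt0 ?(ham_K hH). Qed.

Lemma l2dot_bound g h : sob_half g -> sob_half h ->
  `|l2dot (grad_along g) h| <= 2 * pi * K * (lnorm g * lnorm h).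
Proof.
move=> sg sh; have qg := sob_sqi sg; have qh := sob_sqi sh.
have K0 := ham_K hH; have p0 := @pi2_gt0 R.
rewrite -(@ler_pXn2r _ 2%N) ?nnegrE ?normr_ge0 //; last first.
  by apply: mulr_ge0; [apply: mulr_ge0; exact: ltW|apply: mulr_ge0; exact: lnorm_ge0].
rewrite real_normK ?num_real //; apply: le_trans (l2dot_CS2 (sqi_grad_along qg) qh) _.
apply: (@le_trans _ _ ((K ^+ 2 * (2 * pi * lnorm g ^+ 2)) * (2 * pi * lnorm h ^+ 2))).
  apply: ler_pM; [exact: l2dot_ge0|exact: l2dot_ge0| |exact: l2dot_le_lnorm].
  by apply: le_trans (grad_along_le qg) _; rewrite ler_wpM2l ?sqr_ge0 // l2dot_le_lnorm.
move: (lnorm g) (lnorm h) => x y.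
by rewrite le_eqVlt; apply/orP; left; apply/eqP; ring.
Qed.

(** The action is locally Lipschitz, with a constant that grows linearly: the
    quadratic part and the Taylor remainder of H are bounded by the squared
    norm. *)
Lemma action_dist g h : sob_half g -> sob_half h ->
  `|action H (g + h) - action H g| <= action_lip * ((lnorm g + lnorm h) * lnorm h).
Proof.
move=> sg sh; rewrite (actionE (sobD sg sh)) (actionE sg).
have := ham_int_quad (sob_sqi sg) (sob_sqi sh); have := action_form_dist sg sh.
have := l2dot_bound sg sh; have := l2dot_le_lnorm sh; have := lnorm_ge0 g; have := lnorm_ge0 h.
have := ham_K hH; have := pi_gt0 R; rewrite /action_lip.
move: (action_form (g + h)) (action_form g) (ham_int (g + h)) (ham_int g) (l2dot (grad_along g) h) (l2dot h h) (lnorm g) (lnorm h).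
move=> q1 q2 h1 h2 d i x y p0 K0 y0 x0 iy dxy; rewrite !ler_norml => /andP[a1 a2] /andP[b1 b2].
move: dxy; rewrite ler_norml => /andP[c1 c2].
have e1 : pi * (q1 - q2) <= pi * (2 * x * y + y ^+ 2) by rewrite ler_pM2l.
have e2 : pi * - (2 * x * y + y ^+ 2) <= pi * (q1 - q2) by rewrite ler_pM2l.
have e3 : K * i <= K * (2 * pi * y ^+ 2) by rewrite ler_pM2l.
have e4 : 0 <= pi * y ^+ 2 by rewrite mulr_ge0 ?sqr_ge0 // ltW.
have E : 2 * pi * (1 + K) * ((x + y) * y) = pi * (2 * x * y + y ^+ 2) + pi * y ^+ 2 +
  2 * pi * K * (x * y) + K * (2 * pi * y ^+ 2) by ring.
rewrite E; move: e1 e2 e3 e4 c1 c2 a1 a2 b1 b2; rewrite mulrN !mulrBr.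
move: (pi * (2 * x * y + y ^+ 2)) (pi * y ^+ 2) (2 * pi * K * (x * y)) (K * (2 * pi * y ^+ 2)) (pi * q1) (pi * q2) (K * i).
by move=> *; apply/andP; split; lra.
Qed.

(** The equations say that the linear part of the increment of the action
    vanishes on every mode, hence on every h by the polarized Parseval
    identity; what remains is quadratic in h. *)
Lemma critical_of_eq g : sob_half g ->
  (forall m, m%:~R *: fcoef g m = fcoef (grad_along g) m) -> critical_point (action H) g.
Proof.
move=> sg geq; split; first exact: sg.
move=> e e0.
have K0 := ham_K hH; have p0 := pi_gt0 R; have pn : pi != 0 :> R by rewrite gt_eqF.
pose C := pi * (1 + 2 * K); have C0 : 0 < C.
  by rewrite mulr_gt0 // addr_gt0 // mulr_gt0.
exists (e / C); first by rewrite divr_gt0.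
move=> h sh; rewrite ler_pdivlMr // => hd.
have qg := sob_sqi sg; have qh := sob_sqi sh; have qd := sqi_grad_along qg.
have Qd : `|action_form (g + h) - action_form g - l2dot (grad_along g) h / pi| <= lnorm h ^+ 2.
  have L1 := action_form_partial_cvg (sob_fin (sobD sg sh)); have L2 := action_form_partial_cvg (sob_fin sg).
  have L3 : 2 * pi * (\sum_(m <- modes N) rdot (fcoef (grad_along g) m) (fcoef h m)) * pi^-1 @[N --> \oo] --> l2dot (grad_along g) h * pi^-1.
    by apply: cvgM; [exact: l2dot_cvg|exact: cvg_cst].
  apply: (norm_lim_le _ (cvgB (cvgB L1 L2) L3)) => N.
  rewrite -[X in `|X|]/(action_form_partial N (g + h) - action_form_partial N g - 2 * pi * (\sum_(m <- modes N) rdot (fcoef (grad_along g) m) (fcoef h m)) * pi^-1).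
  rewrite action_form_partialD //.
  have -> : \sum_(m <- modes N) rdot (fcoef (grad_along g) m) (fcoef h m) = action_bilin N g h.
    by apply: eq_bigr => m _; rewrite -geq rdotZl.
  apply: le_trans (action_form_partial_le N (sob_fin sh)).
  move: (action_form_partial N g) (action_bilin N g h) (action_form_partial N h) => x y z.
  rewrite (_ : x + 2 * y + z - x - 2 * pi * y / pi = z) //.
  by rewrite (mulrAC 2 pi y) mulfK //; ring.
have := ham_int_quad qg qh; have := l2dot_le_lnorm sh; rewrite (actionE (sobD sg sh)) (actionE sg).
move: Qd hd; have := lnorm_ge0 h; rewrite /C.
move: (action_form (g + h)) (action_form g) (ham_int (g + h)) (ham_int g) (l2dot (grad_along g) h) (l2dot h h) (lnorm h).
move=> q1 q2 h1 h2 d i y y0; rewrite !ler_norml => /andP[a1 a2] hd iy /andP[b1 b2].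
have e1 : pi * (q1 - q2 - d / pi) <= pi * y ^+ 2 by rewrite ler_pM2l.
have e2 : pi * - y ^+ 2 <= pi * (q1 - q2 - d / pi) by rewrite ler_pM2l.
have E : pi * (q1 - q2 - d / pi) = pi * q1 - pi * q2 - d by rewrite !mulrBr (mulrC pi (d / pi)) divfK.
have e3 : K * i <= K * (2 * pi * y ^+ 2) by rewrite ler_pM2l.
have e4 : y * (pi * (1 + 2 * K)) * y <= e * y by rewrite ler_wpM2r.
have E2 : y * (pi * (1 + 2 * K)) * y = pi * y ^+ 2 + K * (2 * pi * y ^+ 2) by ring.
rewrite E in e1 e2; rewrite E2 in e4; move: e1 e2 e3 e4 b1 b2; rewrite mulrN.
move: (pi * y ^+ 2) (K * (2 * pi * y ^+ 2)) (pi * q1) (pi * q2) (K * i) (e * y).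
by move=> *; apply/andP; split; lra.
Qed.

End Functional.

(** * Linking for trigonometric polynomials *)

Section TrigPolyNorm.
Context {R : realType} {n : nat}.
Implicit Types (c d : int -> cspace R n).

(** The squared norm of the part of a trigonometric polynomial with frequencies
    in P. *)
Definition weighted_energy (P : pred int) N c : R := \sum_(m <- modes N | P m) sob_weight m * enorm (c m) ^+ 2.

Lemma weighted_term_ge0 c m : 0 <= sob_weight m * enorm (c m) ^+ 2.
Proof. by rewrite mulr_ge0 ?sqr_ge0 ?sob_weight_ge0. Qed.

Lemma weighted_energy_ge0 P N c : 0 <= weighted_energy P N c.
Proof. by apply: sumr_ge0 => m _; exact: weighted_term_ge0. Qed.

Lemma weighted_energy_eq (P : pred int) N c d : (forall m, (`|m| <= N)%N -> P m -> c m = d m) -> weighted_energy P N c = weighted_energy P N d.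
Proof.
move=> cd; rewrite /weighted_energy -big_filter -[RHS]big_filter; apply: eq_big_seq => m.
by rewrite mem_filter mem_modes => /andP[Pm mN]; rewrite cd.
Qed.

Lemma weighted_energyZ P N x c : weighted_energy P N (fun m => x *: c m) = x ^+ 2 * weighted_energy P N c.
Proof.
rewrite /weighted_energy mulr_sumr; apply: eq_bigr => m _.
by rewrite enormZ exprMn real_normK ?num_real // mulrCA.
Qed.

Lemma weighted_energy_split N c : weighted_energy predT N c = weighted_energy (fun m => m <= 0) N c + weighted_energy (fun m => 0 < m) N c.
Proof.
rewrite /weighted_energy (bigID (fun m : int => m <= 0)) /=; congr (_ + _).
by apply: eq_bigl => m; rewrite ltNge.
Qed.

Lemma weighted_energy_term (P : pred int) N c m : (`|m| <= N)%N -> P m -> enorm (c m) ^+ 2 <= weighted_energy P N c.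
Proof.
move=> mN Pm; apply: (@le_trans _ _ (sob_weight m * enorm (c m) ^+ 2)).
  by rewrite ler_peMl ?sqr_ge0 ?sob_weight_ge1.
rewrite /weighted_energy big_mkcond; have := @sum_modes_term R N (fun m => if P m then sob_weight m * enorm (c m) ^+ 2 else 0) m mN.
by rewrite Pm; apply => k; case: ifP => // _; exact: weighted_term_ge0.
Qed.

Lemma sob_partial_tpoly N M c : (N <= M)%N -> sob_partial M (tpoly N c) = weighted_energy predT N c.
Proof.
move=> NM; rewrite /sob_partial /weighted_energy (sum_modes_widen _ NM) [RHS]big_mkcond; apply: eq_bigr => m _.
by rewrite fcoef_tpoly; case: ifP => // _; rewrite enorm0 expr0n mulr0.
Qed.

Lemma lnorm_tpoly N c : lnorm (tpoly N c) ^+ 2 = weighted_energy predT N c.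
Proof.
apply/eqP; rewrite eq_le; apply/andP; split; last first.
  by rewrite -(sob_partial_tpoly c (leqnn N)) sob_partial_le //; apply: sob_fin; exact: sob_tpoly.
have [M|//] := @lnorm_finiteP R n (tpoly N c) (weighted_energy predT N c).
rewrite -(sob_partial_tpoly c (leq_maxr M N)); apply: sum_modes_mono; first exact: leq_maxl.
by move=> m; exact: weighted_term_ge0.
Qed.

Lemma action_form_partial_tpoly N M c : (N <= M)%N -> action_form_partial M (tpoly N c) = \sum_(m <- modes N) m%:~R * enorm (c m) ^+ 2.
Proof.
move=> NM; rewrite /action_form_partial (sum_modes_widen _ NM) [RHS]big_mkcond; apply: eq_bigr => m _.
by rewrite fcoef_tpoly; case: ifP => // _; rewrite enorm0 expr0n mulr0.
Qed.

Lemma action_form_tpoly N c : action_form (tpoly N c) = \sum_(m <- modes N) m%:~R * enorm (c m) ^+ 2.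
Proof.
apply: cvg_lim => //; apply: cvg_near_cst; exists N => // M NM /=.
by rewrite action_form_partial_tpoly.
Qed.

End TrigPolyNorm.

Section Cutoff.
Context {R : realType}.

(** The truncation of t to [0, 1], written with absolute values so that its
    continuity is immediate. *)
Definition clamp (t : R) : R := (`|t| - `|t - 1| + 1) / 2.

Lemma clamp01 t : 0 <= clamp t <= 1.
Proof.
rewrite /clamp; case: (ger0P t) => t0; case: (ger0P (t - 1)) => t1.
all: by apply/andP; split; lra.
Qed.

Lemma clamp0 t : t <= 0 -> clamp t = 0.
Proof. by move=> t0; rewrite /clamp ler0_norm // ler0_norm; lra. Qed.

Lemma clamp1 t : 1 <= t -> clamp t = 1.
Proof. by move=> t0; rewrite /clamp ger0_norm ?ger0_norm; lra. Qed.

Lemma clamp_cvg (T : Type) (F : set_system T) (u : T -> R) l : Filter F ->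
  u t @[t --> F] --> l -> clamp (u t) @[t --> F] --> clamp l.
Proof.
move=> FF ul; apply: cvgMl; apply: cvgD; last exact: cvg_cst.
by apply: cvgB; [exact: cvg_norm|apply: cvg_norm; apply: cvgB => //; exact: cvg_cst].
Qed.

Lemma squeeze_norm0 (T : Type) (F : set_system T) (u v : T -> R) : Filter F ->
  (forall t, `|u t| <= v t) -> v t @[t --> F] --> 0 -> u t @[t --> F] --> 0.
Proof.
move=> FF uv v0; apply/cvgr0Pnorm_lt => e e0.
move/cvgr0Pnorm_lt : v0 => /(_ e e0); apply: filterS => t vt.
by apply: le_lt_trans (uv t) _; apply: le_lt_trans vt; exact: ler_norm.
Qed.

Lemma cvg_sum_in (I : eqType) (r : seq I) (P : pred I) (T : Type) (F : set_system T)
    (f : I -> T -> R) (l : I -> R) : Filter F ->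
  (forall i, i \in r -> P i -> f i t @[t --> F] --> l i) ->
  \sum_(i <- r | P i) f i t @[t --> F] --> \sum_(i <- r | P i) l i.
Proof.
move=> FF; elim: r => [|i r IH] fl.
  by under eq_fun do rewrite big_nil; rewrite big_nil; exact: cvg_cst.
under eq_fun do rewrite big_cons; rewrite big_cons.
have IHr := IH (fun j jr => fl j (mem_behead (s := i :: r) jr)).
case: ifP => // Pi; apply: cvgD => //; apply: fl => //; exact: mem_head.
Qed.

Lemma cvg_sum0 (I : eqType) (r : seq I) (T : Type) (F : set_system T) (f : I -> T -> R) :
  Filter F -> (forall i, i \in r -> f i t @[t --> F] --> (0 : R)) ->
  \sum_(i <- r) f i t @[t --> F] --> (0 : R).
Proof.
move=> FF f0; have := @cvg_sum_in I r predT T F f (fun=> 0) FF (fun i ir _ => f0 i ir).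
by rewrite [X in _ --> X]big1.
Qed.

End Cutoff.

Section VectorLimits.
Context {R : realType} {n : nat}.

Lemma enorm_coord (z : cspace R n) :
  enorm z <= \sum_j `|z.1 ord0 j| * enorm (e1 (R := R) j) + \sum_j `|z.2 ord0 j| * enorm (e2 (R := R) j).
Proof.
rewrite {1}(cspace_basis z); apply: le_trans (enormD _ _) _.
apply: lerD; (apply: le_trans (enorm_sum _ _ _) _); by apply: ler_sum => j _; rewrite enormZ.
Qed.

Lemma enorm_cvg0 (T : Type) (F : set_system T) (u : T -> cspace R n) : Filter F ->
  (forall j, (u t).1 ord0 j @[t --> F] --> (0 : R)) ->
  (forall j, (u t).2 ord0 j @[t --> F] --> (0 : R)) -> enorm (u t) @[t --> F] --> (0 : R).
Proof.
move=> FF u1 u2; apply: (squeeze_norm0 (v := fun t =>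
  \sum_j `|(u t).1 ord0 j| * enorm (e1 (R := R) j) +
  \sum_j `|(u t).2 ord0 j| * enorm (e2 (R := R) j))) => [k|].
  by rewrite ger0_norm ?enorm_ge0 // enorm_coord.
rewrite -[X in _ --> X]addr0; apply: cvgD.
  apply: cvg_sum0 => j _; rewrite -(mul0r (enorm (e1 (R := R) j))); apply: cvgMl.
  by rewrite -(normr0 R); apply: cvg_norm.
apply: cvg_sum0 => j _; rewrite -(mul0r (enorm (e2 (R := R) j))); apply: cvgMl.
by rewrite -(normr0 R); apply: cvg_norm.
Qed.

Lemma enorm_cvg (T : Type) (F : set_system T) (u : T -> cspace R n) l : Filter F ->
  enorm (u t - l) @[t --> F] --> (0 : R) -> enorm (u t) @[t --> F] --> enorm l.
Proof.
move=> FF ul; apply/subr_cvg0; apply: (squeeze_norm0 (v := fun t => enorm (u t - l))) => // t.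
rewrite ler_norml lerBlDr -[X in enorm X <= _](subrK l) enormD andbT.
rewrite lerNl opprB lerBlDr -{1}[l](subrK (u t)) (le_trans (enormD _ _)) //.
by rewrite enorm_distC.
Qed.

End VectorLimits.

Section Galerkin.
Context {R : realType} {n : nat}.
Context {H : cspace R n -> R} {dH : cspace R n -> cspace R n} {kap K Cp rho : R}.
Context (hH : hamiltonian H dH kap K Cp rho).
Context (N : nat).
Implicit Types (c d : int -> cspace R n).

Definition trunc_action c : R := action H (tpoly N c).
(** The L^2-gradient of the truncated action, up to a factor 2 pi. *)
Definition trunc_grad c m : cspace R n := m%:~R *: c m - fcoef (grad_along (dH := dH) (tpoly N c)) m.
Definition trunc_grad_sq c : R := \sum_(m <- modes N) enorm (trunc_grad c m) ^+ 2.

Lemma trunc_grad_sq_ge0 c : 0 <= trunc_grad_sq c.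
Proof. by apply: sumr_ge0 => m _; exact: sqr_ge0. Qed.

Lemma trunc_action_le c : trunc_action c <= action_lip (K := K) * weighted_energy predT N c.
Proof.
have s0 := @sob0 R n; have l0 := @lnorm0 R n.
have st := @sob_tpoly R n N c.
have := action_dist hH s0 st; rewrite add0r l0 add0r -expr2 lnorm_tpoly.
have -> : action H 0 = 0.
  have E0 := actionE (H := H) s0; have := action_form_le (sob_fin s0); rewrite l0 expr0n normr_le0 => /eqP.
  move=> Q0; rewrite E0 Q0 mulr0 sub0r /ham_int (circle_int_eq (g := fun=> 0)) ?circle_int_cst ?mul0r ?oppr0 //.
  by move=> t _; exact: ham_H0 hH.
by rewrite subr0; apply: le_trans; exact: ler_norm.
Qed.

(** The second order term of the action along the gradient G is at most pi s^2
    (N + 2 K) |G|^2: N bounds the quadratic part on the frequencies up to N and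
    2 K the Taylor remainder of H. *)
Lemma descent c s : 0 <= s -> s * (N%:R + 2 * K) <= 1 ->
  trunc_action (fun m => c m - s *: trunc_grad c m) <= trunc_action c - pi * s * trunc_grad_sq c.
Proof.
move=> s0 sK; set G := trunc_grad c.
have -> : trunc_action (fun m => c m - s *: G m) = action H (tpoly N c + tpoly N (fun m => (- s) *: G m)).
  by rewrite tpolyD /trunc_action; congr (action H _); apply: eq_bigr => m _; rewrite scaleNr.
have s1 := @sob_tpoly R n N c; have s2 := @sob_tpoly R n N (fun m => (- s) *: G m).
rewrite /trunc_action (actionE (sobD s1 s2)) (actionE s1).
have q1 := @sqi_tpoly R n N c; have q2 := @sqi_tpoly R n N (fun m => (- s) *: G m).
have := ham_int_quad hH q1 q2; rewrite l2dot_tpoly2 l2dot_tpoly; last exact: (sqi_grad_along hH).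
rewrite tpolyD !action_form_tpoly.
set d := fcoef (grad_along (dH := dH) (tpoly N c)).
have -> : \sum_(m <- modes N) enorm (- s *: G m) ^+ 2 = s ^+ 2 * trunc_grad_sq c.
  by rewrite mulr_sumr; apply: eq_bigr => m _; rewrite enormZ exprMn normrN real_normK ?num_real.
move: (ham_int (H := H) _) (ham_int (H := H) _) => A B.
have E : \sum_(m <- modes N) m%:~R * enorm (c m + - s *: G m) ^+ 2 <=
  \sum_(m <- modes N) m%:~R * enorm (c m) ^+ 2 +
  2 * \sum_(m <- modes N) rdot (d m) (- s *: G m) - 2 * s * trunc_grad_sq c + N%:R * (s ^+ 2 * trunc_grad_sq c).
  rewrite !mulr_sumr -big_split -sumrB -big_split /=; apply: sum_modes_le => m mN.
  rewrite enorm_sqrD !rdotZr enormZ exprMn real_normK ?num_real // sqrrN.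
  have dE : d m = m%:~R *: c m - G m by rewrite /G /trunc_grad opprB addrC subrK.
  rewrite dE rdotBl rdotZl -(enorm_sqr (G m)).
  have mR : m%:~R <= N%:R :> R by rewrite -[N%:R]/(N%:Z%:~R) ler_int; lia.
  have e0 : 0 <= s ^+ 2 * enorm (G m) ^+ 2 by rewrite mulr_ge0 ?sqr_ge0.
  have := ler_wpM2r e0 mR; move: (enorm (c m)) (enorm (G m)) (rdot (c m) (G m)) (m%:~R : R) (N%:R : R).
  by move=> x y z w v; lra.
move=> hd; rewrite -/d in hd.
have Ep := ler_wpM2l (ltW (pi_gt0 R)) E.
have F : pi * (s * (s * (N%:R + 2 * K)) * trunc_grad_sq c) <= pi * (s * 1 * trunc_grad_sq c).
  by rewrite ler_wpM2l ?(ltW (pi_gt0 R)) // ler_wpM2r ?trunc_grad_sq_ge0 // ler_wpM2l.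
move: hd; rewrite ler_norml => /andP[h1 h2].
move: Ep F h1; move: (\sum_(m <- modes N) m%:~R * enorm (c m) ^+ 2) (\sum_(m <- modes N) rdot (d m) (- s *: G m)).
move: (\sum_(m <- modes N) m%:~R * enorm _ ^+ 2) => x y z.
move: (trunc_grad_sq c) (N%:R : R) (pi : R) => g w p.
lra.
Qed.

Context (beta : R) (beta_gt0 : 0 < beta).

(** The largest step for which [descent] applies. *)
Definition eta : R := (N%:R + 2 * K)^-1.
Definition cutoff c : R := clamp (2 * trunc_action c / beta - 1).
(** The discrete counterpart of the negative gradient flow, with a cutoff that
    keeps the boundary of Sigma fixed. *)
Definition descent_step c m : cspace R n := c m - (eta * cutoff c) *: trunc_grad c m.

Lemma eta_denom_gt0 : 0 < N%:R + 2 * K.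
Proof. by rewrite ltr_wpDl // mulr_gt0 // (ham_K hH). Qed.

Lemma eta_gt0 : 0 < eta. Proof. by rewrite invr_gt0 eta_denom_gt0. Qed.

Lemma cutoff_low c : trunc_action c <= beta / 2 -> cutoff c = 0.
Proof.
move=> Lb; apply: clamp0; rewrite subr_le0 ler_pdivrMr // mul1r.
by rewrite -ler_pdivlMl // mulrC.
Qed.

Lemma cutoff_high c : beta <= trunc_action c -> cutoff c = 1.
Proof.
move=> Lb; apply: clamp1; rewrite lerBrDr ler_pdivlMr //.
by rewrite (_ : (1 + 1 : R) = 2) // ler_pM2l.
Qed.

Lemma descent_step_fix c : trunc_action c <= beta / 2 -> descent_step c = c.
Proof. by move=> /cutoff_low e; apply/funext => m; rewrite /descent_step e mulr0 scale0r subr0. Qed.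

Lemma descent_step_decrease c : trunc_action (descent_step c) <= trunc_action c - pi * (eta * cutoff c) * trunc_grad_sq c.
Proof.
have /andP[c0 c1] := clamp01 (2 * trunc_action c / beta - 1).
apply: descent; first by rewrite mulr_ge0 // ltW // eta_gt0.
rewrite mulrAC mulVf ?mul1r //; by rewrite gt_eqF ?eta_denom_gt0.
Qed.

Lemma descent_step_le c : trunc_action (descent_step c) <= trunc_action c.
Proof.
apply: le_trans (descent_step_decrease c) _; rewrite gerBl mulr_ge0 ?trunc_grad_sq_ge0 // mulr_ge0 ?(ltW (pi_gt0 R)) //.
by have /andP[c0 c1] := clamp01 (2 * trunc_action c / beta - 1); rewrite mulr_ge0 // ltW // eta_gt0.
Qed.

Lemma iter_step_fix k c : trunc_action c <= beta / 2 -> iter k descent_step c = c.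
Proof. by move=> cb; elim: k => //= k ->; exact: descent_step_fix. Qed.

(** If the gradient exceeded the bound at each of the first k points, the
    action would drop below beta. *)
Lemma iter_step_small k c (M e : R) : beta <= trunc_action (iter k descent_step c) -> trunc_action c <= M -> 0 < e ->
  M - beta < k%:R * (pi * eta * e) -> exists d, beta <= trunc_action d /\ trunc_grad_sq d <= e.
Proof.
move=> Lk LM e0 kM.
apply: contrapT => nex.
have He d : beta <= trunc_action d -> e < trunc_grad_sq d.
  by move=> bd; rewrite ltNge; apply/negP => gd; apply: nex; exists d.
suff : forall j, (j <= k)%N -> trunc_action (iter j descent_step c) <= M - j%:R * (pi * eta * e).
  move=> /(_ k (leqnn _)); move: kM Lk; move: (k%:R * _) (trunc_action _) => x y; lra.
have Lge j : (j <= k)%N -> beta <= trunc_action (iter j descent_step c).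
  move=> jk; apply: le_trans Lk _; rewrite -(subnK jk).
  elim: (k - j)%N => // i IH; rewrite addSn iterS; exact: le_trans (descent_step_le _) IH.
elim=> [|j IH jk]; first by rewrite mul0r subr0.
have bj := Lge j (ltnW jk).
have := IH (ltnW jk); have := descent_step_decrease (iter j descent_step c); rewrite cutoff_high // mulr1 iterS.
have : pi * eta * e <= pi * eta * trunc_grad_sq (iter j descent_step c).
  by rewrite ler_pM2l ?mulr_gt0 ?pi_gt0 ?eta_gt0 // ltW // He.
have -> : j.+1%:R * (pi * eta * e) = j%:R * (pi * eta * e) + pi * eta * e by rewrite -natr1 mulrDl mul1r.
move: (j%:R * (pi * eta * e)) (pi * eta * e) (pi * eta * trunc_grad_sq _) (trunc_action _) (trunc_action _) => *; lra.
Qed.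

(** Coefficientwise convergence of the frequencies up to N, which is all that a
    trigonometric polynomial of degree N sees. *)
Definition coef_cvg (F : set_system nat) (u : nat -> int -> cspace R n) c :=
  forall m, (`|m| <= N)%N -> enorm (u k m - c m) @[k --> F] --> (0 : R).

Section Continuity.
Context (F : set_system nat) {FF : ProperFilter F}.
Context (u : nat -> int -> cspace R n) (c : int -> cspace R n) (uc : coef_cvg F u c).

Let v k : loop R n := tpoly N (fun m => u k m - c m).

Lemma tpoly_add_diff k : tpoly N (u k) = tpoly N c + v k.
Proof. by rewrite tpolyD; apply: eq_bigr => m _; rewrite addrC subrK. Qed.

Lemma lnorm_diff_cvg : lnorm (v k) @[k --> F] --> (0 : R).
Proof.
have E k : lnorm (v k) = Num.sqrt (weighted_energy predT N (fun m => u k m - c m)).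
  by rewrite -lnorm_tpoly sqrtr_sqr ger0_norm // lnorm_ge0.
rewrite (_ : (fun k => _) = (fun k => Num.sqrt (weighted_energy predT N (fun m => u k m - c m)))); last by apply/funext.
have -> : (0 : R) = Num.sqrt 0 by rewrite sqrtr0.
apply: (@cvg_comp _ _ _ _ _ F (nbhs (0 : R))); last exact: sqrt_continuous.
have -> : (0 : R) = \sum_(m <- modes N) 0 by rewrite big1.
apply: cvg_sum_in => m; rewrite mem_modes => mN _.
rewrite (_ : 0 = sob_weight m * (0 * 0)); last by rewrite !mulr0.
by apply: cvgMr; apply: cvgM; exact: uc.
Qed.

Lemma trunc_action_cvg : trunc_action (u k) @[k --> F] --> trunc_action c.
Proof.
apply/subr_cvg0; apply: (@squeeze_norm0 _ _ _ _ (fun k => action_lip (K := K) * ((lnorm (tpoly N c) + lnorm (v k)) * lnorm (v k)))).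
  move=> k; rewrite /trunc_action tpoly_add_diff; apply: (action_dist hH); exact: sob_tpoly.
rewrite -(mulr0 (action_lip (K := K))); apply: cvgMr.
rewrite -(mulr0 (lnorm (tpoly N c) + 0)); apply: cvgM; last exact: lnorm_diff_cvg.
by apply: cvgD; [exact: cvg_cst|exact: lnorm_diff_cvg].
Qed.

Lemma trunc_grad_cvg m : (`|m| <= N)%N -> enorm (trunc_grad (u k) m - trunc_grad c m) @[k --> F] --> (0 : R).
Proof.
move=> mN; apply: (@squeeze_norm0 _ _ _ _ (fun k => `|m%:~R| * enorm (u k m - c m) + K * lnorm (v k))).
  move=> k; rewrite ger0_norm ?enorm_ge0 //.
  have -> : trunc_grad (u k) m - trunc_grad c m = m%:~R *: (u k m - c m) -
     (fcoef (grad_along (dH := dH) (tpoly N (u k))) m - fcoef (grad_along (dH := dH) (tpoly N c)) m).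
    by rewrite /trunc_grad scalerBr opprB addrACA opprB [in RHS]addrACA; congr (_ + _); rewrite addrC.
  apply: le_trans (enormB _ _) _; rewrite enormZ lerD2l.
  by rewrite tpoly_add_diff; apply: (fcoef_grad_along_dist hH); exact: sob_tpoly.
rewrite (_ : 0 = `|m%:~R| * 0 + K * 0); last by rewrite !mulr0 addr0.
by apply: cvgD; apply: cvgMr; [exact: uc|exact: lnorm_diff_cvg].
Qed.

Lemma descent_step_cvg : coef_cvg F (fun k => descent_step (u k)) (descent_step c).
Proof.
move=> m mN.
have ac : eta * cutoff (u k) @[k --> F] --> eta * cutoff c.
  apply: cvgMr; apply: clamp_cvg; apply: cvgB; last exact: cvg_cst.
  by apply: cvgMl; apply: cvgMr; exact: trunc_action_cvg.
apply: (@squeeze_norm0 _ _ _ _ (fun k => enorm (u k m - c m) + (`|eta * cutoff (u k)| * enorm (trunc_grad (u k) m - trunc_grad c m)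
   + `|eta * cutoff (u k) - eta * cutoff c| * enorm (trunc_grad c m)))).
  move=> k; rewrite ger0_norm ?enorm_ge0 //.
  rewrite /descent_step; move: (eta * cutoff _) (eta * cutoff _) (trunc_grad _ _) (trunc_grad _ _) (u k m) (c m) => a b x y z w.
  have -> : z - b *: y - (w - a *: x) = (z - w) - (b *: (y - x) + (b - a) *: x).
    rewrite scalerBr scalerBl addrA subrK !opprB [LHS]addrACA [RHS]addrACA; congr (_ + _); exact: addrC.
  apply: le_trans (enormB _ _) _; rewrite lerD2l.
  by apply: le_trans (enormD _ _) _; rewrite !enormZ.
rewrite -(addr0 0); apply: cvgD; first exact: uc.
rewrite -(addr0 0); apply: cvgD.
  rewrite -(mulr0 `|eta * cutoff c|); apply: cvgM; last exact: trunc_grad_cvg.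
  exact: cvg_norm.
rewrite -(mul0r (enorm (trunc_grad c m))); apply: cvgMl.
by rewrite -(normr0 R); apply: cvg_norm; apply/subr_cvg0.
Qed.

End Continuity.

Lemma iter_step_cvg (F : set_system nat) (FF : ProperFilter F) u c j : coef_cvg F u c ->
  coef_cvg F (fun k => iter j descent_step (u k)) (iter j descent_step c).
Proof. by move=> uc; elim: j => // j IH; exact: descent_step_cvg. Qed.

Lemma weighted_energy_cvg (F : set_system nat) (FF : ProperFilter F) u c (P : pred int) : coef_cvg F u c ->
  weighted_energy P N (u k) @[k --> F] --> weighted_energy P N c.
Proof.
move=> uc; apply: cvg_sum_in => m; rewrite mem_modes => mN _; apply: cvgMr.
have E : enorm (u k m) @[k --> F] --> enorm (c m) by apply: enorm_cvg; exact: uc.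
by rewrite !expr2; exact: cvgM.
Qed.

Definition nonpos_mode : pred int := fun m => m <= 0.
Definition pos_mode : pred int := fun m => 0 < m.

Context (pe : int -> cspace R n) (tau alpha : R) (tau_gt0 : 0 < tau) (alpha_gt0 : 0 < alpha).

Local Notation cube := (option ('I_N.+1 * 'I_n * bool)).
Implicit Types (u : cube -> R).

(** The set Sigma, truncated to degree N, is parametrized by a cube: the
    coordinates [Some (i, j, b)] are the real and imaginary parts of the j-th
    component of the coefficient of frequency -i, and the coordinate [None] is
    the parameter s along e^+. *)
Definition cube_coef u (m : int) : cspace R n :=
  (\row_j u (Some (inord (absz m), j, false)), \row_j u (Some (inord (absz m), j, true))).
Definition cube_norm u : R := Num.sqrt (weighted_energy nonpos_mode N (cube_coef u)).
(** The factor tau / max (tau, |u|) of the radial retraction of the cube onto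
    the ball of radius tau in E^-; it sends the faces of the cube to the
    sphere. *)
Definition radial_factor u : R := tau / ((tau + cube_norm u + `|tau - cube_norm u|) / 2).
Definition linking_start u m : cspace R n := if m <= 0 then radial_factor u *: cube_coef u m else u None *: pe m.

Lemma cube_norm_ge0 u : 0 <= cube_norm u. Proof. exact: sqrtr_ge0. Qed.

Lemma radial_factor_low u : cube_norm u <= tau -> radial_factor u = 1.
Proof.
move=> nt; rewrite /radial_factor ger0_norm ?subr_ge0 // (_ : _ / 2 = tau) ?divff ?gt_eqF //.
by field.
Qed.

Lemma radial_factor_high u : tau <= cube_norm u -> radial_factor u = tau / cube_norm u.
Proof.
move=> nt; rewrite /radial_factor ler0_norm ?subr_le0 //; congr (_ / _); by field.
Qed.

Lemma radial_factor_gt0 u : 0 < radial_factor u.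
Proof.
rewrite /radial_factor divr_gt0 // divr_gt0 // ltr_wpDr // ltr_wpDr //; exact: cube_norm_ge0.
Qed.

Lemma linking_start_neg u : weighted_energy nonpos_mode N (linking_start u) = (radial_factor u * cube_norm u) ^+ 2.
Proof.
rewrite exprMn sqr_sqrtr ?weighted_energy_ge0 // -weighted_energyZ; apply: weighted_energy_eq => m _.
by rewrite /nonpos_mode /linking_start => ->.
Qed.

Lemma linking_start_pos u : weighted_energy pos_mode N (linking_start u) = u None ^+ 2 * weighted_energy pos_mode N pe.
Proof.
by rewrite -weighted_energyZ; apply: weighted_energy_eq => m _; rewrite /pos_mode /linking_start ltNge => /negbTE ->.
Qed.

Lemma linking_start_neg_le u : weighted_energy nonpos_mode N (linking_start u) <= tau ^+ 2.
Proof.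
rewrite linking_start_neg; have n0 := cube_norm_ge0 u; case: (leP (cube_norm u) tau) => nt.
  by rewrite radial_factor_low // mul1r lerXn2r // nnegrE // ltW.
by rewrite radial_factor_high ?(ltW nt) // divfK // gt_eqF // (lt_trans tau_gt0).
Qed.

Lemma linking_start_neg_eq u : tau <= cube_norm u -> weighted_energy nonpos_mode N (linking_start u) = tau ^+ 2.
Proof.
by move=> nt; rewrite linking_start_neg radial_factor_high // divfK // gt_eqF // (lt_le_trans tau_gt0).
Qed.

Lemma cube_coef_cvg (F : set_system nat) (FF : ProperFilter F) (x : nat -> cube -> R) x0 :
  (forall i, x k i @[k --> F] --> x0 i) -> coef_cvg F (fun k => cube_coef (x k)) (cube_coef x0).
Proof.
move=> xx m _; apply: enorm_cvg0 => j; under eq_fun do rewrite !mxE; exact/subr_cvg0.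
Qed.

Lemma linking_start_cvg (F : set_system nat) (FF : ProperFilter F) (x : nat -> cube -> R) x0 :
  (forall i, x k i @[k --> F] --> x0 i) -> coef_cvg F (fun k => linking_start (x k)) (linking_start x0).
Proof.
move=> xx m mN; have gc := cube_coef_cvg FF xx.
have nc : cube_norm (x k) @[k --> F] --> cube_norm x0.
  apply: (@cvg_comp _ _ _ _ _ F (nbhs (weighted_energy nonpos_mode N (cube_coef x0)))); last exact: sqrt_continuous.
  exact: weighted_energy_cvg.
have lc : radial_factor (x k) @[k --> F] --> radial_factor x0.
  apply: cvgMr; apply: cvgV.
    by rewrite gt_eqF // divr_gt0 // ltr_wpDr // ltr_wpDr // cube_norm_ge0.
  apply: cvgMl; apply: cvgD; first by apply: cvgD => //; exact: cvg_cst.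
  by apply: cvg_norm; apply: cvgB => //; exact: cvg_cst.
rewrite /linking_start; case: ifP => m0; last first.
  under eq_fun do rewrite -scalerBl enormZ.
  rewrite -(mul0r (enorm (pe m))); apply: cvgMl; rewrite -(normr0 R); apply: cvg_norm.
  exact/subr_cvg0.
apply: (squeeze_norm0 (v := fun k => `|radial_factor (x k)| * enorm (cube_coef (x k) m - cube_coef x0 m) +
   `|radial_factor (x k) - radial_factor x0| * enorm (cube_coef x0 m))) => [k|].
  rewrite ger0_norm ?enorm_ge0 //.
  have -> : radial_factor (x k) *: cube_coef (x k) m - radial_factor x0 *: cube_coef x0 m =
    radial_factor (x k) *: (cube_coef (x k) m - cube_coef x0 m) + (radial_factor (x k) - radial_factor x0) *: cube_coef x0 m.
    by rewrite scalerBr scalerBl addrA subrK.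
  by apply: le_trans (enormD _ _) _; rewrite !enormZ.
rewrite (_ : 0 = `|radial_factor x0| * 0 + 0 * enorm (cube_coef x0 m)); last by rewrite mulr0 mul0r addr0.
apply: cvgD; first by apply: cvgM; [exact: cvg_norm|exact: gc].
apply: cvgMl; rewrite -(normr0 R); apply: cvg_norm; exact/subr_cvg0.
Qed.

Definition coord (i : 'I_N.+1 * 'I_n * bool) c : R :=
  if i.2 then (c (- (i.1.1 : nat)%:Z)).2 ord0 i.1.2 else (c (- (i.1.1 : nat)%:Z)).1 ord0 i.1.2.

Lemma coord_cvg (F : set_system nat) (FF : ProperFilter F) (w : nat -> int -> cspace R n) c i :
  coef_cvg F w c -> coord i (w k) @[k --> F] --> coord i c.
Proof.
move=> wc; have iN : (`|(- (i.1.1 : nat)%:Z)%R| <= N)%N by have := ltn_ord i.1.1; lia.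
apply/subr_cvg0; apply: (squeeze_norm0 (v := fun k => enorm (w k (- (i.1.1 : nat)%:Z) - c (- (i.1.1 : nat)%:Z)))); last exact: wc.
move=> k; rewrite /coord; case: i.2.
  by have := coord2_le (w k (- (i.1.1 : nat)%:Z) - c (- (i.1.1 : nat)%:Z)) i.1.2; rewrite !mxE.
by have := coord1_le (w k (- (i.1.1 : nat)%:Z) - c (- (i.1.1 : nat)%:Z)) i.1.2; rewrite !mxE.
Qed.

Lemma coord_linking_start u i : coord i (linking_start u) = radial_factor u * u (Some i).
Proof.
case: i => [[i j] b]; rewrite /coord /linking_start /cube_coef /= oppr_le0 le0z_nat /= abszN absz_nat inord_val.
by case: b; rewrite !mxE.
Qed.

Lemma coord_cube_norm u i : `|u (Some i)| <= cube_norm u.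
Proof.
have iN : (`|(- (i.1.1 : nat)%:Z)%R| <= N)%N by have := ltn_ord i.1.1; lia.
have in0 : nonpos_mode (- (i.1.1 : nat)%:Z) by rewrite /nonpos_mode oppr_le0.
have : enorm (cube_coef u (- (i.1.1 : nat)%:Z)) <= cube_norm u.
  rewrite -(@ler_pXn2r _ 2%N) ?nnegrE ?enorm_ge0 ?cube_norm_ge0 // [X in _ <= X]sqr_sqrtr ?weighted_energy_ge0 //.
  exact: weighted_energy_term.
apply: le_trans; case: i {iN in0} => [[i j] b].
case: b; [have := coord2_le (cube_coef u (- (i : nat)%:Z)) j|have := coord1_le (cube_coef u (- (i : nat)%:Z)) j].
all: by rewrite !mxE /= abszN absz_nat inord_val.
Qed.

Context (hA : forall c, (forall m, (`|m| <= N)%N -> m <= 0 -> c m = 0) ->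
  weighted_energy pos_mode N c = alpha ^+ 2 -> beta <= trunc_action c).
Context (hB : forall c (s : R), (forall m, 0 < m -> c m = s *: pe m) -> 0 <= s <= tau ->
  weighted_energy nonpos_mode N c <= tau ^+ 2 -> [\/ s = 0, s = tau | weighted_energy nonpos_mode N c = tau ^+ 2] -> trunc_action c <= beta / 2).
Context (hC : alpha ^+ 2 <= tau ^+ 2 * weighted_energy pos_mode N pe).

Definition linking_map k (i : cube) u : R :=
  if i is Some i' then coord i' (iter k descent_step (linking_start u))
  else weighted_energy pos_mode N (iter k descent_step (linking_start u)) - alpha ^+ 2.

(** On the faces of the cube the starting point is on the boundary of Sigma, so
    it is not moved by the iterates and the signs of [linking_map] are those of
    the cube coordinates; for the coordinate s, they are those of -alpha^2 at s
    = 0 and of tau^2 |e^+|^2 - alpha^2 at s = tau. A common zero has no E^-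
    part and an E^+ part of norm alpha. *)
Lemma linking_point k : exists c, weighted_energy nonpos_mode N c <= tau ^+ 2 /\
  weighted_energy pos_mode N c <= tau ^+ 2 * weighted_energy pos_mode N pe /\ beta <= trunc_action (iter k descent_step c).
Proof.
pose a (i : cube) := if i is Some _ then - tau else 0.
have [|F x x0 FF xb xx [i|]|i x xb|u ub u0] := @poincare_miranda R cube a (fun=> tau) (linking_map k).
- by case=> [i|] //=; rewrite gtrN.
- by apply: coord_cvg; apply: iter_step_cvg; exact: linking_start_cvg.
- apply: cvgB; last exact: cvg_cst.
  by apply: weighted_energy_cvg; apply: iter_step_cvg; exact: linking_start_cvg.
- have bx : 0 <= x None <= tau by exact: xb None.
  have sp m : 0 < m -> linking_start x m = x None *: pe m by rewrite /linking_start ltNge => /negbTE ->.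
  have st := linking_start_neg_le x; have hB' := hB sp bx st.
  case: i => [i|]; split=> /= xi; rewrite /linking_map iter_step_fix; try (apply: hB').
  + rewrite coord_linking_start xi mulrN oppr_le0 mulr_ge0 // ltW //; exact: radial_factor_gt0.
  + apply: Or33; apply: linking_start_neg_eq; have := coord_cube_norm x i.
    by rewrite xi normrN gtr0_norm.
  + rewrite coord_linking_start xi mulr_ge0 // ltW //; exact: radial_factor_gt0.
  + apply: Or33; apply: linking_start_neg_eq; have := coord_cube_norm x i.
    by rewrite xi gtr0_norm.
  + by rewrite linking_start_pos xi expr0n mul0r sub0r oppr_le0 sqr_ge0.
  + exact: Or31.
  + by rewrite linking_start_pos xi subr_ge0.
  + exact: Or32.
exists (linking_start u); split; first exact: linking_start_neg_le.
have bu : 0 <= u None <= tau by exact: ub None.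
split.
  by rewrite linking_start_pos ler_wpM2r ?weighted_energy_ge0 // lerXn2r ?nnegrE //; case/andP: bu => // /le_trans h /h.
apply: hA => [m mN m0|]; last by apply/eqP; rewrite -subr_eq0; exact/eqP/(u0 None).
have iN : (absz m < N.+1)%N by [].
have mE : - (Ordinal iN : nat)%:Z = m by rewrite /=; lia.
rewrite [LHS]surjective_pairing; congr (_, _); apply/rowP => j; rewrite mxE.
  by have := u0 (Some (Ordinal iN, j, false)); rewrite /= /coord /= -/(absz m)%:Z mE.
by have := u0 (Some (Ordinal iN, j, true)); rewrite /= /coord /= mE.
Qed.

(** The action on the starting set is bounded independently of the number k of
    steps, so k can be chosen large enough for [iter_step_small]. *)
Lemma galerkin_critical (e : R) : 0 < e -> exists c, beta <= trunc_action c /\ trunc_grad_sq c <= e.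
Proof.
move=> e0; pose M := action_lip (K := K) * (tau ^+ 2 + tau ^+ 2 * weighted_energy pos_mode N pe).
have p0 : 0 < pi * eta * e by rewrite !mulr_gt0 ?pi_gt0 ?eta_gt0.
pose k := Num.bound `|(M - beta) / (pi * eta * e)|.
have [c [c1 [c2 Lk]]] := linking_point k.
apply: (@iter_step_small k c M e Lk _ e0).
  apply: le_trans (trunc_action_le c) _; rewrite ler_wpM2l ?(ltW (action_lip_gt0 hH)) // weighted_energy_split.
  exact: lerD.
by rewrite -ltr_pdivrMr //; exact: le_lt_trans (ler_norm _) (archi_boundP (normr_ge0 _)).
Qed.

End Galerkin.

(** * The spaces E^+, E^- and the boundary of Sigma *)

Section Eigenspaces.
Context {R : realType} {n : nat}.
Implicit Types (g h : loop R n) (c : int -> cspace R n) (m : int).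

Lemma trig0 m : trig m (0 : cspace R n) = 0.
Proof. by apply/funext => t; rewrite trig_cosE -(scale0r (0 : cspace R n)) JmulZ !scale0r !scaler0 addr0. Qed.

Lemma C1_trig m (b : cspace R n) : C1loop (trig m b).
Proof. by have [N [c ->]] := is_tpoly_trig m b; exact: C1_tpoly. Qed.

Lemma eigenloop_trig m (b : cspace R n) : eigenloop m%:~R (trig m b).
Proof.
split=> [|t]; first exact: C1_trig.
have [_ E] := is_derive_trig m b t.
rewrite derive1E E JmulZ !trig_cosE JmulD !JmulZ JmulJ -scalerN; congr (_ *: _).
by rewrite JmulN !scalerN -opprD opprK.
Qed.

(** -J d/dt multiplies the coefficient of frequency m by m. *)
Lemma fcoef_eigenloop (l : R) g m : eigenloop l g -> m%:~R != l -> fcoef g m = 0.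
Proof.
move=> [c1g eg] ml; have := fcoef_Jderive m c1g.
have -> : Jderive g = l *: g by apply/funext => t; exact: eg.
rewrite fcoefZ; last exact: sob_sqi (sob_C1 c1g).
move=> /eqP; rewrite -subr_eq0 -scalerBl => /eqP E.
apply: enorm_eq0; have : enorm ((l - m%:~R) *: fcoef g m) = 0 by rewrite E enorm0.
by rewrite enormZ => /eqP; rewrite mulf_eq0 normr_eq0 subr_eq0 eq_sym (negbTE ml) => /eqP.
Qed.

Lemma sob_sum (I : Type) (r : seq I) (F : I -> loop R n) :
  (forall i, sob_half (F i)) -> sob_half (\sum_(i <- r) F i).
Proof.
move=> sF; elim: r => [|i r IH]; last by rewrite big_cons; exact: (sobD (sF i) IH).
by rewrite big_nil; exact: sob0.
Qed.

Lemma fcoef_closed_span (P : set (loop R n)) g m : (forall h, P h -> sob_half h /\ fcoef h m = 0) ->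
  closed_span P g -> fcoef g m = 0.
Proof.
move=> P0 [sg gP]; apply: enorm_eq0; apply/eqP; rewrite eq_le enorm_ge0 andbT.
apply/ler_addgt0Pr => e e0; rewrite add0r.
have [k [a [b [Pb /ltW gb]]]] := gP e e0.
have sb i : sob_half (a i *: b i) by have [sbi _] := P0 _ (Pb i); exact: sobZ sbi.
have ss := sob_sum (index_enum 'I_k) sb.
apply: le_trans gb; apply: le_trans (enorm_fcoef_le m (sob_fin (sobB sg ss))).
rewrite fcoefB; [|exact: sob_sqi sg|exact: sob_sqi ss].
rewrite fcoef_sum; last by move=> i; exact: sob_sqi (sb i).
rewrite [X in _ - X]big1 ?subr0 // => i _; have [sbi b0] := P0 _ (Pb i).
by rewrite fcoefZ ?b0 ?scaler0 //; exact: sob_sqi sbi.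
Qed.

Lemma fcoef_Eplus g m : Eplus g -> m <= 0 -> fcoef g m = 0.
Proof.
move=> gE m0; apply: fcoef_closed_span gE => h [l l0 hl]; split; first exact: sob_C1 hl.1.
apply: fcoef_eigenloop hl _; rewrite lt_eqF // (le_lt_trans _ l0) //.
by rewrite -[0]/(0%:~R) ler_int.
Qed.

Lemma fcoef_Eminus g m : Eminus g -> 0 < m -> fcoef g m = 0.
Proof.
move=> gE m0; apply: fcoef_closed_span gE => h [l l0 hl]; split; first exact: sob_C1 hl.1.
apply: fcoef_eigenloop hl _; rewrite gt_eqF // (le_lt_trans l0) //.
by rewrite -[0]/(0%:~R) ltr_int.
Qed.

Lemma closed_span_tpoly (P : set (loop R n)) N c : P 0 ->
  (forall m, (`|m| <= N)%N -> c m <> 0 -> P (trig m (c m))) -> closed_span P (tpoly N c).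
Proof.
move=> P0 Pc; split=> [|e e0]; first exact: sob_tpoly.
exists N.*2.+1, (fun=> 1), (fun i => trig (i%:Z - N%:Z) (c (i%:Z - N%:Z))); split.
  move=> i; have [c0|c0] := pselect (c (i%:Z - N%:Z) = 0); first by rewrite c0 trig0.
  by apply: Pc => //; have := ltn_ord i; lia.
rewrite (_ : \sum_(i < _) _ = tpoly N c) ?subrr ?lnorm0 //.
rewrite /tpoly /modes big_map -[in RHS]/(index_iota 0 N.*2.+1) big_mkord.
by apply: eq_bigr => i _; rewrite scale1r.
Qed.

Lemma Eminus_tpoly N c : (forall m, (`|m| <= N)%N -> 0 < m -> c m = 0) -> Eminus (tpoly N c).
Proof.
move=> c0; apply: closed_span_tpoly => [|m mN cm].
  by exists 0 => //; rewrite -(trig0 0); exact: eigenloop_trig.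
exists m%:~R; last exact: eigenloop_trig.
by rewrite -[0]/(0%:~R) ler_int leNgt; apply/negP => /(c0 m mN).
Qed.

Lemma Eplus_tpoly N c : (forall m, (`|m| <= N)%N -> m <= 0 -> c m = 0) -> Eplus (tpoly N c).
Proof.
move=> c0; apply: closed_span_tpoly => [|m mN cm].
  by exists 1%:~R => //; rewrite -(trig0 1); exact: eigenloop_trig.
exists m%:~R; last exact: eigenloop_trig.
by rewrite -[0]/(0%:~R) ltr_int ltNge; apply/negP => /(c0 m mN).
Qed.

Lemma sob_Eplus g : Eplus g -> sob_half g. Proof. by case. Qed.

Section Boundary.
Context (ep : loop R n) (ep_plus : Eplus ep) (ep_unit : lnorm ep = 1).
Context (tau : R) (tau_gt0 : 0 < tau).

Lemma ep_coef : exists2 m, 0 < m & fcoef ep m <> 0.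
Proof.
apply: contrapT => nex.
have [N|_] := @lnorm_finiteP R n ep 0; last by rewrite ep_unit expr1n ler10.
rewrite /sob_partial big1 // => m _; have [m0|m0] := leP m 0.
  by rewrite (fcoef_Eplus ep_plus m0) enorm0 expr0n mulr0.
have -> : fcoef ep m = 0 by apply: contrapT => h; apply: nex; exists m.
by rewrite enorm0 expr0n mulr0.
Qed.

(** The decomposition of a loop in E^- + R e^+ is unique, because e^+ has a
    nonzero coefficient of positive frequency. *)
Lemma line_inj gm gm' (s s' : R) : Eminus gm -> Eminus gm' -> gm + s *: ep = gm' + s' *: ep -> s = s' /\ gm = gm'.
Proof.
move=> g1 g2 E; have [m m0 em] := ep_coef; have sep := sob_Eplus ep_plus.
suff ss : s = s' by split=> //; move: E; rewrite ss => /addIr.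
have := congr1 (fun g => fcoef g m) E; rewrite /= (fcoefD _ (sob_sqi g1.1) (sob_sqi (sobZ s sep))) (fcoefD _ (sob_sqi g2.1) (sob_sqi (sobZ s' sep))) !(fcoefZ _ _ (sob_sqi sep)).
rewrite (fcoef_Eminus g1 m0) (fcoef_Eminus g2 m0) !add0r => /eqP; rewrite -subr_eq0 -scalerBl => /eqP E2.
have : enorm ((s - s') *: fcoef ep m) = 0 by rewrite E2 enorm0.
rewrite enormZ => /eqP; rewrite mulf_eq0 normr_eq0 subr_eq0 => /orP[/eqP //|/eqP e0].
by case: em; exact: enorm_eq0.
Qed.

(** A small change of s, or a small dilation of the E^- part, leads out of
    Sigma within E^- + R e^+; that it does so rests on the uniqueness of the
    decomposition. *)
Lemma boundary_mem N c (s : R) : (forall m, 0 < m -> c m = 0) -> 0 <= s <= tau ->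
  lnorm (tpoly N c) <= tau -> [\/ s = 0, s = tau | lnorm (tpoly N c) = tau] ->
  rel_boundary (Eminus_line ep) (Sigma ep tau) (tpoly N c + s *: ep).
Proof.
move=> c0 s0t ct bd; have sep := sob_Eplus ep_plus; have st := @sob_tpoly R n N c.
have Ec : Eminus (tpoly N c) by apply: Eminus_tpoly => m _; exact: c0.
have lin gm (s' : R) : Eminus gm -> Eminus_line ep (gm + s' *: ep) by exists gm, s'.
split=> [|e e0]; first exact: lin.
split; first by exists (tpoly N c + s *: ep); [split; [exact: lin|exists (tpoly N c), s]|rewrite subrr lnorm0].
have e20 : 0 < e / 2 by rewrite divr_gt0.
have e2 : e / 2 < e by rewrite ltr_pdivrMr // mulr_natr mulr2n ltrDl.
have far (s' : R) : ~~ (0 <= s' <= tau) -> `|s' - s| = e / 2 ->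
  exists2 h, (Eminus_line ep `\` Sigma ep tau) h & lnorm (h - (tpoly N c + s *: ep)) < e.
  move=> ns ss; exists (tpoly N c + s' *: ep).
    split; first exact: lin.
    by move=> [gm [r [Eg _ rt E]]]; have [sr _] := line_inj Ec Eg E; move: ns; rewrite sr rt.
  by rewrite opprD addrACA subrr add0r -scalerBl (lnormZ _ sep) ep_unit mulr1 ss.
case: bd => bd.
- apply: (far (- (e / 2))); last by rewrite bd subr0 normrN gtr0_norm.
  by rewrite oppr_ge0 leNgt e20.
- apply: (far (tau + e / 2)); last by rewrite bd addrAC subrr add0r gtr0_norm.
  by rewrite negb_and -!ltNge orbC ltrDl e20.
- pose d := e / 2 / tau; have d0 : 0 < d by rewrite divr_gt0.
  exists ((1 + d) *: tpoly N c + s *: ep).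
    have Ed : Eminus ((1 + d) *: tpoly N c).
      by rewrite tpolyZ; apply: Eminus_tpoly => m _ /c0 ->; rewrite scaler0.
    split; first exact: lin.
    move=> [gm [r [Eg gt _ E]]]; have [_ gE] := line_inj Ed Eg E.
    move: gt; rewrite -gE (lnormZ _ st) bd gtr0_norm ?addr_gt0 // leNgt.
    by rewrite ltr_pMl // ltrDl d0.
  rewrite opprD addrACA subrr addr0 scalerDl scale1r addrAC subrr add0r (lnormZ _ st) bd gtr0_norm //.
  by rewrite /d divfK ?gt_eqF.
Qed.

End Boundary.
End Eigenspaces.

(** * Almost critical trigonometric polynomials *)

Lemma le_half_of_close (R : realFieldType) (p q a b c : R) :
  q <= p / 2 -> p <= c -> a - b <= q -> b <= 0 -> a <= c / 2.
Proof. by move=> *; lra. Qed.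

Lemma le_of_close (R : realFieldType) (x y z d : R) : d <= 1 - z -> y < d -> 1 <= x + y -> z <= x.
Proof. by move=> *; lra. Qed.

Section Approximation.
Context {R : realType} {n : nat}.
Context {H : cspace R n -> R} {dH : cspace R n -> cspace R n} {kap K Cp rho : R}.
Context (hH : hamiltonian H dH kap K Cp rho).
Context (ep : loop R n) (ep_plus : Eplus ep) (ep_unit : lnorm ep = 1).
Context (tau alpha beta : R) (alpha_gt0 : 0 < alpha) (alpha_tau : alpha < tau) (beta_gt0 : 0 < beta).
Context (action_bd : forall g,
     rel_boundary (Eminus_line ep) (Sigma ep tau) g -> action H g <= 0).
Context (action_Gamma : forall g, Gamma alpha g -> beta <= action H g).

Lemma lnorm_eq_sqrt (g : loop R n) (x : R) : 0 <= x -> lnorm g ^+ 2 = x ^+ 2 -> lnorm g = x.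
Proof.
move=> x0 /eqP; rewrite eqf_sqr => /orP[/eqP //|/eqP gx].
by have := lnorm_ge0 g; rewrite gx oppr_ge0 => x0'; apply/eqP; rewrite eq_sym -eqr_oppLR eq_le; lra.
Qed.

(** For N large the truncation of e^+ is so close to e^+ that the action on the
    boundary of the truncated Sigma exceeds its value on the boundary of Sigma,
    at most 0, by at most beta / 2, and that tau times the truncation still has
    norm at least alpha. *)
Lemma galerkin_sequence : exists N0, forall N, (N0 <= N)%N -> forall e, 0 < e ->
  exists c, beta <= action H (tpoly N c) /\ trunc_grad_sq (dH := dH) N c <= e.
Proof.
have tau_gt0 := lt_trans alpha_gt0 alpha_tau.
have sep := sob_Eplus ep_plus; pose pe := fcoef ep.
have pe0 m : m <= 0 -> pe m = 0 by exact: fcoef_Eplus ep_plus.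
pose C := action_lip (K := K); have C0 : 0 < C := action_lip_gt0 hH.
(* The first bound on the error serves to reach Gamma at s = tau, the second
   one keeps the action below beta / 2. *)
pose d := Num.min (1 - alpha / tau) (beta / (6 * C * tau ^+ 2)).
have CT : 0 < 6 * C * tau ^+ 2 by apply: mulr_gt0; [exact: mulr_gt0|exact: exprn_gt0].
have d0 : 0 < d by rewrite lt_min divr_gt0 // andbT subr_gt0 ltr_pdivrMr // mul1r.
have d1 : d <= 1 - alpha / tau by rewrite ge_min lexx.
have d2 : d <= beta / (6 * C * tau ^+ 2) by rewrite ge_min lexx orbT.
have at0 : 0 < alpha / tau by rewrite divr_gt0.
have [N0 HN] := lnorm_fpart_cvg sep d0; exists N0 => N /HN epN e e0.
have sP := @sob_tpoly R n N pe.
pose r := tpoly N pe - ep; have sr : sob_half r := sobB sP sep.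
have rd : lnorm r <= d by rewrite /r (lnorm_distC sP sep) ltW.
have r0 := lnorm_ge0 r.
apply: (galerkin_critical hH beta_gt0 (pe := pe) tau_gt0 alpha_gt0 _ _ _ e0).
- move=> c c0 ca; apply: action_Gamma; split; first exact: Eplus_tpoly.
  apply: lnorm_eq_sqrt; first exact: ltW.
  rewrite lnorm_tpoly weighted_energy_split -ca -[RHS]add0r; congr (_ + _).
  rewrite /weighted_energy big1_seq // => m /andP[m0]; rewrite mem_modes => mN.
  by rewrite (c0 m mN m0) enorm0 expr0n mulr0.
(* c is a point of the boundary of Sigma plus s times the error r of the
   truncation. *)
- move=> c s cpe s0t cneg bd; pose cm m := if m <= 0 then c m else 0.
  have sc := @sob_tpoly R n N cm.
  have lcm : lnorm (tpoly N cm) ^+ 2 = weighted_energy nonpos_mode N c.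
    rewrite lnorm_tpoly weighted_energy_split [X in _ + X](_ : _ = 0) ?addr0.
      by apply: weighted_energy_eq => m _; rewrite /nonpos_mode /cm => ->.
    by apply: big1 => m m0; rewrite /cm leNgt m0 enorm0 expr0n mulr0.
  have cmt : lnorm (tpoly N cm) <= tau.
    by rewrite -(@ler_pXn2r _ 2%N) ?nnegrE ?lnorm_ge0 ?(ltW tau_gt0) // lcm.
  have B : action H (tpoly N cm + s *: ep) <= 0.
    apply: action_bd; apply: (boundary_mem ep_plus ep_unit tau_gt0) => //.
      by move=> m m0; rewrite /cm leNgt m0.
    case: bd => [s0|st|cn]; [exact: Or31|exact: Or32|apply: Or33].
    by apply: lnorm_eq_sqrt; [exact: ltW|rewrite lcm].
  have E : tpoly N c = (tpoly N cm + s *: ep) + s *: r.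
    rewrite -addrA -scalerDr /r addrC [ep + _]addrC subrK tpolyZ tpolyD; apply: eq_bigr => m _.
    rewrite /cm; case: leP => m0; first by rewrite pe0 // scaler0 add0r.
    by rewrite addr0 cpe.
  have sse := sobZ s sep; have ssr := sobZ s sr; have sg := sobD sc sse.
  have := action_dist hH sg ssr; rewrite -E; move: B.
  have [s0 st] := andP s0t.
  have l1 : lnorm (s *: r) <= tau * d.
    rewrite (lnormZ _ sr) ger0_norm //; exact: ler_pM.
  have l2 : lnorm (tpoly N cm + s *: ep) <= tau + tau.
    have l3 : lnorm (s *: ep) <= tau by rewrite (lnormZ _ sep) ep_unit mulr1 ger0_norm.
    exact: le_trans (lnormD sc sse) (lerD cmt l3).
  have := lnorm_ge0 (s *: r); have := lnorm_ge0 (tpoly N cm + s *: ep).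
  rewrite -/(trunc_action _ _); move: l1 l2.
  rewrite /trunc_action; move: (lnorm (s *: r)) (lnorm (tpoly N cm + s *: ep)) (action _ _) (action _ _) => x y a b xd yt y0 x0 b0.
  rewrite ler_norml => /andP[_ ab].
  have xt : x <= tau.
    apply: le_trans xd _; rewrite ger_pMr //; apply: le_trans d1 _; rewrite gerBl; exact: ltW.
  have m1 : C * ((y + x) * x) <= C * ((tau + tau + tau) * (tau * d)).
    rewrite ler_pM2l //; apply: ler_pM => //; [exact: addr_ge0|exact: lerD].
  have m2 : d * (6 * C * tau ^+ 2) <= beta by rewrite -ler_pdivlMr.
  have e1 : C * ((tau + tau + tau) * (tau * d)) = d * (6 * C * tau ^+ 2) / 2 by field.
  rewrite e1 in m1; move: m1 m2 ab b0; rewrite -/C.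
  exact: le_half_of_close.
- have -> : weighted_energy pos_mode N pe = lnorm (tpoly N pe) ^+ 2.
    rewrite lnorm_tpoly weighted_energy_split [X in X + _](_ : _ = 0) ?add0r //.
    by apply: big1 => m m0; rewrite pe0 // enorm0 expr0n mulr0.
  rewrite -exprMn lerXn2r ?nnegrE ?mulr_ge0 ?lnorm_ge0 ?(ltW alpha_gt0) ?(ltW tau_gt0) //.
  suff : alpha / tau <= lnorm (tpoly N pe) by rewrite (ler_pdivrMr _ _ tau_gt0) mulrC.
  apply: le_of_close d1 epN _; rewrite -ep_unit -{1}(subrK (tpoly N pe) ep) addrC.
  exact: lnormD sP (sobB sep sP).
Qed.

End Approximation.

(** * A priori bounds *)

Section Weights.
Context {R : realType} {n : nat}.
Implicit Types (c d : int -> cspace R n) (m : int).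

(** The weight of the first derivative, stronger than that of L^2_{1/2}: a
    bound of the sum of its squares gives uniform convergence and strong
    compactness. *)
Definition grad_weight m : R := 1 + `|m%:~R|.

Lemma grad_weight_ge1 m : 1 <= grad_weight m. Proof. by rewrite /grad_weight lerDl. Qed.
Lemma grad_weight_gt0 m : 0 < grad_weight m. Proof. exact: lt_le_trans (grad_weight_ge1 m). Qed.

Lemma grad_weight_nat m : grad_weight m = (absz m).+1%:R.
Proof. by rewrite /grad_weight -intr_norm -natr1 addrC. Qed.

Lemma sob_weight_le m : sob_weight m <= grad_weight m ^+ 2 :> R.
Proof.
have d1 := grad_weight_ge1 m; apply: (@le_trans _ _ (grad_weight m)); last by rewrite expr2 ler_peMl // (le_trans ler01).
rewrite /sob_weight /grad_weight addrC lerD2r; by case: eqP.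
Qed.

Definition grad_energy N c : R := \sum_(m <- modes N) (grad_weight m * enorm (c m)) ^+ 2.

Lemma sum_modesS (V : nmodType) N (F : int -> V) (P : pred int) : P (N.+1%:Z) -> P (- N.+1%:Z) ->
  \sum_(m <- modes N.+1 | P m) F m = F N.+1%:Z + (F (- N.+1%:Z) + \sum_(m <- modes N | P m) F m).
Proof.
have E (m : int) : (m \in modes N.+1) = (m \in N.+1%:Z :: - N.+1%:Z :: modes N).
  by rewrite mem_modes 2!in_cons mem_modes; lia.
move=> P1 P2; rewrite (perm_big (N.+1%:Z :: - N.+1%:Z :: modes N)) /=; first by rewrite !big_cons P1 P2.
apply: uniq_perm; first exact: uniq_modes.
  apply/and3P; split; [by rewrite inE mem_modes; lia|by rewrite mem_modes; lia|exact: uniq_modes].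
exact: E.
Qed.

(** Comparison with a telescoping sum: 2 / (N + 2)^2 <= 2 / (N + 1) - 2 / (N +
    2). *)
Lemma inv_tail N M : \sum_(m <- modes N | (M < `|m|)%N) (grad_weight m)^-1 ^+ 2 <= 2 / M.+1%:R.
Proof.
have M0 : 0 < M.+1%:R :> R by rewrite ltr0n.
have [NM|/ltnW MN] := leqP N M.
  rewrite big1_seq ?divr_ge0 // => m /andP[Mm]; rewrite mem_modes => mN; lia.
suff : \sum_(m <- modes N | (M < `|m|)%N) (grad_weight m)^-1 ^+ 2 <= 2 / M.+1%:R - 2 / N.+1%:R.
  by move/le_trans; apply; rewrite gerBl divr_ge0.
elim: N MN => [|N IH]; rewrite leq_eqVlt => /orP[/eqP MN|MN] //.
- by rewrite -MN subrr big1_seq // => m /andP[Mm]; rewrite mem_modes => mN; lia.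
- by rewrite -MN subrr big1_seq // => m /andP[Mm]; rewrite mem_modes => mN; lia.
rewrite sum_modesS ?abszN // addrA.
apply: (@le_trans _ _ ((grad_weight N.+1%:Z)^-1 ^+ 2 + (grad_weight (- N.+1%:Z))^-1 ^+ 2 + (2 / M.+1%:R - 2 / N.+1%:R))).
  by rewrite lerD2l IH.
rewrite !grad_weight_nat abszN /= -[N.+2%:R]natr1.
have : 0 < N.+1%:R :> R by rewrite ltr0n.
move: (N.+1%:R : R) (2 / M.+1%:R) => x y x0.
rewrite -subr_ge0 (_ : _ - _ = 2 / (x * (x + 1) ^+ 2)).
  by rewrite divr_ge0 // mulr_ge0 ?sqr_ge0 // ltW.
by field; rewrite !gt_eqF // addr_gt0.
Qed.

Lemma inv_sum N : \sum_(m <- modes N) (grad_weight m)^-1 ^+ 2 <= 3.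
Proof.
rewrite (bigID (fun m : int => (0 < `|m|)%N)) /=.
have T := inv_tail N 0; rewrite divr1 in T.
suff : \sum_(m <- modes N | ~~ (0 < `|m|)%N) (grad_weight m)^-1 ^+ 2 <= 1.
  by move: T; move: (\sum_(m <- modes N | _) _) (\sum_(m <- modes N | _) _) => *; lra.
rewrite big_mkcond (@sum_modes_single _ _ _ 0) /=.
  by rewrite /grad_weight normr0 addr0 invr1 expr1n.
by move=> k k0; rewrite absz_gt0 k0.
Qed.

Lemma inv_sum_part N (P : pred int) : \sum_(m <- modes N | P m) (grad_weight m)^-1 ^+ 2 <= 3.
Proof.
apply: le_trans (inv_sum N); rewrite big_mkcond /=; apply: ler_sum => m _.
by case: ifP => // _; exact: sqr_ge0.
Qed.

(** A Sobolev inequality, by Cauchy-Schwarz with the weights 1 + |m|. *)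
Lemma sup_part N (P : pred int) c t :
  enorm ((\sum_(m <- modes N | P m) trig m (c m)) t) ^+ 2 <=
  (\sum_(m <- modes N | P m) (grad_weight m)^-1 ^+ 2) * (\sum_(m <- modes N | P m) (grad_weight m * enorm (c m)) ^+ 2).
Proof.
rewrite sum_loopE.
have := @weighted_CS R int [seq m <- modes N | P m] (fun=> 1) (fun m => (grad_weight m)^-1) (fun m => grad_weight m * enorm (c m)) (fun=> ler01).
under [X in X ^+ 2 <= _]eq_bigr => m _ do rewrite mul1r mulKf ?gt_eqF ?grad_weight_gt0 //.
under [X in _ <= X * _]eq_bigr => m _ do rewrite mul1r.
under [X in _ <= _ * X]eq_bigr => m _ do rewrite mul1r.
rewrite !big_filter; apply: le_trans; rewrite lerXn2r ?nnegrE ?enorm_ge0 //.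
  by apply: sumr_ge0 => m _; exact: enorm_ge0.
apply: le_trans (enorm_sum _ _ _) _; apply: ler_sum => m _.
by rewrite /trig enorm_cis.
Qed.

Lemma enorm_sqrD_le (z w : cspace R n) : enorm (z + w) ^+ 2 <= 2 * enorm z ^+ 2 + 2 * enorm w ^+ 2.
Proof.
apply: (@le_trans _ _ ((enorm z + enorm w) ^+ 2)).
  by rewrite lerXn2r ?nnegrE ?addr_ge0 ?enorm_ge0 // enormD.
by move: (enorm z) (enorm w) => x y; have := sqr_ge0 (x - y); nra.
Qed.

End Weights.

Section CoefBound.
Context {R : realType} {n : nat}.
Context {H : cspace R n -> R} {dH : cspace R n -> cspace R n} {kap K Cp rho : R}.
Context (hH : hamiltonian H dH kap K Cp rho).
Implicit Types (c : int -> cspace R n) (m : int).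

(** The integer nearest to kap is the only one at distance less than 1/2, and
    its coefficient is the only one that a small gradient does not control. *)
Lemma nearest_int : exists m0 : int, forall m, m != m0 -> 2^-1 <= `|m%:~R - kap|.
Proof.
exists (Num.floor (kap + 2^-1)) => m; rewrite neq_lt => /orP[] mm.
  have := floor_le (kap + 2^-1); have : (m + 1)%:~R <= (Num.floor (kap + 2^-1))%:~R :> R by rewrite ler_int; lia.
  rewrite intrD; move: (m%:~R : R) (_%:~R : R) => x y h1 h2.
  by rewrite ler0_norm; lra.
have := floorD1_gt (kap + 2^-1); have : (Num.floor (kap + 2^-1) + 1)%:~R <= m%:~R :> R by rewrite ler_int; lia.
move: (m%:~R : R) (_%:~R : R) => x y h1 h2.
by rewrite ger0_norm; lra.
Qed.

Definition perturbation g : loop R n := fun t => dH (g t) - kap *: g t.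

Lemma perturbationE g : perturbation g = grad_along (dH := dH) g - kap *: g.
Proof. by []. Qed.

Lemma sqi_perturbation g : square_integrable g -> square_integrable (perturbation g).
Proof. by move=> sg; rewrite perturbationE; apply: sqiB; [exact: (sqi_grad_along hH)|exact: sqiZ]. Qed.

Lemma l2dot_perturbation g : square_integrable g -> l2dot (perturbation g) (perturbation g) <= Cp ^+ 2 * (2 * pi).
Proof.
move=> sg; rewrite l2dot_enorm2 -circle_int_cst; apply: circle_int_le; [exact: circle_integrable_enorm2 (sqi_perturbation sg)|exact: circle_integrable_cst|].
by move=> t _; rewrite lerXn2r ?nnegrE ?enorm_ge0 ?(ham_Cp hH) //; exact: ham_bd hH (g t).
Qed.

Lemma fourier_energy_perturbation N g : square_integrable g -> fourier_energy N (perturbation g) <= Cp ^+ 2.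
Proof.
move=> sg; have := le_trans (bessel N (sqi_perturbation sg)) (l2dot_perturbation sg).
by rewrite mulrC ler_pM2r ?pi2_gt0.
Qed.

Lemma trunc_grad_perturbation N c m : (`|m| <= N)%N ->
  (m%:~R - kap) *: c m = trunc_grad (dH := dH) N c m + fcoef (perturbation (tpoly N c)) m.
Proof.
move=> mN; have st := @sqi_tpoly R n N c; have sd := sqi_grad_along hH st.
rewrite perturbationE (fcoefB _ sd (sqiZ kap st)) (fcoefZ _ _ st) fcoef_tpoly mN /trunc_grad.
by rewrite addrA subrK scalerBl.
Qed.

Lemma shifted_sum N c : trunc_grad_sq (dH := dH) N c <= 1 ->
  \sum_(m <- modes N) enorm ((m%:~R - kap) *: c m) ^+ 2 <= 2 + 2 * Cp ^+ 2.
Proof.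
move=> g1; have p1 := fourier_energy_perturbation N (@sqi_tpoly R n N c).
apply: (@le_trans _ _ (2 * trunc_grad_sq (dH := dH) N c + 2 * fourier_energy N (perturbation (tpoly N c)))).
  rewrite !mulr_sumr -big_split /=; apply: sum_modes_le => m mN.
  by rewrite (trunc_grad_perturbation c mN) enorm_sqrD_le.
by move: g1 p1; move: (trunc_grad_sq _ _) (fourier_energy _ _) (Cp ^+ 2) => *; lra.
Qed.

(** Along a loop that stays in the region where H is quadratic, the gradient
    and the action are those of the linear problem. *)
Lemma action_far N c : (forall t, rho <= enorm (tpoly N c t)) ->
  action H (tpoly N c) = pi * \sum_(m <- modes N) (m%:~R - kap) * enorm (c m) ^+ 2 /\
  forall m, (`|m| <= N)%N -> trunc_grad (dH := dH) N c m = (m%:~R - kap) *: c m.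
Proof.
move=> far; have st := @sqi_tpoly R n N c; split; last first.
  move=> m mN; rewrite /trunc_grad; have -> : grad_along (dH := dH) (tpoly N c) = kap *: tpoly N c.
    by apply/funext => t; have [_] := ham_inf hH (far t).
  by rewrite (fcoefZ _ _ st) fcoef_tpoly mN scalerBl.
rewrite (actionE (sob_tpoly _ _)) action_form_tpoly.
have -> : ham_int (H := H) (tpoly N c) = kap / 2 * l2dot (tpoly N c) (tpoly N c).
  rewrite l2dot_enorm2 -circle_intZ; last exact: circle_integrable_enorm2.
  by apply: circle_int_eq => t _; have [] := ham_inf hH (far t).
rewrite l2dot_tpoly2.
have -> : \sum_(m <- modes N) (m%:~R - kap) * enorm (c m) ^+ 2 =
  \sum_(m <- modes N) m%:~R * enorm (c m) ^+ 2 - kap * \sum_(m <- modes N) enorm (c m) ^+ 2.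
  by rewrite mulr_sumr -sumrB; apply: eq_bigr => m _; rewrite mulrBl.
move: (\sum_(m <- modes N) _) (\sum_(m <- modes N) _) (pi : R) => x y p.
by field.
Qed.

(** The gradient and the perturbation control (m - kap) c_m, hence the first
    derivative of the part of the loop without the frequency m0 nearest to kap,
    hence its maximum. If |c_m0| exceeds this maximum by rho, the loop stays in
    the region where H is quadratic, where the action is pi sum (m - kap)
    |c_m|^2 <= pi D sum (m - kap)^2 |c_m|^2 = pi D |G|^2; the terms with m =
    kap vanish on both sides. This contradicts the lower bound beta when the
    gradient is small. *)
Lemma coef_bound (beta : R) : 0 < beta -> exists N1 e0 C2, 0 < e0 /\
  forall N c, (N1 <= N)%N -> beta <= action H (tpoly N c) -> trunc_grad_sq (dH := dH) N c <= e0 ->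
  grad_energy N c <= C2.
Proof.
move=> beta0; have [m0 Hm0] := nearest_int.
(* If m0 = kap, the inverse is 0 and the inequality HD for m0 reads 0 <= 0. *)
pose D : R := 2 + `|m0%:~R - kap|^-1.
have D0 : 0 < D by rewrite ltr_wpDr // invr_ge0.
have HD m : m%:~R - kap <= D * (m%:~R - kap) ^+ 2.
  have [->|/Hm0] := eqVneq m m0.
    rewrite /D; move: (m0%:~R - kap) => x; have [->|x0] := eqVneq x 0; first by rewrite expr0n mulr0.
    apply: le_trans (ler_norm _) _; rewrite mulrDl -[x ^+ 2]real_normK ?num_real //.
    rewrite [X in _ <= _ + X](_ : _ = `|x|) ?lerDr ?mulr_ge0 ?sqr_ge0 //.
    by rewrite expr2 mulrA mulVf ?mul1r // normr_eq0.
  move: (m%:~R - kap) => x x2; apply: le_trans (ler_norm _) _; rewrite -[x ^+ 2]real_normK ?num_real //.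
  rewrite /D; have : 0 <= `|m0%:~R - kap|^-1 by rewrite invr_ge0.
  move: (`|x|) (`|m0%:~R - kap|^-1) x2 => y z y2 z0.
  have : 0 <= (y - 2^-1) * y by rewrite mulr_ge0; lra.
  have : 0 <= z * y ^+ 2 by rewrite mulr_ge0 ?sqr_ge0.
  by nra.
(* 1 + |m| <= 1 + |kap| + |m - kap|, and 1 <= 2 |m - kap| for m <> m0. *)
pose A : R := 3 + 2 * `|kap|; have A0 : 0 < A by rewrite ltr_wpDr // mulr_ge0.
have HA m : m != m0 -> grad_weight m <= A * `|m%:~R - kap|.
  move=> /Hm0 h; have : `|m%:~R| <= `|m%:~R - kap| + `|kap| by rewrite -{1}(subrK kap m%:~R) ler_normD.
  rewrite /grad_weight /A; have := normr_ge0 kap; move: h; move: (`|m%:~R - kap|) (`|kap|) (`|m%:~R|) => x y z *; nra.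
pose B1 : R := A ^+ 2 * (2 + 2 * Cp ^+ 2).
have B10 : 0 <= B1 by rewrite mulr_ge0 ?sqr_ge0 // addr_ge0 // mulr_ge0 ?sqr_ge0.
(* The part without m0 is at most 3 B1 + 1, since x ^ 2 <= 3 B1 implies x <= 3
   B1 + 1. *)
pose W : R := 3 * B1 + 1 + rho.
pose e0 : R := Num.min 1 (beta / (2 * pi * D)).
have pD : 0 < 2 * pi * D by rewrite mulr_gt0 // pi2_gt0.
exists (absz m0), e0, (B1 + (grad_weight m0 * W) ^+ 2); split.
  by rewrite /e0 lt_min ltr01 divr_gt0.
move=> N c m0N bL ge.
have g1 : trunc_grad_sq (dH := dH) N c <= 1 by apply: le_trans ge _; rewrite ge_min lexx.
have g2 : trunc_grad_sq (dH := dH) N c <= beta / (2 * pi * D).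
  by apply: le_trans ge _; rewrite ge_min lexx orbT.
have S1 : \sum_(m <- modes N | m != m0) (grad_weight m * enorm (c m)) ^+ 2 <= B1.
  apply: (@le_trans _ _ (A ^+ 2 * \sum_(m <- modes N) enorm ((m%:~R - kap) *: c m) ^+ 2)); last first.
    by rewrite ler_wpM2l ?sqr_ge0 // shifted_sum.
  rewrite mulr_sumr big_mkcond /=; apply: ler_sum => m _; case: ifP => [mm|_]; last by rewrite mulr_ge0 ?sqr_ge0.
  rewrite enormZ -exprMn lerXn2r ?nnegrE ?mulr_ge0 ?enorm_ge0 ?(ltW A0) ?(ltW (grad_weight_gt0 _)) //.
  by rewrite mulrA ler_wpM2r ?enorm_ge0 // HA.
have c0W : enorm (c m0) <= W.
  rewrite leNgt; apply/negP => Wc.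
  have far t : rho <= enorm (tpoly N c t).
    have -> : tpoly N c = trig m0 (c m0) + \sum_(m <- modes N | m != m0) trig m (c m).
      by rewrite /tpoly (bigD1_seq m0) ?mem_modes ?uniq_modes.
    have := sup_part N (fun m => m != m0) c t; set w := \sum_(m <- modes N | m != m0) trig m (c m) => Hw.
    have w3 : enorm (w t) ^+ 2 <= 3 * B1.
      apply: le_trans Hw _; apply: ler_pM => //.
      - by apply: sumr_ge0 => m _; exact: sqr_ge0.
      - by apply: sumr_ge0 => m _; exact: sqr_ge0.
      exact: inv_sum_part.
    have w4 : enorm (w t) <= 3 * B1 + 1.
      by move: w3; have := enorm_ge0 (w t); move: (enorm (w t)) (3 * B1) => x y *; nra.
    rewrite loopDE; have := enormB (trig m0 (c m0) t + w t) (w t).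
    rewrite addrK [enorm (trig _ _ _)]enorm_cis; move: Wc w4; rewrite /W.
    by move: (enorm (c m0)) (enorm (w t)) (enorm (_ + _)) (3 * B1) => *; lra.
  have [LE GE] := action_far far.
  suff : action H (tpoly N c) <= beta / 2 by move: bL beta0; move: (action _ _) => *; lra.
  rewrite LE; apply: (@le_trans _ _ (pi * (D * trunc_grad_sq (dH := dH) N c))).
    rewrite ler_pM2l ?pi_gt0 // mulr_sumr; apply: sum_modes_le => m mN.
    rewrite GE // enormZ exprMn real_normK ?num_real // (mulrA D).
    by rewrite ler_wpM2r ?sqr_ge0 // HD.
  move: g2; rewrite ler_pdivlMr //; move: (trunc_grad_sq _ _) (pi : R) => g p; clear.
  by move=> h; rewrite ler_pdivlMr //; apply: le_trans h; rewrite le_eqVlt; apply/orP; left; apply/eqP; ring.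
rewrite /grad_energy (bigID (fun m => m == m0)) /= addrC lerD //.
rewrite big_mkcond (@sum_modes_single _ _ _ m0) ?m0N ?eqxx.
  by rewrite lerXn2r ?nnegrE ?mulr_ge0 ?enorm_ge0 ?(ltW (grad_weight_gt0 _)) ?(le_trans (enorm_ge0 _) c0W) // ler_wpM2l ?(ltW (grad_weight_gt0 _)).
by move=> k /negbTE ->.
Qed.

End CoefBound.

(** * Passage to the limit *)

Section RieszFischer.
Context {R : realType} {n : nat}.

Lemma ultra_lim_vec (T : Type) (U : set_system T) (u : T -> cspace R n) (B : R) : UltraFilter U ->
  (forall t, enorm (u t) <= B) -> exists l, enorm (u t - l) @[t --> U] --> (0 : R).
Proof.
move=> UU uB; have PU := @ultra_proper _ _ UU.
have E1 j : exists l : R, (u t).1 ord0 j @[t --> U] --> l.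
  have [t|l _ ul] := @ultra_lim R T U (fun t => (u t).1 ord0 j) (- B) B UU; last by exists l.
  by rewrite -ler_norml; exact: le_trans (coord1_le _ _) (uB t).
have E2 j : exists l : R, (u t).2 ord0 j @[t --> U] --> l.
  have [t|l _ ul] := @ultra_lim R T U (fun t => (u t).2 ord0 j) (- B) B UU; last by exists l.
  by rewrite -ler_norml; exact: le_trans (coord2_le _ _) (uB t).
have [l1 H1] := choice E1; have [l2 H2] := choice E2.
exists (\row_j l1 j, \row_j l2 j); apply: enorm_cvg0 => j.
  by under eq_fun do rewrite !mxE; exact/subr_cvg0.
by under eq_fun do rewrite !mxE; exact/subr_cvg0.
Qed.

Lemma grad_energy_le_bound (N : nat) (c : int -> cspace R n) (C : R) m : grad_energy N c <= C -> (`|m| <= N)%N ->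
  enorm (c m) <= C + 1.
Proof.
move=> cC mN.
have : (grad_weight m * enorm (c m)) ^+ 2 <= C.
  apply: le_trans cC; apply: (@sum_modes_term R N (fun k => (grad_weight k * enorm (c k)) ^+ 2)) => // k.
  exact: sqr_ge0.
have := ler_peMl (enorm_ge0 (c m)) (grad_weight_ge1 (R := R) m).
move: (grad_weight m * enorm (c m)) (enorm (c m)) => x y yx xC; nra.
Qed.

Context (a : int -> cspace R n) (C : R) (aC : forall M, grad_energy M a <= C).

Let r (M : nat) : R := Num.sqrt (2 * C * M.+1%:R^-1).

Lemma coef_loop_r_cvg : r M @[M --> \oo] --> (0 : R).
Proof.
rewrite -[X in _ --> X]sqrtr0; apply: (@cvg_comp _ _ _ _ _ _ (nbhs (0 : R))); last exact: sqrt_continuous.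
by rewrite -(mulr0 (2 * C)); apply: cvgMr; exact: cvg_harmonic.
Qed.

Lemma coef_loop_cauchy (M M' : nat) t : (M <= M')%N -> enorm (tpoly M' a t - tpoly M a t) <= r M.
Proof.
move=> MM; have -> : tpoly M' a t - tpoly M a t = (\sum_(m <- modes M' | (M < `|m|)%N) trig m (a m)) t.
  rewrite /tpoly (sum_modes_widen _ MM) [X in X t - _](bigID (fun m : int => (`|m| <= M)%N)) /= loopDE addrAC subrr add0r.
  by congr (_ t); apply: eq_bigl => m; rewrite -ltnNge.
rewrite -(ger0_norm (enorm_ge0 _)) -sqrtr_sqr /r ler_wsqrtr //.
apply: le_trans (sup_part _ _ _ _) _; rewrite mulrAC.
apply: ler_pM; [by apply: sumr_ge0 => m _; exact: sqr_ge0|by apply: sumr_ge0 => m _; exact: sqr_ge0|exact: inv_tail|].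
apply: le_trans (aC M'); rewrite /grad_energy big_mkcond /=; apply: ler_sum => m _.
by case: ifP => // _; exact: sqr_ge0.
Qed.

(** The Riesz-Fischer theorem for coefficients square summable with the weights
    1 + |m|: the partial sums are uniformly Cauchy, by [sup_part] and
    [inv_tail], so that a pointwise limit exists and is again a loop with these
    coefficients. The operator [ulim] depends only on the sequence, which makes
    the limit periodic. *)
Lemma loop_of_coef : exists x : loop R n, sob_half x /\ forall m, fcoef x m = a m.
Proof.
have [U [UU oU]] := free_ultrafilter; have PU := @ultra_proper _ _ UU.
pose ulim (v : nat -> cspace R n) : cspace R n := xget 0 [set l | enorm (v M - l) @[M --> U] --> (0 : R)].
pose x : loop R n := fun t => ulim (fun M => tpoly M a t).
have xl t : enorm (tpoly M a t - x t) @[M --> U] --> (0 : R).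
  have [|l ul] := @ultra_lim_vec nat U (fun M => tpoly M a t) (r 0 + enorm (tpoly 0 a t)) UU.
    move=> M; rewrite -{1}(subrK (tpoly 0 a t) (tpoly M a t)) (le_trans (enormD _ _)) // lerD2r.
    exact: coef_loop_cauchy.
  exact: (@xgetPex _ 0 [set l | enorm (tpoly M a t - l) @[M --> U] --> (0 : R)] (ex_intro _ l ul)).
have r0 M : 0 <= r M by exact: sqrtr_ge0.
have xr M t : enorm (x t - tpoly M a t) <= r M.
  apply/ler_addgt0Pr => e e0.
  have /cvgr0Pnorm_lt/(_ e e0) Ue := xl t.
  have UM : U [set M' | (M <= M')%N] by apply: oU; exists M.
  have [M' [/= H1 H2]] := filter_ex (filterI Ue UM).
  have -> : x t - tpoly M a t = (tpoly M' a t - tpoly M a t) + (x t - tpoly M' a t) by rewrite [RHS]addrC addrA subrK.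
  apply: le_trans (enormD _ _) (lerD (coef_loop_cauchy t H2) _).
  by rewrite enorm_distC; apply: le_trans (ltW H1); exact: ler_norm.
have perx : loop_periodic x.
  move=> t; rewrite /x; have -> // : (fun M => tpoly M a (t + 2 * pi)) = (fun M => tpoly M a t).
  by apply/funext => M; exact: (sob_per (sob_tpoly M a) t).
have sx : square_integrable x.
  apply: (sqi_of_bound _ (circle_integrable_cst ((r 0 + enorm (a 0)) ^+ 2))) => [b|t].
    have mt M := @sqi_meas_comp _ _ (tpoly M a) (fun z => rdot z b) (sqi_tpoly _ _) (@continuous_rdot R n b).
    apply: (measurable_fun_cvg mt) => t _.
    apply/subr_cvg0; apply: (squeeze_norm0 (v := fun M => r M * enorm b)).
      move=> M; rewrite -rdotBl; apply: le_trans (rdot_CS _ _) _.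
      by rewrite ler_wpM2r ?enorm_ge0 // enorm_distC xr.
    by rewrite -(mul0r (enorm b)); apply: cvgMl; exact: coef_loop_r_cvg.
  rewrite lerXn2r ?nnegrE ?addr_ge0 ?enorm_ge0 //.
  rewrite -(subrK (tpoly 0 a t) (x t)) (le_trans (enormD _ _)) // lerD ?xr //.
  by rewrite /tpoly /modes /= big_seq1 subrr /trig enorm_cis.
have fx m : fcoef x m = a m.
  apply/eqP; rewrite -subr_eq0; apply/eqP; apply: enorm_eq0.
  have H M : (`|m| <= M)%N -> enorm (fcoef x m - a m) <= r M.
    move=> mM; have st := @sqi_tpoly R n M a.
    have -> : fcoef x m - a m = fcoef (x - tpoly M a) m by rewrite (fcoefB _ sx st) fcoef_tpoly mM.
    rewrite -(@ler_pXn2r _ 2%N) ?nnegrE ?enorm_ge0 // -(ler_pM2l (@pi2_gt0 R)).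
    apply: le_trans (enorm_fcoef_l2dot _ (sqiB sx st)) _; rewrite mulrC -circle_int_cst l2dot_enorm2.
    apply: circle_int_le; [exact: circle_integrable_enorm2 (sqiB sx st)|exact: circle_integrable_cst|].
    by move=> t _; rewrite lerXn2r ?nnegrE ?enorm_ge0 // xr.
  apply/eqP; rewrite eq_le enorm_ge0 andbT; apply/ler_addgt0Pr => e e0; rewrite add0r.
  have /cvgr0Pnorm_lt/(_ e e0)[M0 _ HM] := coef_loop_r_cvg.
  apply: le_trans (H (maxn M0 (absz m)) (leq_maxr _ _)) _.
  by have := HM _ (leq_maxl M0 (absz m)) => /=; rewrite ger0_norm // => /ltW.
exists x; split=> //; apply: sobP => //.
have [M|//] := @lnorm_finiteP R n x C; apply: le_trans (aC M); apply: ler_sum => m _.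
by rewrite fx exprMn ler_wpM2r ?sqr_ge0 ?sob_weight_le.
Qed.

End RieszFischer.

Section Limit.
Context {R : realType} {n : nat}.
Context {H : cspace R n -> R} {dH : cspace R n -> cspace R n} {kap K Cp rho : R}.
Context (hH : hamiltonian H dH kap K Cp rho).

(** Coefficientwise convergence is convergence in L^2_{1/2}, because beyond
    frequency M the weight of L^2_{1/2} is at most (1 + |m|)^2 / (M + 1): the
    tails are uniformly small. *)
Lemma lnorm_limit (U : set_system nat) (u : nat -> int -> cspace R n) (N : nat -> nat)
    (a : int -> cspace R n) (x : loop R n) (C : R) : ProperFilter U ->
  (forall k m, (N k < `|m|)%N -> u k m = 0) ->
  (forall k M, grad_energy M (u k) <= C) -> (forall M, grad_energy M a <= C) ->
  sob_half x -> (forall m, fcoef x m = a m) ->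
  (forall m, enorm (u k m - a m) @[k --> U] --> (0 : R)) ->
  lnorm (tpoly (N k) (u k) - x) @[k --> U] --> (0 : R).
Proof.
move=> PU uN uC aC sx fx ua.
have C0 : 0 <= C by apply: le_trans (aC 0); apply: sumr_ge0 => m _; exact: sqr_ge0.
have fE k m : fcoef (tpoly (N k) (u k) - x) m = u k m - a m.
  rewrite (fcoefB _ (sqi_tpoly _ _) (sob_sqi sx)) fx fcoef_tpoly; case: leqP => // h.
  by rewrite uN.
pose S M k := \sum_(m <- modes M) sob_weight m * enorm (u k m - a m) ^+ 2.
(* The frequencies up to M, plus a tail bounded uniformly in k. *)
have tail M k : lnorm (tpoly (N k) (u k) - x) ^+ 2 <= S M k + 4 * C / M.+1%:R.
  have M0 : 0 < M.+1%:R :> R by rewrite ltr0n.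
  have [M'|_ //] := @lnorm_finiteP R n (tpoly (N k) (u k) - x) (S M k + 4 * C / M.+1%:R).
  apply: (@le_trans _ _ (\sum_(m <- modes (maxn M M')) sob_weight m * enorm (u k m - a m) ^+ 2)).
    rewrite /sob_partial; under eq_bigr do rewrite fE.
    by apply: sum_modes_mono; [exact: leq_maxr|move=> m; rewrite mulr_ge0 ?sqr_ge0 ?sob_weight_ge0].
  rewrite (bigID (fun m : int => (`|m| <= M)%N)) /= -sum_modes_widen ?leq_maxl // lerD2l.
  apply: (@le_trans _ _ (M.+1%:R^-1 * (2 * grad_energy (maxn M M') (u k) + 2 * grad_energy (maxn M M') a))); last first.
    rewrite mulrC ler_pM2r ?invr_gt0 //; have := uC k (maxn M M'); have := aC (maxn M M').
    by move: (grad_energy _ _) (grad_energy _ _) => p q; lra.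
  rewrite !mulr_sumr -big_split /= mulr_sumr big_mkcond /=; apply: ler_sum => m _.
  have p0 : 0 <= 2 * (grad_weight m * enorm (u k m)) ^+ 2 + 2 * (grad_weight m * enorm (a m)) ^+ 2.
    by rewrite addr_ge0 // mulr_ge0 ?sqr_ge0.
  case: leqP => /= mM; first by rewrite mulr_ge0 // invr_ge0.
  rewrite ler_pdivlMl //.
  have h1 : M.+1%:R * sob_weight m <= grad_weight m ^+ 2 :> R.
    rewrite expr2; apply: ler_pM; [exact: ltW|exact: sob_weight_ge0| |].
      by rewrite grad_weight_nat ler_nat ltnW.
    by rewrite /sob_weight /grad_weight addrC lerD2r; case: eqP.
  have h2 := enorm_sqrD_le (u k m) (- a m); rewrite enormN in h2.
  rewrite mulrA; apply: (@le_trans _ _ (grad_weight m ^+ 2 * (2 * enorm (u k m) ^+ 2 + 2 * enorm (a m) ^+ 2))).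
    apply: ler_pM => //; [by rewrite mulr_ge0 ?sob_weight_ge0 // ltW|exact: sqr_ge0].
  by rewrite !exprMn mulrDr (mulrCA _ 2) (mulrCA _ 2).
have S0 M : S M k @[k --> U] --> (0 : R).
  apply: cvg_sum0 => m _; rewrite (_ : 0 = sob_weight m * (0 * 0)); last by rewrite !mulr0.
  by apply: cvgMr; apply: cvgM; exact: ua.
apply/cvgr0Pnorm_lt => e e0.
have e2 : 0 < e ^+ 2 / 2 by rewrite divr_gt0 // exprn_gt0.
have /cvgr0Pnorm_lt/(_ _ e2)[M _ /(_ M (leqnn M)) /= HM] : 4 * C * M.+1%:R^-1 @[M --> \oo] --> (0 : R).
  by rewrite -(mulr0 (4 * C)); apply: cvgMr; exact: cvg_harmonic.
have /cvgr0Pnorm_lt/(_ _ e2) := S0 M; apply: filterS => k Sk.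
rewrite ger0_norm ?lnorm_ge0 // -(@ltr_pXn2r _ 2%N) ?nnegrE ?lnorm_ge0 ?(ltW e0) //.
apply: le_lt_trans (tail M k) _; have := ler_norm (S M k); have := ler_norm (4 * C / M.+1%:R).
by move: HM Sk; move: (S M k) (4 * C / _) (e ^+ 2) => p q s *; lra.
Qed.

(** Both the action and the coefficients of its gradient pass to the limit; for
    a given frequency m only the degrees N k >= |m| matter. *)
Lemma critical_limit (U : set_system nat) (x : loop R n) (c : nat -> int -> cspace R n)
    (N : nat -> nat) (beta : R) : ProperFilter U -> sob_half x ->
  lnorm (tpoly (N k) (c k) - x) @[k --> U] --> (0 : R) ->
  (forall k, beta <= action H (tpoly (N k) (c k))) ->
  (forall m, \forall k \near U, (`|m| <= N k)%N) ->
  (forall m, (fun k => if (`|m| <= N k)%N then enorm (trunc_grad (dH := dH) (N k) (c k) m) else 0) @ U --> (0 : R)) ->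
  critical_point (action H) x /\ beta <= action H x.
Proof.
move=> PU sx xl Lb NU G0.
pose v k : loop R n := tpoly (N k) (c k) - x.
have sv k : sob_half (v k) by exact: sobB (sob_tpoly _ _) sx.
have xv k : tpoly (N k) (c k) = x + v k by rewrite /v addrC subrK.
split; last first.
  have D k := action_dist hH sx (sv k).
  have D0 : action_lip (K := K) * ((lnorm x + lnorm (v k)) * lnorm (v k)) @[k --> U] --> (0 : R).
    rewrite -(mulr0 (action_lip (K := K))); apply: cvgMr.
    rewrite -(mulr0 (lnorm x + 0)); apply: cvgM => //.
    by apply: cvgD; [exact: cvg_cst|].
  apply/ler_addgt0Pr => e e0; have /cvgr0Pnorm_lt/(_ e e0) := D0.
  move=> /filter_ex[k Dk]; have := Lb k; have := D k; rewrite -xv; move: Dk.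
  move=> /(le_lt_trans (ler_norm _)); move: (action_lip * _) => p pe.
  by rewrite ler_norml => /andP[_]; move: (action _ _) (action _ _) => *; lra.
apply: (critical_of_eq hH sx) => m; apply/eqP; rewrite -subr_eq0; apply/eqP; apply: enorm_eq0.
apply/eqP; rewrite eq_le enorm_ge0 andbT; apply/ler_addgt0Pr => e e0; rewrite add0r.
have E0 : (if (`|m| <= N k)%N then enorm (trunc_grad (dH := dH) (N k) (c k) m) else 0) + (`|m%:~R| * lnorm (v k) + K * lnorm (v k)) @[k --> U] --> (0 : R).
  rewrite -[X in _ --> X](addr0 0); apply: cvgD; first exact: G0.
  rewrite (_ : 0 = `|m%:~R| * 0 + K * 0); last by rewrite !mulr0 addr0.
  by apply: cvgD; apply: cvgMr.
have /cvgr0Pnorm_lt/(_ e e0) Ue := E0.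
have [k [/(le_lt_trans (ler_norm _)) Hk mN]] := filter_ex (filterI Ue (NU m)).
apply: le_trans (ltW Hk); rewrite mN.
have d1 := fcoef_grad_along_dist hH m sx (sv k); rewrite -xv in d1.
have d2 := enorm_fcoef_le m (sob_fin (sv k)).
have fv : fcoef (v k) m = c k m - fcoef x m.
  by rewrite (fcoefB _ (sqi_tpoly _ _) (sob_sqi sx)) fcoef_tpoly mN.
have -> : m%:~R *: fcoef x m - fcoef (grad_along (dH := dH) x) m = trunc_grad (dH := dH) (N k) (c k) m -
   (m%:~R *: fcoef (v k) m - (fcoef (grad_along (dH := dH) (tpoly (N k) (c k))) m - fcoef (grad_along (dH := dH) x) m)).
  rewrite fv /trunc_grad scalerBr; move: (_ *: _) (_ *: _) (fcoef (grad_along _) m) (fcoef (grad_along _) m) => p q s w.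
  have psw : (p - s) + (s - w) = p - w by rewrite addrA subrK.
  by rewrite opprB addrA psw opprB [RHS]addrC addrA subrK.
apply: le_trans (enormB _ _) _; rewrite lerD2l; apply: le_trans (enormB _ _) _.
by rewrite enormZ; apply: lerD => //; rewrite ler_wpM2l.
Qed.

End Limit.

Theorem theorem6 (R : realType) (n : nat) (H : cspace R n -> R) (eps : R)
  (ep : loop R n) (tau alpha beta : R)
  (H_smooth : smooth H)
  (H_zero : \forall z \near (0 : cspace R n), H z = 0)
  (eps_gt0 : 0 < eps)
  (H_infty : exists rho : R, forall z : cspace R n, rho <= enorm z ->
     H z = (1 + eps) * enorm z ^+ 2)
  (ep_Eplus : Eplus ep) (ep_unit : lnorm ep = 1)
  (alpha_gt0 : 0 < alpha) (alpha_lt_tau : alpha < tau) (beta_gt0 : 0 < beta)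
  (action_bd : forall g,
     rel_boundary (Eminus_line ep) (Sigma ep tau) g -> action H g <= 0)
  (action_Gamma : forall g, Gamma alpha g -> beta <= action H g)
  (Sigma_Gamma : Sigma ep tau `&` Gamma alpha =
     [set g | sob_half g /\ lnorm (g - alpha *: ep) = 0]) :
  exists x : loop R n, critical_point (action H) x /\ beta <= action H x.
Proof.
have [K [Cp [rho hH]]] := smooth_hamiltonian H_smooth H_zero H_infty.
have [N0 HN] := galerkin_sequence hH ep_Eplus ep_unit alpha_gt0 alpha_lt_tau beta_gt0 action_bd action_Gamma.
have [N1 [e0 [C2 [e00 HC]]]] := coef_bound hH beta_gt0.
pose N k := (maxn N0 N1 + k)%N.
pose e1 := Num.min 1 e0; have e10 : 0 < e1 by rewrite lt_min ltr01.
(* The bounds on the gradient: their squares are at most e0, as the a priori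
   bound requires, and they tend to zero. *)
pose er k := e1 * k.+1%:R^-1.
have er0 k : 0 < er k by rewrite mulr_gt0 // invr_gt0 ltr0n.
have er1 k : er k <= e1 by rewrite ger_pMr // invf_le1 ?ltr0n // ler1n.
have ere k : er k ^+ 2 <= e0.
  apply: (@le_trans _ _ e1); last by rewrite ge_min lexx orbT.
  apply: le_trans (er1 k); rewrite expr2 ger_pMr //; apply: le_trans (er1 k) _.
  by rewrite ge_min lexx.
have NN k : (N0 <= N k)%N by rewrite /N (leq_trans (leq_maxl N0 N1)) ?leq_addr.
have NN1 k : (N1 <= N k)%N by rewrite /N (leq_trans (leq_maxr N0 N1)) ?leq_addr.
have exc k : exists c, beta <= action H (tpoly (N k) c) /\ trunc_grad_sq (dH := grad H) (N k) c <= er k ^+ 2.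
  by apply: HN => //; rewrite exprn_gt0.
have [c0 Hc0] := choice exc.
(* With the irrelevant coefficients set to 0, the a priori bound holds for the
   sums of any length. *)
pose c k m := if (`|m| <= N k)%N then c0 k m else 0.
have tc k : tpoly (N k) (c k) = tpoly (N k) (c0 k).
  by apply: sum_modes_eq => m mN; rewrite /c mN.
have cC k M : grad_energy M (c k) <= C2.
  have [b1 b2] := Hc0 k; apply: le_trans (HC (N k) (c0 k) (NN1 k) b1 (le_trans b2 (ere k))).
  apply: (@le_trans _ _ (grad_energy (maxn M (N k)) (c k))).
    by apply: sum_modes_mono => [|m]; [exact: leq_maxl|exact: sqr_ge0].
  rewrite /grad_energy (sum_modes_widen _ (leq_maxr M (N k))) [leRHS]big_mkcond; apply: ler_sum => m _.
  by rewrite /c; case: ifP => // _; rewrite enorm0 mulr0 expr0n.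
have [U [UU oU]] := free_ultrafilter; have PU := @ultra_proper _ _ UU.
have exa m : exists l : cspace R n, enorm (c k m - l) @[k --> U] --> (0 : R).
  apply: (ultra_lim_vec (B := C2 + 1)) => k.
  exact: grad_energy_le_bound (cC k (absz m)) (leqnn _).
have [a ca] := choice exa.
have aC M : grad_energy M a <= C2.
  apply: le_trans (ler_norm _) _.
  apply: (@norm_lim_le R nat U (fun k => grad_energy M (c k)) (grad_energy M a) C2 PU) => [|k]; last first.
    by rewrite ger0_norm ?cC // sumr_ge0 // => m _; exact: sqr_ge0.
  apply: cvg_sum_in => m _ _; rewrite !expr2; have E : enorm (c k m) @[k --> U] --> enorm (a m) by exact: enorm_cvg.
  by apply: cvgM; apply: cvgMr.
have [x [sx fx]] := loop_of_coef aC.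
exists x; apply: (critical_limit (U := U) (c := c) (N := N) hH) => //.
- apply: (lnorm_limit (a := a) (C := C2)) => // k m; rewrite /c ltnNge.
  by move=> /negbTE ->.
- by move=> k; rewrite tc; have [] := Hc0 k.
- move=> m; apply: oU; exists (absz m) => // k /= mk.
  by rewrite /N (leq_trans mk) // leq_addl.
move=> m; apply: (squeeze_norm0 (v := er)); last first.
  by apply: (ultra_cvg oU); rewrite -(mulr0 e1); apply: cvgMr; exact: cvg_harmonic.
move=> k; case: ifP => mN; last by rewrite normr0 ltW.
rewrite ger0_norm ?enorm_ge0 // -(@ler_pXn2r _ 2%N) ?nnegrE ?enorm_ge0 ?(ltW (er0 k)) //.
have [_ b2] := Hc0 k; apply: le_trans b2.
rewrite /trunc_grad tc /c mN.
by apply: (@sum_modes_term R (N k) (fun j => enorm (trunc_grad (dH := grad H) (N k) (c0 k) j) ^+ 2) m mN) => j; exact: sqr_ge0.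
Qed.
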